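(* Let $a,b\in\mathbb{R}$ with $0<b<\min\{a-\sqrt2,\,4-2a\}$, let $f(x,y)=(1+y-a|x|,\,bx)$ be the Lozi map on $\mathbb{R}^2$ and let $\rho$ be its SRB measure. For each $x\in\mathbb{R}$ there exists a positive Borel measure $\rho_x$ on $\mathbb{R}^2$ with support on $\ell_x:=\{x\}\times\mathbb{R}$ such that: (a) $\sup_{x\in\mathbb{R}}\rho_x(\ell_x)<\infty$; (b) for all $x\in\mathbb{R}$ and all $A:\mathbb{R}^2\to\mathbb{R}$ bounded and continuous, $$\int_{\mathbb{R}^2}A\,d\rho_x=\lim_{\delta\to0}\frac1{2\delta}\int_{(x-\delta,x+\delta)\times\mathbb{R}}A\,d\rho;$$ (c) for all measurable $E\subseteq\mathbb{R}^2$, $$\rho(E)=\int_{\mathbb{R}}\rho_x(\ell_x\cap E)\,dx.$$ Furthermore, the property in (b) specifies $\rho_x$ uniquely.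
   Context: For these parameters it is known (standing fact) that $f$ is a bijection of $\mathbb{R}^2$ with a strange attractor $\Lambda$, contained in the interior of a compact set $\mathcal{M}$ with $f(\mathcal{M})\subset\operatorname{int}\mathcal{M}$, and a unique SRB probability measure $\rho$, supported on $\Lambda$ (an $f$-invariant probability measure whose conditional measures on local unstable manifolds are absolutely continuous with respect to length). Measurable means Borel measurable. *)

(* Defs.v *)
From HB Require Import structures.
From mathcomp Require Import all_boot all_order all_algebra.
From mathcomp Require Import all_classical all_reals all_analysis.
From mathcomp Require Import measurable_realfun.
From mathcomp Require Import ring.
Set Implicit Arguments.
Unset Strict Implicit.
Unset Printing Implicit Defensive.
Import Order.TTheory GRing.Theory Num.Theory.
Import numFieldNormedType.Exports.
Local Open Scope classical_set_scope.
Local Open Scope ring_scope.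

Definition lozi (R : realType) (a b : R) (p : R * R) : R * R :=
  (1 + p.2 - a * `|p.1|, b * p.1).

Definition lozi_inv (R : realType) (a b : R) (p : R * R) : R * R :=
  (p.2 / b, p.1 - 1 + a * `|p.2 / b|).

Lemma loziK (R : realType) (a b : R) :
  b != 0 -> cancel (lozi a b) (lozi_inv a b).
Proof.
move=> b0 [x y]; rewrite /lozi /lozi_inv /= (mulrC b) mulfK//.
by congr (_, _); ring.
Qed.

Lemma lozi_invK (R : realType) (a b : R) :
  b != 0 -> cancel (lozi_inv a b) (lozi a b).
Proof.
move=> b0 [x y]; rewrite /lozi /lozi_inv /= (mulrC b) divfK//.
by congr (_, _); ring.
Qed.

Definition attracting_set (R : realType) (a b : R) (M : set (R * R)) :
    set (R * R) :=
  \bigcap_n (iter n (lozi a b) @` M).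

Definition segment_path (R : realType) (u v : R * R) (t : R) : R * R :=
  u + t *: (v - u).

Definition open_segment (R : realType) (u v : R * R) : set (R * R) :=
  segment_path u v @` `]0, 1[.

(* one-dimensional (Euclidean) length carried by the segment with endpoints
   u and v, as a set function on the plane *)
Definition segment_length (R : realType) (u v : R * R) (E : set (R * R)) :
    \bar R :=
  let len := Num.sqrt ((v.1 - u.1) ^+ 2 + (v.2 - u.2) ^+ 2) in
  let times := `]0, 1[ `&` segment_path u v @^-1` E in
  (len%:E * lebesgue_measure times)%E.

(* The Lozi map is affine on each side of the line x = 0, so its local unstable
   manifolds are line segments: open segments on which every backward iterate
   is affine (no preimage meets the line x = 0) and whose points have mutually
   asymptotic backward orbits. *)
Definition local_unstable (R : realType) (a b : R) (u v : R * R) : Prop :=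
  [/\ u != v,
      (forall (n : nat) (p : R * R), (0 < n)%N -> open_segment u v p ->
         (iter n (lozi_inv a b) p).1 != 0) &
      (forall p q : R * R, open_segment u v p -> open_segment u v q ->
         (fun n : nat => `|iter n (lozi_inv a b) p - iter n (lozi_inv a b) q|)
           @ \oo --> (0 : R))].

(* rho is an invariant probability measure admitting a measurable partition
   subordinate to the local unstable manifolds, with conditional measures
   absolutely continuous with respect to length.  The measurable partition is
   the partition into fibres of a Borel function xi, and kappa (xi p) is the
   conditional measure of rho on the atom of p.  Subordinate means that, for
   almost every p, the atom of p is contained in a local unstable manifold
   through p and contains a neighbourhood of p in it. *)
Definition SRB_measure (R : realType) (a b : R)
    (rho : probability (R * R)%type R) : Prop :=
  (forall E : set (R * R), measurable E -> rho (lozi a b @^-1` E) = rho E) /\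
  exists (xi : R * R -> R) (kappa : R.-pker R ~> (R * R)%type),
    [/\ measurable_fun setT xi,
        (forall (E : set (R * R)) (B : set R), measurable E -> measurable B ->
           rho (E `&` xi @^-1` B) =
             (\int[rho]_(p in xi @^-1` B) kappa (xi p) E)%E) &
        {ae rho, forall p : R * R, exists u v : R * R,
           [/\ local_unstable a b u v,
               open_segment u v p,
               xi @^-1` [set xi p] `<=` open_segment u v,
               (\forall q \near p, open_segment u v q -> xi q = xi p) &
               kappa (xi p) `<< segment_length u v]}].

Definition vertical_line (R : realType) (x : R) : set (R * R) :=
  [set x] `*` setT.

Definition vertical_strip (R : realType) (x d : R) : set (R * R) :=
  `]x - d, x + d[ `*` setT.

(* The integrals are extended-real valued, and not Rintegral, so that the case
   A = 1 rules out any infinite nu when the limit is finite. *)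
Definition strip_limit (R : realType) (rho : probability (R * R)%type R)
    (x : R) (nu : {measure set (R * R)%type -> \bar R}) : Prop :=
  forall A : R * R -> R, continuous A ->
    (exists K : R, forall p : R * R, `|A p| <= K) ->
    (((2 * d)^-1)%:E * \int[rho]_(p in vertical_strip x d) (A p)%:E)%E
      @[d --> 0^'+] --> (\int[nu]_p (A p)%:E)%E.

(* Main.v *)
From HB Require Import structures.
Require Import Defs.
From mathcomp Require Import all_boot all_order all_algebra.
From mathcomp Require Import all_classical all_reals all_analysis.
From mathcomp Require Import measurable_realfun.
From mathcomp Require Import ring lra.
Set Implicit Arguments.
Unset Strict Implicit.
Unset Printing Implicit Defensive.
Import Order.TTheory GRing.Theory Num.Theory.
Import numFieldNormedType.Exports.
Local Open Scope classical_set_scope.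
Local Open Scope ring_scope.

(** Why the theorem is true. Everything rests on one estimate: the measure of a
    vertical strip of half-width [d] is at most [2 * d * L], where [L] depends
    only on [a] and [b], and [L] also bounds the integrals of suitable signed
    combinations of strips. It is a consequence of hyperbolicity.

    Local unstable manifolds are segments whose direction [w] lies in the cone
    [|w.2| <= b * |w.1|] ([local_unstable_cone]): a vector outside the cone is
    expanded under backward iteration. The map stretches the horizontal extent
    of a segment in the cone by at least [a - b], and it may fold the segment
    on the line [x = 0]. The attractor lies above a height larger than [-1]
    ([attracting_set_above]), so the image of a point near the line [x = 0] is
    well to the right of it, and a short segment is folded at most once in two
    steps. Since [(a - b) ^+ 2 > 2], stretching wins. Consequently, let [g] be
    a bounded Borel function whose integral along any segment of the cone is
    at most [1 / |w.1|] in affine time, and let [phi n] be [g] composed with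
    [2 * n] iterates of the map. The integral of [phi n] along a segment is at
    most [L] times the duration, up to a geometrically small error
    ([segment_bounded_iter]). The conditional measures of [rho] on unstable
    segments have densities, hence the means of [phi n] for these measures are
    asymptotically at most [L] ([fibre_bound]). By invariance the integral of
    [g] is the average of these means for every [n], and it is at most [L]
    ([segment_bounded_Rintegral]).

    Fix [x] and a height [c], and let [strip_density rho x c d] be the mass of
    the part of the strip of half-width [d] around [x] that is below [c],
    divided by [2 * d]. Along a segment, the corresponding integral is a
    difference of two clamped functions [clamp (be / d)] and [clamp (al / d)]
    ([segment_strip_ratio]). It is therefore bounded, and its variation in [d]
    is bounded too, so the estimate applies both to one strip and to a signed
    sum over a partition of the values of [d]. The strip density is bounded by
    [L] and has variation at most [L] in [d], and so it converges as [d] tends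
    to 0 for every [x] and [c] without exception ([strip_density_cvg]).

    The limit is nondecreasing in [c], and its right-continuous modification is
    the distribution function of a measure on the vertical line, the slice.
    Riemann-Stieltjes sums over a grid of heights show that strip averages of
    continuous functions converge to integrals against the slice
    ([slice_strip_limit]). By Tonelli the integral of the strip densities over
    the centres [x <= s] is the mass of the quadrant [x <= s, y <= c] up to
    [2 * d * L] ([window_strip_density]); in the limit, the slices disintegrate
    [rho] on quadrants, hence on Borel sets ([slice_disintegrates]). Finally, a
    finite measure on the plane is determined by the integrals of bounded
    continuous functions ([measure_unique_continuous]), whence uniqueness. *)

(** * Parameters *)
Section parameters.
Context {R : realType} (a b : R).

(** Here [a - b] is the least horizontal stretch of a vector of the unstable
    cone. Its square exceeds 2, so that two steps stretch more than one fold
    can compensate, and [param_drop] keeps the attractor above the height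
    [-1]. *)
Record hyperbolic : Prop := Hyperbolic {
  param_b_gt0 : 0 < b ;
  param_b_lt1 : b < 1 ;
  param_stretch : 1 < a - b ;
  param_stretch2 : 2 < (a - b) ^+ 2 ;
  param_drop : b < (1 - b) * (a - 1) }.

Lemma lozi_hyperbolic : 0 < b -> b < Num.min (a - Num.sqrt 2) (4 - 2 * a) ->
  hyperbolic.
Proof.
rewrite lt_min => b0 /andP[bs b4].
have s2 : Num.sqrt 2 ^+ 2 = 2 :> R by rewrite sqr_sqrtr.
have s0 : 0 <= Num.sqrt 2 :> R by exact: sqrtr_ge0.
move: (Num.sqrt 2) s2 s0 bs => s s2 s0 bs.
(* eliminating [a] gives [3 * b < 4 - 2 * s], whence the bound 2/5 *)
have s14 : 7/5 < s by nra.
have b25 : b < 2/5 by lra.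
by split => //; nra.
Qed.

End parameters.

(** * The attractor lies above a horizontal line *)
Section attractor.
Context {R : realType} (a b : R) (M : set (R * R)).
Hypothesis hyp : hyperbolic a b.
Hypothesis cM : compact M.
Hypothesis fM : lozi a b @` M `<=` M°.

Let b_neq0 : b != 0. Proof. by rewrite gt_eqF//; case: hyp. Qed.

Lemma attracting_set_lozi q : attracting_set a b M q ->
  attracting_set a b M (lozi a b q).
Proof.
move=> Lq [|n] _.
  have [p Mp /= <-] := Lq 0%N I; exists (lozi a b p) => //.
  by apply: interior_subset; apply: fM; exists p.
by have [p Mp <-] := Lq n I; exists p.
Qed.

Lemma attracting_set_lozi_inv q : attracting_set a b M q ->
  attracting_set a b M (lozi_inv a b q).
Proof.
move=> Lq n _; have [p Mp <-] := Lq n.+1 I.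
by exists p => //; rewrite iterS loziK.
Qed.

Lemma attracting_set_bounded : exists L : R, 0 < L /\
  forall q, attracting_set a b M q -> `|q.1| <= L /\ `|q.2| <= L.
Proof.
have [L [_ ML]] := compact_bounded cM.
exists (`|L| + 1); split; first by rewrite ltr_wpDl.
move=> q Lq; have /ML/(_ q) : L < `|L| + 1 by rewrite ltr_pwDr ?ler_norm.
have [p Mp /= <-] := Lq 0%N I => /(_ Mp).
by rewrite prod_normE ge_max => /andP[].
Qed.

Definition floor_height : R := - (b / ((1 - b) * (a - 1))).

(** The image of a point of height [y] on the line [x = 0] has abscissa
    [1 + y], so a segment of the attractor that has just been folded is away
    from the next fold. *)
Lemma floor_height_gtN1 : - 1 < floor_height.
Proof.
have [b0 b1 ab ab2 bd] := hyp.
by rewrite ltrN2 ltr_pdivrMr ?mul1r//; apply: lt_trans bd.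
Qed.

(** Let [s] be the supremum of the abscissas on the attractor. The height of a
    point is [b] times the abscissa of its preimage, so the abscissa of its
    image is at most [1 + b * s], whence [s <= 1 / (1 - b)]. As this image is
    again in the attractor, the abscissas [x] satisfy
    [a * |x| <= 1 + b * s - i], where [i] is their infimum, and this bounds
    [i] from below by [- 1 / ((1 - b) * (a - 1))]. *)
Lemma attracting_set_above q : attracting_set a b M q -> floor_height <= q.2.
Proof.
have [b0 b1 ab ab2 bd] := hyp.
have [L [L0 LL]] := attracting_set_bounded.
have lozi1 p : (lozi a b p).1 = 1 + p.2 - a * `|p.1| by [].
have lozi2 p : (lozi a b p).2 = b * p.1 by [].
have inv2 p : p.2 = b * (lozi_inv a b p).1 by rewrite /lozi_inv/= mulrC divfK.
move=> Lq; pose X := [set p.1 | p in attracting_set a b M].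
have X0 : X !=set0 by exists q.1; exists q.
have hX : has_sup X.
  split => //; exists L => _ [p Lp <-]; have [h _] := LL p Lp.
  exact: le_trans (ler_norm _) h.
have hN : has_inf X.
  split => //; exists (- L) => _ [p Lp <-]; have [h _] := LL p Lp.
  by rewrite lerNl; apply: le_trans h; rewrite -normrN ler_norm.
have Xsup p : attracting_set a b M p -> p.1 <= sup X.
  by move=> Lp; apply: sup_upper_bound => //; exists p.
have Xinf p : attracting_set a b M p -> inf X <= p.1.
  by move=> Lp; apply: ge_inf; [case: hN|exists p].
have sX : sup X <= 1 + b * sup X.
  apply: ge_sup => // _ [p Lp <-].
  rewrite -(lozi_invK a b_neq0 p) lozi1 inv2.
  have := Xsup _ (attracting_set_lozi_inv (attracting_set_lozi_inv Lp)).
  have : 0 <= `|(lozi_inv a b p).1| by [].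
  by nra.
have sX1 : (1 - b) * sup X <= 1 by lra.
have iX : -1 <= (1 - b) * ((a - 1) * inf X).
  have : (a * - inf X) <= (1 + b * sup X) - inf X.
    have h : forall p, attracting_set a b M p ->
      - p.1 <= ((1 + b * sup X) - inf X) / a.
      move=> p Lp; rewrite ler_pdivlMr; last by lra.
      have := Xinf _ (attracting_set_lozi Lp); rewrite lozi1.
      have : - p.1 <= `|p.1| by rewrite -normrN ler_norm.
      rewrite (inv2 p).
      have := Xsup _ (attracting_set_lozi_inv Lp).
      by nra.
    have : - (((1 + b * sup X) - inf X) / a) <= inf X.
      by apply: lb_le_inf => // _ [r Lr <-]; have := h r Lr; lra.
    rewrite lerNl ler_pdivlMr; last by lra.
    by rewrite mulrC.
  by nra.
rewrite (inv2 q) /floor_height.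
have := Xinf _ (attracting_set_lozi_inv Lq).
have d0 : 0 < (1 - b) * (a - 1) by exact: lt_trans bd.
rewrite -(ler_pM2l d0) => Dx; rewrite lerNl ler_pdivlMr//.
have : -1 <= (1 - b) * (a - 1) * (lozi_inv a b q).1.
  by apply: le_trans Dx; rewrite -mulrA.
move: ((1 - b) * (a - 1)) (lozi_inv a b q).1 => D x ?.
have /(ler_wpM2l (ltW b0)) : - (D * x) <= 1 by lra.
by lra.
Qed.

End attractor.

(** * Unstable segments lie in a cone *)
Section unstable_direction.
Context {R : realType} (a b : R).
Hypothesis hyp : hyperbolic a b.

(** Segments are followed in affine time, because an affine branch of the map
    then sends rays to rays without a change of time. *)
Definition ray (p w : R * R) (t : R) : R * R := (p.1 + t * w.1, p.2 + t * w.2).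

Lemma segment_path_ray (u v : R * R) : segment_path u v = ray u (v - u).
Proof. by apply/funext => t. Qed.

Lemma affine_sign (x y : R) : (forall t, 0 < t < 1 -> x + t * y != 0) ->
  (forall t, 0 < t < 1 -> 0 < x + t * y) \/
  (forall t, 0 < t < 1 -> x + t * y < 0).
Proof.
move=> xy.
have h2 : 0 < (2^-1 : R) < 1 by lra.
have key s t : 0 < s < 1 -> 0 < t < 1 -> 0 < x + s * y -> x + t * y < 0 -> False.
  move=> s01 t01 sp tn.
  have y0 : y != 0.
    by apply/eqP => y0; move: sp tn; rewrite y0 !mulr0 => ? ?; lra.
  have e : x + (- x / y) * y = 0 by rewrite divfK// subrr.
  have nr : ~ (0 < - x / y < 1) by move=> h; have := xy _ h; rewrite e eqxx.
  apply: nr; move: (- x / y) e => r e.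
  have [yn|yp|yy] := ltgtP y 0; last by move: y0; rewrite yy eqxx.
    have ? : r < t by rewrite -subr_gt0 -(nmulr_llt0 _ yn); lra.
    have ? : s < r by rewrite -subr_gt0 -(nmulr_llt0 _ yn); lra.
    by lra.
  have ? : t < r by rewrite -subr_gt0 -(pmulr_lgt0 _ yp); lra.
  have ? : r < s by rewrite -subr_gt0 -(pmulr_lgt0 _ yp); lra.
  by lra.
have [hp|hn|] := ltgtP 0 (x + 2^-1 * y); last by move/esym/eqP; rewrite (negbTE (xy _ h2)).
- left=> t t01; have [//|tn|] := ltgtP 0 (x + t * y).
    by have := key _ _ h2 t01 hp tn.
  by move/esym/eqP; rewrite (negbTE (xy _ t01)).
- right=> t t01; have [tp|//|] := ltgtP 0 (x + t * y).
    by have := key _ _ t01 h2 tp hn.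
  by move/esym/eqP; rewrite (negbTE (xy _ t01)).
Qed.

(** The inverse branches send [w] to [(w.2 / b, w.1 + e * w.2 / b)], where
    [|e| = a]. If [w] is outside the cone then so is its image, because
    [a - b > 1], and its horizontal extent is at least [|w.2| / b] from the
    first step on. The backward orbits of two points of the segment would stay
    at a positive distance. *)
Lemma local_unstable_cone u v : local_unstable a b u v ->
  (v - u).1 != 0 /\ `|(v - u).2| <= b * `|(v - u).1|.
Proof.
have [b0 b1 ab ab2 bd] := hyp.
case=> uv avoid asym.
set w := v - u.
have seg t : 0 < t < 1 -> open_segment u v (ray u w t).
  by move=> t01; exists t; rewrite ?segment_path_ray//= in_itv.
suff cone : `|w.2| <= b * `|w.1|.
  split=> //; apply/eqP => w10; move: cone; rewrite w10 normr0 mulr0.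
  rewrite normr_le0 => /eqP w20; move: uv; rewrite eq_sym -subr_eq0 => /eqP; apply.
  by rewrite -/w [w]surjective_pairing w10 w20.
rewrite leNgt; apply/negP => steep.
have h14 : 0 < (4^-1 : R) < 1 by lra.
have h12 : 0 < (2^-1 : R) < 1 by lra.
(* the [n]-th preimage of the segment is a segment of direction [z] *)
have aff n : exists p z, [/\ forall t, 0 < t < 1 ->
    iter n (lozi_inv a b) (ray u w t) = ray p z t,
    b * `|z.1| < `|z.2| & ((0 < n)%N -> `|w.2| / b <= `|z.1|)].
  elim: n => [|n [p [z [pz stz grow]]]]; first by exists u, w.
  have nz t : 0 < t < 1 -> p.2 / b + t * (z.2 / b) != 0.
    move=> t01; have := avoid n.+1 (ray u w t) isT (seg t t01).
    by rewrite iterS pz//= mulrDl mulrA.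
  have z1 : `|z.1| < `|z.2| / b by rewrite ltr_pdivlMr// mulrC.
  have bi : `|b^-1| = b^-1 by rewrite gtr0_norm ?invr_gt0.
  have growS : `|w.2| / b <= `|z.2 / b|.
    rewrite normrM bi; case: n pz grow nz => [pz _ _|n _ grow _].
      have e0 : ray u w 4^-1 = ray p z 4^-1 by rewrite -pz.
      have e1 : ray u w 2^-1 = ray p z 2^-1 by rewrite -pz.
      have -> // : w.2 = z.2.
      by have := congr1 snd e0; have := congr1 snd e1; rewrite /ray/=; lra.
    exact: le_trans (grow isT) (ltW z1).
  have steepS e : `|e| = a -> b * `|z.2 / b| < `|z.1 + e * (z.2 / b)|.
    move=> ea; have hE : `|e * (z.2 / b)| = a * (`|z.2| / b) by rewrite !normrM ea bi.
    have bz : b * (`|z.2| / b) = `|z.2| by rewrite mulrCA divff ?gt_eqF// mulr1.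
    rewrite normrM bi bz.
    have := lerB_dist (e * (z.2 / b)) (- z.1); rewrite opprK normrN [_ + z.1]addrC hE.
    have := normr_ge0 z.1; rewrite -{2}bz.
    move: (`|z.1 + _|) (`|z.2| / b) `|z.1| z1 => A B C CB C0 h1.
    have : 0 < (a - b - 1) * B by apply: mulr_gt0; lra.
    by lra.
  have [pos|neg] := affine_sign nz.
  - exists (p.2 / b, p.1 - 1 + a * (p.2 / b)), (z.2 / b, z.1 + a * (z.2 / b)).
    split=> //=; last by apply: steepS; rewrite ger0_norm//; lra.
    move=> t t01; rewrite pz// /lozi_inv /ray /=.
    have -> : (p.2 + t * z.2) / b = p.2 / b + t * (z.2 / b) by rewrite mulrDl mulrA.
    by rewrite (gtr0_norm (pos t t01)); congr pair; ring.
  - exists (p.2 / b, p.1 - 1 - a * (p.2 / b)), (z.2 / b, z.1 + (- a) * (z.2 / b)).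
    split=> //=; last by apply: steepS; rewrite normrN ger0_norm//; lra.
    move=> t t01; rewrite pz// /lozi_inv /ray /=.
    have -> : (p.2 + t * z.2) / b = p.2 / b + t * (z.2 / b) by rewrite mulrDl mulrA.
    by rewrite (ltr0_norm (neg t t01)); congr pair; ring.
have w2 : 0 < `|w.2| by apply: le_lt_trans steep; rewrite mulr_ge0// ltW.
(* the preimages of the points at times 1/2 and 1/4 differ by [|z.1| / 4] *)
have := asym _ _ (seg _ h12) (seg _ h14).
have e0 : 0 < `|w.2| / b / 4 by rewrite !divr_gt0.
move=> /cvgrPdist_lt/(_ _ e0)[N _ /(_ N.+1 (leqnSn N))].
have [p [z [pz _ /(_ isT) grow]]] := aff N.+1.
rewrite !pz// sub0r normrN normr_id prod_normE gt_max => /andP[+ _].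
rewrite /= opprD addrACA subrr add0r -mulrBl normrM.
have -> : 2^-1 - 4^-1 = 4^-1 :> R by lra.
rewrite ger0_norm; last lra.
by rewrite ltNge => /negP; apply; rewrite mulrC ler_pM2l; lra.
Qed.

End unstable_direction.

(** * Bounded measurable functions and interval integrals *)
Section bounded_measurable.
Context {d} {T : measurableType d} {R : realType}.
Implicit Types (f g : T -> R) (A D P : set T) (mu : {measure set T -> \bar R}).

Definition bounded_measurable f :=
  measurable_fun setT f /\ exists S : R, forall x, `|f x| <= S.

Lemma bounded_measurable_cst (c : R) : bounded_measurable (cst c).
Proof. by split => //; exists `|c|. Qed.

Lemma bounded_measurable_indic A : measurable A -> bounded_measurable (\1_A).
Proof.
move=> mA; split; first exact: measurable_indic.
by exists 1 => x; rewrite indicE; case: (_ \in _); rewrite ?normr1 ?normr0.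
Qed.

Lemma bounded_measurable_normr f : bounded_measurable f ->
  bounded_measurable (fun x => `|f x|).
Proof.
move=> [mf [S fS]]; split; first exact: measurableT_comp.
by exists S => x; rewrite normr_id.
Qed.

Lemma bounded_measurableM f g : bounded_measurable f -> bounded_measurable g ->
  bounded_measurable (fun x => f x * g x).
Proof.
move=> [mf [S fS]] [mg [S' gS']]; split; first exact: measurable_funM.
by exists (S * S') => x; rewrite normrM; apply: ler_pM.
Qed.

Lemma bounded_measurableD f g : bounded_measurable f -> bounded_measurable g ->
  bounded_measurable (fun x => f x + g x).
Proof.
move=> [mf [S fS]] [mg [S' gS']]; split; first exact: measurable_funD.
by exists (S + S') => x; apply: (le_trans (ler_normD _ _)); apply: lerD.
Qed.

Lemma bounded_measurableB f g : bounded_measurable f -> bounded_measurable g ->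
  bounded_measurable (fun x => f x - g x).
Proof.
move=> [mf [S fS]] [mg [S' gS']]; split; first exact: measurable_funB.
by exists (S + S') => x; apply: (le_trans (ler_normB _ _)); apply: lerD.
Qed.

Lemma bounded_measurable_integrable mu D f : measurable D -> (mu D < +oo)%E ->
  bounded_measurable f -> mu.-integrable D (EFin \o f).
Proof.
move=> mD Doo [mf [S fS]]; apply: measurable_bounded_integrable => //.
  exact: measurable_funS mf.
exists S; split=> [|x Sx y _]; first exact: num_real.
by apply: le_trans (fS y) _; exact: ltW.
Qed.

Lemma Rintegral_split mu D P f : measurable D -> (mu D < +oo)%E ->
  measurable P -> bounded_measurable f ->
  \int[mu]_(x in D) f x =
  \int[mu]_(x in D `&` P) f x + \int[mu]_(x in D `&` ~` P) f x.
Proof.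
move=> mD Doo mP bf.
have {1}-> : D = (D `&` P) `|` (D `&` ~` P) by rewrite -setIUr setUv setIT.
rewrite Rintegral_setU//.
- exact: measurableI.
- by apply: measurableI => //; exact: measurableC.
- by rewrite -setIUr setUv setIT; exact: bounded_measurable_integrable.
- by apply/disj_setPS => x [[_ ?] [_ ?]].
Qed.

Lemma fine_measure_split mu D P : measurable D -> (mu D < +oo)%E ->
  measurable P ->
  fine (mu D) = fine (mu (D `&` P)) + fine (mu (D `&` ~` P)).
Proof.
move=> mD Doo mP.
have mP' : measurable (D `&` P) by exact: measurableI.
have mPC : measurable (D `&` ~` P).
  by apply: measurableI => //; exact: measurableC.
have lt1 A : measurable A -> A `<=` D -> mu A \is a fin_num.
  move=> mA AD; rewrite ge0_fin_numE//; apply: le_lt_trans Doo.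
  by apply: le_measure; rewrite ?inE.
rewrite -fineD ?lt1// -measureU//.
  by rewrite -setIUr setUv setIT.
by rewrite setIACA setICr setI0.
Qed.

Lemma fine_measure_le mu D P : measurable D -> (mu D < +oo)%E ->
  measurable P -> P `<=` D -> (mu P < +oo)%E /\ fine (mu P) <= fine (mu D).
Proof.
move=> mD Doo mP PD.
have PDle : (mu P <= mu D)%E by apply: le_measure; rewrite ?inE.
have Poo : (mu P < +oo)%E by exact: le_lt_trans Doo.
by split=> //; apply: fine_le; rewrite ?ge0_fin_numE.
Qed.

End bounded_measurable.

Section intervals.
Context {R : realType}.
Implicit Types (J : set R) (x y c : R).
Notation mu := (@lebesgue_measure R).

Lemma is_intervalI J J' : is_interval J -> is_interval J' ->
  is_interval (J `&` J').
Proof.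
move=> iJ iJ' x y [Jx J'x] [Jy J'y] z xzy; split; first exact: (iJ x y).
exact: (iJ' x y).
Qed.

Lemma is_interval_affine_ge c x y : is_interval [set t | c <= x + t * y].
Proof.
move=> s t /= hs ht z /andP[sz zt].
have [y0|y0] := leP 0 y.
  by have := ler_wpM2r y0 sz; lra.
by have := ler_wnM2r (ltW y0) zt; lra.
Qed.

Lemma is_interval_affine_lt c x y : is_interval [set t | x + t * y < c].
Proof.
move=> s t /= hs ht z /andP[sz zt].
have [y0|y0] := leP 0 y.
  by have := ler_wpM2r y0 zt; lra.
by have := ler_wnM2r (ltW y0) sz; lra.
Qed.

Lemma interval_dist_le J s t : is_interval J -> (mu J < +oo)%E -> J s -> J t ->
  `|s - t| <= fine (mu J).
Proof.
move=> iJ Joo.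
wlog st : s t / s <= t.
  move=> W Js Jt; have [/W|/ltW/W] := leP s t; first exact.
  by rewrite distrC; exact.
move=> Js Jt; rewrite distrC ger0_norm ?subr_ge0//.
have := @fine_measure_le _ _ _ mu J `[s, t]%classic
  (is_interval_measurable iJ) Joo (measurable_itv _).
case=> [z /=|_]; first by rewrite in_itv/=; exact: iJ.
rewrite /= lebesgue_measure_itv/= lte_fin.
have [->|ns] := eqVneq s t; first by rewrite ltxx subrr/=.
by rewrite lt_neqAle ns st/=.
Qed.

(** The interval is cut into pieces of length [l]. All of them but one are full,
    so the constant [k] is paid at most once more than the length divided by
    [l]. *)
Lemma Rintegral_subdivision (f : R -> R) (l k be : R) :
  bounded_measurable f -> 0 < l -> 0 <= k ->
  (forall J, is_interval J -> (mu J < +oo)%E ->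
     (forall s t, J s -> J t -> `|s - t| <= l) ->
     `|\int[mu]_(t in J) f t| <= k + be * fine (mu J)) ->
  forall J, is_interval J -> (mu J < +oo)%E ->
     `|\int[mu]_(t in J) f t| <= k + (be + k / l) * fine (mu J).
Proof.
move=> bf l0 k0 short.
have claim n : forall J, is_interval J -> (mu J < +oo)%E ->
     (forall s t, J s -> J t -> `|s - t| <= l *+ n.+1) ->
     `|\int[mu]_(t in J) f t| <= k *+ n.+1 + be * fine (mu J).
  elim: n => [|n IH] J iJ Joo Jd; first exact: short.
  have [[t0 Jt0]|J0] := pselect (J !=set0); last first.
    have -> : J = set0 by apply/eqP/negPn/negP => /set0P.
    by rewrite Rintegral_set0 measure0 normr0/= mulr0 addr0 mulrn_wge0.
  have hlb : has_lbound J.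
    exists (t0 - l *+ n.+2) => s Js; have := Jd _ _ Js Jt0.
    by rewrite ler_norml => /andP[]; lra.
  have hi : has_inf J by split; [exists t0|].
  pose P := [set t | t < inf J + l].
  have PE : P = [set t | 0 + t * 1 < inf J + l].
    by apply/seteqP; split => t /=; rewrite add0r mulr1.
  have PCE : ~` P = [set t | inf J + l <= 0 + t * 1].
    by apply/seteqP; split => t /=; rewrite add0r mulr1 leNgt => /negP.
  have iP : is_interval P by rewrite PE; exact: is_interval_affine_lt.
  have iPC : is_interval (~` P) by rewrite PCE; exact: is_interval_affine_ge.
  have mJ := is_interval_measurable iJ; have mP := is_interval_measurable iP.
  have mPC := is_interval_measurable iPC.
  rewrite (Rintegral_split (mu:=mu) mJ Joo mP bf) (fine_measure_split (mu:=mu) mJ Joo mP) mulrDr.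
  have [oo1 _] := fine_measure_le (mu:=mu) mJ Joo (measurableI _ _ mJ mP) (@subIsetl _ _ _).
  have [oo2 _] := fine_measure_le (mu:=mu) mJ Joo (measurableI _ _ mJ mPC) (@subIsetl _ _ _).
  have inf_le t : J t -> inf J <= t by move=> Jt; apply: ge_inf.
  have b1 := short _ (is_intervalI iJ iP) oo1.
  have b2 := IH _ (is_intervalI iJ iPC) oo2.
  apply: (le_trans (ler_normD _ _)); rewrite mulrS.
  rewrite addrACA; apply: lerD; [apply: b1|apply: b2].
    move=> s t [Js Ps] [Jt Pt]; have := inf_le _ Js; have := inf_le _ Jt.
    by move: Ps Pt; rewrite /P/= ler_norml; lra.
  have up s : J s -> s <= inf J + l *+ n.+2.
    move=> Js; rewrite addrC -lerBlDl.
    apply: lb_le_inf; first by exists t0.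
    by move=> t Jt; have := Jd _ _ Js Jt; rewrite ler_norml => /andP[]; lra.
  move=> s t [Js /negP Ps] [Jt /negP Pt]; have := up _ Js; have := up _ Jt.
  move: Ps Pt; rewrite /P/= -!leNgt (mulrS _ n.+1) ler_norml.
  by move: (l *+ n.+1) => z; lra.
move=> J iJ Joo.
set m := fine (mu J); have m0 : 0 <= m by exact: fine_ge0.
pose n := Num.truncn (m / l).
have /andP[nle nlt] : n%:R <= m / l < n.+1%:R.
  by apply: truncn_itv; rewrite divr_ge0// ltW.
have := claim n J iJ Joo; rewrite -/m => h.
apply: (le_trans (h _)).
  move=> s t Js Jt; apply: (le_trans (interval_dist_le iJ Joo Js Jt)).
  by rewrite -/m -mulr_natr mulrC -ler_pdivrMr// ltW.
rewrite mulrS -addrA lerD2l mulrDl addrC lerD2l.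
rewrite -mulr_natr mulrAC -mulrA; exact: ler_wpM2l.
Qed.

End intervals.

(** * Growth of unstable segments *)
Section growth.
Context {R : realType} (a b : R).
Hypothesis hyp : hyperbolic a b.
Notation mu := (@lebesgue_measure R).
Let y0 := floor_height a b.
(** The least horizontal stretch of a vector of the cone. *)
Let mon := a - b.

(** The cut-off below the floor of the attractor does not change integrals
    against the invariant measure. It discards the part of a segment that may
    be folded twice in two steps. *)
Definition pullback (phi : R * R -> R) (q : R * R) : R :=
  if y0 <= q.2 then phi (lozi a b q) else 0.

Lemma measurable_lozi : measurable_fun setT (lozi a b).
Proof.
apply: measurable_fun_pair => /=.
  apply: (@measurable_funB _ _ _ _ (fun q : R * R => 1 + q.2)
    (fun q : R * R => a * `|q.1|)).
    exact: measurable_funD.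
  by apply: measurable_funM => //; exact: measurableT_comp.
exact: measurable_funM.
Qed.

Lemma measurable_ray (p w : R * R) : measurable_fun setT (ray p w).
Proof.
by apply: measurable_fun_pair; apply: measurable_funD => //;
  exact: measurable_funM.
Qed.

Lemma bounded_measurable_pullback phi : bounded_measurable phi ->
  bounded_measurable (pullback phi).
Proof.
move=> [mf [S fS]]; split.
  apply: measurable_fun_ifT => //=.
    by apply: measurable_fun_ler => //; exact: measurable_snd.
  exact: measurableT_comp mf measurable_lozi.
exists S => x; rewrite /pullback; case: ifPn => // _; rewrite normr0.
exact: le_trans (fS (0, 0)).
Qed.

Lemma bounded_measurable_ray (phi : R * R -> R) p w : bounded_measurable phi ->
  bounded_measurable (phi \o ray p w).
Proof.
move=> [mf [S fS]]; split; last by exists S => x; exact: fS.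
exact: measurableT_comp mf (measurable_ray p w).
Qed.

(** Multiplied by [|w.1|], the bound says that the integral with respect to
    horizontal length is at most [al] plus [be] times the length. The constant
    [al] is what counts for short segments, and what expansion reduces. *)
Definition segment_bounded (phi : R * R -> R) (al be : R) : Prop :=
  forall (p w : R * R) (J : set R), w.1 != 0 -> `|w.2| <= b * `|w.1| ->
    is_interval J -> (mu J < +oo)%E ->
    `|\int[mu]_(t in J) phi (ray p w t)| <= al / `|w.1| + be * fine (mu J).

(** The affine map that agrees with the Lozi map where [|x| = s * x], for a sign
    [s]. *)
Definition branch (s : R) (p : R * R) : R * R := (1 + p.2 - s * a * p.1, b * p.1).
Definition branch_lin (s : R) (w : R * R) : R * R := (w.2 - s * a * w.1, b * w.1).

Definition one_sided (s : R) (p w : R * R) (J : set R) :=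
  forall t, J t -> `|(ray p w t).1| = s * (ray p w t).1.

Lemma lozi_ray s p w t : `|(ray p w t).1| = s * (ray p w t).1 ->
  lozi a b (ray p w t) = ray (branch s p) (branch_lin s w) t.
Proof.
rewrite /lozi /branch /branch_lin /ray /= => ->.
by congr pair; ring.
Qed.

(** In the cone, [w.2] removes at most [b * |w.1|] from the stretch [a * |w.1|]. *)
Lemma branch_cone s w : `|s| = 1 -> w.1 != 0 -> `|w.2| <= b * `|w.1| ->
  [/\ (branch_lin s w).1 != 0,
      `|(branch_lin s w).2| <= b * `|(branch_lin s w).1| &
      mon * `|w.1| <= `|(branch_lin s w).1|].
Proof.
have [b0 b1 ab ab2 bd] := hyp.
move=> s1 w0 cone; have w1 : 0 < `|w.1| by rewrite normr_gt0.
have saw : `|s * a * w.1| = a * `|w.1|.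
  by rewrite !normrM s1 mul1r ger0_norm//; lra.
have grow : mon * `|w.1| <= `|(branch_lin s w).1|.
  have := lerB_dist (s * a * w.1) w.2; rewrite distrC saw /mon => h.
  by apply: le_trans h; lra.
have grow1 : `|w.1| <= `|(branch_lin s w).1|.
  apply: le_trans grow; rewrite ler_peMl//; rewrite /mon; lra.
split=> //; first by rewrite -normr_gt0; exact: lt_le_trans grow1.
by rewrite /branch_lin/= normrM gtr0_norm// ler_pM2l.
Qed.

Let box (p w : R * R) : set R := [set t | y0 <= p.2 + t * w.2].

Let is_interval_box (p w : R * R) J : is_interval J -> is_interval (J `&` box p w).
Proof. by move=> iJ; apply: is_intervalI => //; exact: is_interval_affine_ge. Qed.

Lemma Rintegral_pullback phi s p w J : bounded_measurable phi ->
  is_interval J -> (mu J < +oo)%E -> one_sided s p w J ->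
  \int[mu]_(t in J) pullback phi (ray p w t) =
  \int[mu]_(t in J `&` box p w) phi (ray (branch s p) (branch_lin s w) t).
Proof.
move=> bf iJ Joo sJ; have mJ := is_interval_measurable iJ.
have mB : measurable (box p w).
  by apply: is_interval_measurable; exact: is_interval_affine_ge.
rewrite (Rintegral_split (mu:=mu) mJ Joo mB (f:= pullback phi \o ray p w)); last first.
  by apply/bounded_measurable_ray/bounded_measurable_pullback.
rewrite [X in _ + X](_ : _ = 0) ?addr0.
  apply: eq_Rintegral => t; rewrite inE => -[Jt Bt] /=.
  by rewrite /pullback (lozi_ray (sJ _ Jt)) ifT.
rewrite (@eq_Rintegral _ _ _ mu _ (cst 0)) ?Rintegral_cst ?mul0r//.
  by apply: measurableI => //; exact: measurableC.
move=> t; rewrite inE => -[Jt Bt] /=.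
by rewrite /pullback ifF//; apply/negP.
Qed.

Let mon_gt0 : 0 < mon. Proof. by case: hyp; rewrite /mon => *; lra. Qed.

Lemma segment_bound_branch phi al be s p w J : 0 <= al ->
  segment_bounded phi al be -> `|s| = 1 -> w.1 != 0 -> `|w.2| <= b * `|w.1| ->
  is_interval J -> (mu J < +oo)%E ->
  `|\int[mu]_(t in J) phi (ray (branch s p) (branch_lin s w) t)| <=
  al / mon / `|w.1| + be * fine (mu J).
Proof.
move=> al0 seg s1 w0 cone iJ Joo.
have [w0' cone' grow] := branch_cone s1 w0 cone.
apply: (le_trans (seg _ _ _ w0' cone' iJ Joo)); rewrite lerD2r -mulrA -invfM.
apply: ler_wpM2l => //; rewrite lef_pV2// posrE ?mulr_gt0 ?normr_gt0//.
Qed.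

(** Away from the fold the image of a segment is a segment with a longer
    velocity, and the part above the floor is an interval of times. *)
Lemma segment_bound_pullback_one_sided phi al be s p w J : 0 <= al -> 0 <= be ->
  bounded_measurable phi -> segment_bounded phi al be ->
  `|s| = 1 -> w.1 != 0 -> `|w.2| <= b * `|w.1| ->
  is_interval J -> (mu J < +oo)%E -> one_sided s p w J ->
  `|\int[mu]_(t in J) pullback phi (ray p w t)| <=
  al / mon / `|w.1| + be * fine (mu J).
Proof.
move=> al0 be0 bf seg s1 w0 cone iJ Joo sJ.
rewrite (Rintegral_pullback bf iJ Joo sJ).
have iJB := @is_interval_box p w _ iJ.
have [oo le] := fine_measure_le (mu:=mu) (is_interval_measurable iJ) Joo
  (is_interval_measurable iJB) (@subIsetl _ _ _).
apply: (le_trans (segment_bound_branch _ al0 seg s1 w0 cone iJB oo)).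
by rewrite lerD2l; apply: ler_wpM2l.
Qed.

Let right (p w : R * R) : set R := [set t | 0 <= p.1 + t * w.1].

Let is_interval_right (p w : R * R) J : is_interval J ->
  is_interval (J `&` right p w) /\ is_interval (J `&` ~` right p w).
Proof.
move=> iJ; split; apply: is_intervalI => //.
  exact: is_interval_affine_ge.
have -> : ~` right p w = [set t | p.1 + t * w.1 < 0].
  by apply/seteqP; split => t /=; rewrite ltNge => /negP.
exact: is_interval_affine_lt.
Qed.

Let one_sided_right p w J : one_sided 1 p w (J `&` right p w).
Proof. by move=> t [_ Rt]; rewrite mul1r ger0_norm. Qed.

Let one_sided_left p w J : one_sided (- 1) p w (J `&` ~` right p w).
Proof. by move=> t [_ /negP Rt]; rewrite mulN1r ltr0_norm// ltNge. Qed.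

(** A segment crosses the line [x = 0] at most once: it has one part on each
    side, and [k] is paid for both. *)
Lemma segment_bound_cut (f : R -> R) p w J k be : bounded_measurable f ->
  is_interval J -> (mu J < +oo)%E ->
  (forall J', is_interval J' -> (mu J' < +oo)%E -> J' `<=` J ->
     J' `<=` right p w \/ J' `<=` ~` right p w ->
     `|\int[mu]_(t in J') f t| <= k + be * fine (mu J')) ->
  `|\int[mu]_(t in J) f t| <= 2 * k + be * fine (mu J).
Proof.
move=> bf iJ Joo h.
have [iR iL] := @is_interval_right p w J iJ.
have mJ := is_interval_measurable iJ.
have mR : measurable (right p w).
  by apply: is_interval_measurable; exact: is_interval_affine_ge.
have [oo1 _] := fine_measure_le (mu:=mu) mJ Joo (is_interval_measurable iR)
  (@subIsetl _ _ _).
have [oo2 _] := fine_measure_le (mu:=mu) mJ Joo (is_interval_measurable iL)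
  (@subIsetl _ _ _).
rewrite (Rintegral_split (mu:=mu) mJ Joo mR bf) (fine_measure_split (mu:=mu) mJ Joo mR).
apply: (le_trans (ler_normD _ _)).
have h1 := h _ iR oo1 (@subIsetl _ _ _) (or_introl (@subIsetr _ _ _)).
have h2 := h _ iL oo2 (@subIsetl _ _ _) (or_intror (@subIsetr _ _ _)).
by lra.
Qed.

Lemma segment_bounded_pullback phi al be : 0 <= al -> 0 <= be ->
  bounded_measurable phi -> segment_bounded phi al be ->
  segment_bounded (pullback phi) (2 * (al / mon)) be.
Proof.
move=> al0 be0 bf seg p w J w0 cone iJ Joo; rewrite -mulrA.
apply: (segment_bound_cut (p := p) (w := w)) => //.
  by apply/bounded_measurable_ray/bounded_measurable_pullback.
move=> J' iJ' J'oo _ [J'R|J'L].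
  apply: (segment_bound_pullback_one_sided (s := 1)) => //; first by rewrite normr1.
  by rewrite -(setIidl J'R); exact: one_sided_right.
apply: (segment_bound_pullback_one_sided (s := -1)) => //; first by rewrite normrN1.
by rewrite -(setIidl J'L); exact: one_sided_left.
Qed.

(** Points above the floor whose distance to the line [x = 0] is at most [eps]
    have images in the half-plane [x >= 0]. *)
Let eps := (1 + y0) / a.

Let eps_gt0 : 0 < eps.
Proof.
have := floor_height_gtN1 hyp; case: hyp => *.
by rewrite divr_gt0//; rewrite /y0; lra.
Qed.

(** A short segment that crosses the line [x = 0] stays within [eps] of it. The
    images of its two halves are then on one side of the line, and are not cut
    by the second step. *)
Lemma segment_bounded_pullback2_short phi al be p w J : 0 <= al -> 0 <= be ->
  bounded_measurable phi -> segment_bounded phi al be ->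
  w.1 != 0 -> `|w.2| <= b * `|w.1| -> is_interval J -> (mu J < +oo)%E ->
  (forall s t, J s -> J t -> `|s - t| <= eps / `|w.1|) ->
  `|\int[mu]_(t in J) pullback (pullback phi) (ray p w t)| <=
  2 * (al / mon) / mon / `|w.1| + be * fine (mu J).
Proof.
have [b0 b1 ab ab2 bd] := hyp.
move=> al0 be0 bf seg w0 cone iJ Joo short.
have bf1 := bounded_measurable_pullback bf.
have seg1 := segment_bounded_pullback al0 be0 bf seg.
have al1 : 0 <= 2 * (al / mon) by rewrite mulr_ge0// divr_ge0// ltW.
have [[t1 Jt1]|R0] := pselect (J `&` right p w !=set0); last first.
  apply: (segment_bound_pullback_one_sided (s := -1)) => //; first by rewrite normrN1.
  have -> : J = J `&` ~` right p w; last exact: one_sided_left.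
  by apply/esym/setIidPl => t Jt Rt; apply: R0; exists t.
have [[t2 Jt2]|L0] := pselect (J `&` ~` right p w !=set0); last first.
  apply: (segment_bound_pullback_one_sided (s := 1)) => //; first by rewrite normr1.
  have -> : J = J `&` right p w; last exact: one_sided_right.
  by apply/esym/setIidPl => t Jt; apply: contrapT => Rt; apply: L0; exists t.
have near0 t : J t -> `|p.1 + t * w.1| <= eps.
  move=> Jt; have w1 : 0 < `|w.1| by rewrite normr_gt0.
  have d s : J s -> `|(p.1 + t * w.1) - (p.1 + s * w.1)| <= eps.
    move=> Js; rewrite opprD addrACA subrr add0r -mulrBl normrM.
    by rewrite -ler_pdivlMr//; exact: short.
  case: Jt1 Jt2 => /d + + [/d + /negP]; rewrite /right/= -ltNge.
  move: eps => e.
  by rewrite !ler_norml => /andP[? ?] ? /andP[? ?] ?; apply/andP; split; lra.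
rewrite [X in X / `|_|](_ : _ = 2 * (al / mon / mon)); last by rewrite -mulrA.
rewrite -[2 * _ / _]mulrA.
apply: (segment_bound_cut (p := p) (w := w)) => //.
  by apply/bounded_measurable_ray/bounded_measurable_pullback.
move=> J' iJ' J'oo J'J side.
have [s s1 sJ'] : exists2 s, `|s| = 1 & one_sided s p w J'.
  case: side => side.
    exists 1; first exact: normr1.
    by rewrite -(setIidl side); exact: one_sided_right.
  exists (-1); first exact: normrN1.
  by rewrite -(setIidl side); exact: one_sided_left.
rewrite (Rintegral_pullback bf1 iJ' J'oo sJ').
have iJB := @is_interval_box p w _ iJ'.
have [oo le] := fine_measure_le (mu:=mu) (is_interval_measurable iJ') J'oo
  (is_interval_measurable iJB) (@subIsetl _ _ _).
have [w0' cone' grow] := branch_cone s1 w0 cone.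
apply: le_trans (_ : al / mon / `|(branch_lin s w).1| +
    be * fine (mu (J' `&` box p w)) <= _); last first.
  apply: lerD; last exact: ler_wpM2l.
  rewrite -mulrA -invfM -[leRHS]mulrA -invfM -[leRHS]mulrA -invfM.
  apply: ler_wpM2l => //; rewrite lef_pV2 ?posrE ?mulr_gt0 ?normr_gt0//.
  by rewrite ler_pM2l.
apply: (segment_bound_pullback_one_sided (s := 1)) => //; first by rewrite normr1.
move=> t [J't Bt]; rewrite mul1r ger0_norm// -lozi_ray; last exact: sJ'.
rewrite /lozi/=; have := near0 _ (J'J _ J't).
have a0 : 0 < a by lra.
rewrite /eps ler_pdivlMr// mulrC; move: Bt; rewrite /box/=.
by lra.
Qed.

Let theta := 2 / mon ^+ 2.

Let theta_lt1 : 0 < theta < 1.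
Proof.
have [b0 b1 ab ab2 bd] := hyp.
have m2 : 0 < mon ^+ 2 by rewrite exprn_gt0.
by rewrite divr_gt0//= ltr_pdivrMr// mul1r.
Qed.

(** The factor 2 of the only cut is overcome by the stretch [mon ^+ 2] of two
    steps. A long segment is first subdivided into pieces of horizontal length
    [eps]; their constants add up to an increase of the density. *)
Lemma segment_bounded_pullback2 phi al be : 0 <= al -> 0 <= be ->
  bounded_measurable phi -> segment_bounded phi al be ->
  segment_bounded (pullback (pullback phi)) (theta * al) (be + theta / eps * al).
Proof.
move=> al0 be0 bf seg p w J w0 cone iJ Joo.
have w1 : 0 < `|w.1| by rewrite normr_gt0.
have -> : theta * al = 2 * (al / mon) / mon.
  rewrite /theta expr2 invfM; ring.
have k0 : 0 <= 2 * (al / mon) / mon / `|w.1|.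
  by rewrite !(mulr_ge0, divr_ge0)// ?invr_ge0// ltW.
have -> : be + theta / eps * al =
    be + (2 * (al / mon) / mon / `|w.1|) / (eps / `|w.1|).
  have cancel_w X : X / `|w.1| / (eps / `|w.1|) = X / eps.
    by rewrite invf_div mulrA mulfVK// gt_eqF.
  rewrite cancel_w.
  by rewrite /theta expr2 invfM; ring.
apply: (Rintegral_subdivision _ _ _ _ iJ Joo) => //.
  by apply/bounded_measurable_ray/bounded_measurable_pullback/bounded_measurable_pullback.
  by rewrite divr_gt0.
move=> {}J {}iJ {}Joo short.
exact: segment_bounded_pullback2_short.
Qed.

(** The sum of the geometric series of the increases [theta / eps * theta ^+ n]
    of the density. *)
Definition line_density := theta / eps / (1 - theta).

Lemma line_density_ge0 : 0 <= line_density.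
Proof.
case/andP: theta_lt1 => t0 t1.
by apply: divr_ge0; [apply: divr_ge0; exact: ltW|rewrite subr_ge0 ltW].
Qed.

Definition contraction := theta.

Lemma contraction_itv : 0 < contraction < 1. Proof. exact: theta_lt1. Qed.

Lemma segment_bounded_iter phi n : bounded_measurable phi ->
  segment_bounded phi 1 0 ->
  bounded_measurable (iter n (pullback \o pullback) phi) /\
  segment_bounded (iter n (pullback \o pullback) phi)
    (contraction ^+ n) line_density.
Proof.
have [t0 t1] := andP theta_lt1.
have t1' : 1 - theta != 0 by rewrite subr_eq0 eq_sym lt_eqF.
move=> bf seg.
have be0 m : 0 <= theta / eps * ((1 - theta ^+ m) / (1 - theta)).
  apply: mulr_ge0; first by apply: divr_ge0; exact: ltW.
  apply: divr_ge0; last by rewrite subr_ge0 ltW.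
  by rewrite subr_ge0 exprn_ile1// ltW.
suff [? seg'] : bounded_measurable (iter n (pullback \o pullback) phi) /\
    segment_bounded (iter n (pullback \o pullback) phi)
    (theta ^+ n) (theta / eps * ((1 - theta ^+ n) / (1 - theta))).
  split=> // p w J w0 cone iJ Joo.
  apply: (le_trans (seg' p w J w0 cone iJ Joo)); rewrite lerD2l.
  apply: ler_wpM2r; first exact: fine_ge0.
  rewrite /line_density; apply: ler_wpM2l; first by apply: divr_ge0; exact: ltW.
  rewrite ler_pdivrMr ?subr_gt0// mulVf//.
  by rewrite gerBl exprn_ge0// ltW.
elim: n => [|n [IH1 IH2]].
  by rewrite expr0 subrr mul0r mulr0.
split; first by apply/bounded_measurable_pullback/bounded_measurable_pullback.
have -> : theta ^+ n.+1 = theta * theta ^+ n by rewrite exprS.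
have -> : theta / eps * ((1 - theta * theta ^+ n) / (1 - theta)) =
    theta / eps * ((1 - theta ^+ n) / (1 - theta)) + theta / eps * theta ^+ n.
  rewrite -mulrDr; congr (_ * _).
  by rewrite -{3}(mulfK t1' (theta ^+ n)) -mulrDl; congr (_ / _); ring.
apply: segment_bounded_pullback2 => //; first by rewrite exprn_ge0// ltW.
Qed.

End growth.

(** * Weak limits along a segment *)
Section uniform_continuity.
Context {R : realType}.

(** The second point ranges over a neighbourhood of the compact set: later the
    set is a vertical segment, and the strips around it contain points off it. *)
Lemma compact_uniform_modulus (X : pseudoMetricType R) (f : X -> R) (K : set X)
    (e : R) : compact K -> continuous f -> 0 < e ->
  exists2 d : R, 0 < d & forall p q, K p -> ball p d q -> `|f p - f q| < e.
Proof.
move=> /compact_near_coveringP cK cf e0.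
pose P (d : R) (p : X) := forall q, ball p d q -> `|f p - f q| < e.
have /cK : forall p, K p -> \forall p' \near p & d \near (0 : R)^'+, P d p'.
  move=> p Kp; have e2 : 0 < e / 2 by rewrite divr_gt0.
  have /cvgrPdist_lt/(_ _ e2) := cf p.
  rewrite -nbhs_ballE => -[r /= r0 rP].
  exists (ball p (r / 2), [set d | d < r / 2]) => /=.
    split; first by apply: nbhsx_ballx; rewrite divr_gt0.
    by apply: nbhs_right_lt; rewrite divr_gt0.
  move=> [p' d] /= [pp' dr] q p'q.
  have p'p : ball p r p' by apply: le_ball pp'; rewrite ler_pdivrMr//; lra.
  have qp : ball p r q.
    by apply: (ball_split pp'); apply/ball_sym/(le_ball (ltW dr))/ball_sym.
  have := rP _ p'p; have := rP _ qp; rewrite /= !ltr_distl => *.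
  by apply/andP; split; lra.
move=> Hd.
have /filter_ex[d [d0 Kd]] : \forall d \near (0 : R)^'+, 0 < d /\ K `<=` P d.
  by apply: filterI; [exact: nbhs_right_gt|exact: Hd].
by exists d => // p q Kp; exact: Kd.
Qed.

End uniform_continuity.

Section weak_bound.
Context {R : realType}.
Notation mu := (@lebesgue_measure R).

Let integrable_bm J (f : R -> R) : measurable J -> (mu J < +oo)%E ->
  bounded_measurable f -> mu.-integrable J (EFin \o f).
Proof. exact: bounded_measurable_integrable. Qed.

Lemma fine_lebesgue_itvco (s t : R) : s <= t ->
  (mu `[s, t[%classic < +oo)%E /\ fine (mu `[s, t[%classic) = t - s.
Proof.
move=> st; have -> : mu `[s, t[%classic = (t - s)%:E; last by rewrite ltry.
rewrite lebesgue_measure_itv/= lte_fin; have [->|ns] := eqVneq s t.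
  by rewrite ltxx subrr.
by rewrite lt_neqAle ns st.
Qed.

(** Freezing [k] at the left end of the cell costs the oscillation [e] twice:
    against [f], and when [|k s|] is compared with the mean of [|k|]. *)
Lemma cell_bound (k f : R -> R) (S al be e s t : R) :
  bounded_measurable k -> bounded_measurable f -> s <= t -> 0 <= be -> 0 <= e ->
  (forall x, `|f x| <= S) ->
  (forall x, s <= x < t -> `|k s - k x| <= e) ->
  `|\int[mu]_(x in `[s, t[) f x| <= al + be * (t - s) ->
  `|\int[mu]_(x in `[s, t[) (k x * f x)| <=
    `|k s| * al + be * \int[mu]_(x in `[s, t[) `|k x| + e * (S + be) * (t - s).
Proof.
move=> bk bf st be0 e0 fS ke fb.
have [Joo Jl] := fine_lebesgue_itvco st.
have mJ : measurable `[s, t[%classic by [].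
have intg g : bounded_measurable g -> mu.-integrable `[s, t[ (EFin \o g).
  exact: integrable_bm.
have bd : bounded_measurable (fun x => (k s - k x) * f x).
  apply: bounded_measurableM => //; apply: bounded_measurableB => //.
  exact: bounded_measurable_cst.
have bsf : bounded_measurable (fun x => k s * f x).
  exact: bounded_measurableM (bounded_measurable_cst _) bf.
have -> : \int[mu]_(x in `[s, t[) (k x * f x) =
    \int[mu]_(x in `[s, t[) (k s * f x) -
    \int[mu]_(x in `[s, t[) ((k s - k x) * f x).
  by rewrite -RintegralB ?intg//; apply: eq_Rintegral => x _; ring.
apply: (le_trans (ler_normB _ _)).
have I1 : `|\int[mu]_(x in `[s, t[) (k s * f x)| <= `|k s| * (al + be * (t - s)).
  by rewrite RintegralZl ?intg// normrM; apply: ler_wpM2l.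
have cst_int c : \int[mu]_(x in `[s, t[) c = c * (t - s).
  by rewrite Rintegral_cst// Jl.
have I2 : `|\int[mu]_(x in `[s, t[) ((k s - k x) * f x)| <= e * S * (t - s).
  apply: (le_trans (le_normr_Rintegral _ _)); rewrite ?intg// -cst_int.
  apply: le_Rintegral => //.
  - by apply: intg; exact: bounded_measurable_normr.
  - by apply: intg; exact: bounded_measurable_cst.
  - move=> x /=; rewrite in_itv/= => sxt; rewrite normrM.
    by apply: ler_pM => //; exact: ke.
have I3 : `|k s| * (t - s) <= \int[mu]_(x in `[s, t[) `|k x| + e * (t - s).
  rewrite -!cst_int -RintegralD ?intg//; last 2 first.
  - exact: bounded_measurable_normr.
  - exact: bounded_measurable_cst.
  apply: le_Rintegral => //.
  - by apply: intg; exact: bounded_measurable_cst.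
  - apply/intg/bounded_measurableD/bounded_measurable_cst.
    exact: bounded_measurable_normr.
  - move=> x /=; rewrite in_itv/= => /ke; rewrite -lerBlDl.
    by apply: le_trans; exact: lerB_dist.
apply: (le_trans (lerD I1 I2)).
have := ler_wpM2l be0 I3; rewrite !mulrDr !mulrDl; lra.
Qed.

(** The constant [K] is the sum of [|k|] over the grid, the same for all [n]. *)
Lemma grid_bound (k : R -> R) (S be e : R) (f_ : nat -> R -> R) (al : nat -> R) m :
  bounded_measurable k -> 0 <= be -> 0 <= e ->
  (forall n, bounded_measurable (f_ n)) -> (forall n x, `|f_ n x| <= S) ->
  (forall n, 0 <= al n) ->
  (forall n J, is_interval J -> (mu J < +oo)%E ->
    `|\int[mu]_(x in J) f_ n x| <= al n + be * fine (mu J)) ->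
  (forall x y, 0 <= x -> x <= y -> y < 1 -> y - x <= m.+1%:R^-1 -> `|k x - k y| <= e) ->
  exists2 K : R, 0 <= K & forall n, `|\int[mu]_(x in `[0, 1[) (k x * f_ n x)| <=
    K * al n + be * \int[mu]_(x in `[0, 1[) `|k x| + e * (S + be).
Proof.
move=> bk be0 e0 bf fS al0 fb kunif.
pose c j : R := j%:R / m.+1%:R.
have m0 : 0 < m.+1%:R :> R by rewrite ltr0n.
have c0 : c 0%N = 0 by rewrite /c mul0r.
have cm : c m.+1 = 1 by rewrite /c divff// gt_eqF.
have cS j : c j.+1 = c j + m.+1%:R^-1 by rewrite /c -natr1 mulrDl mul1r.
have i0 : 0 < m.+1%:R^-1 :> R by rewrite invr_gt0.
have cge0 j : 0 <= c j by rewrite divr_ge0.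
have claim j : (j <= m.+1)%N -> exists2 K : R, 0 <= K &
    forall n, `|\int[mu]_(x in `[0, c j[) (k x * f_ n x)| <=
    K * al n + be * \int[mu]_(x in `[0, c j[) `|k x| + e * (S + be) * c j.
  elim: j => [_|j IH jm].
    exists 0 => // n; rewrite c0 set_itv_ge ?bnd_simp ?ltxx//.
    by rewrite !Rintegral_set0 normr0 !mulr0 mul0r !addr0.
  have [K K0 KP] := IH (ltnW jm).
  exists (K + `|k (c j)|) => [|n]; first exact: addr_ge0.
  have cc : c j <= c j.+1 by rewrite cS lerDl ltW.
  have cj1 : c j.+1 <= 1 by rewrite -cm /c ler_pM2r// ler_nat.
  have [Joo Jl] := fine_lebesgue_itvco (cge0 j.+1).
  have [J'oo J'l] := fine_lebesgue_itvco cc.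
  have split f : bounded_measurable f -> \int[mu]_(x in `[0, c j.+1[) f x =
      \int[mu]_(x in `[0, c j[) f x + \int[mu]_(x in `[c j, c j.+1[) f x.
    move=> bmf.
    rewrite (Rintegral_split (mu:=mu) _ Joo (measurable_itv `]-oo, c j[) bmf)//.
    have -> : `[0, c j.+1[%classic `&` `]-oo, c j[%classic = `[0, c j[%classic.
      apply/seteqP; split => x /=; rewrite !in_itv/=.
        by move=> [/andP[-> _] ->].
      by move=> /andP[-> xc]; rewrite xc (lt_le_trans xc cc).
    have -> // : `[0, c j.+1[%classic `&` ~` `]-oo, c j[%classic =
        `[c j, c j.+1[%classic.
    apply/seteqP; split => x /=; rewrite !in_itv/=.
      by move=> [/andP[_ ->] /negP]; rewrite -leNgt => ->.
    move=> /andP[cx ->]; rewrite (le_trans (cge0 j) cx); split => //.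
    by apply/negP; rewrite -leNgt.
  rewrite (split _ (bounded_measurableM bk (bf n))).
  rewrite (split _ (bounded_measurable_normr bk)).
  apply: (le_trans (ler_normD _ _)).
  have h1 := KP n.
  have h2 : `|\int[mu]_(x in `[c j, c j.+1[) (k x * f_ n x)| <=
    `|k (c j)| * al n + be * \int[mu]_(x in `[c j, c j.+1[) `|k x| +
    e * (S + be) * (c j.+1 - c j).
    apply: cell_bound => //.
    - move=> x /andP[cx xc]; apply: kunif => //; first exact: lt_le_trans cj1.
      by rewrite lerBlDl -cS ltW.
    - rewrite -J'l; apply: fb => //; exact: interval_is_interval.
  apply: (le_trans (lerD h1 h2)); rewrite !mulrDr !mulrDl; lra.
have [K K0 KP] := claim m.+1 (leqnn _).
by exists K => // n; have := KP n; rewrite cm mulr1.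
Qed.

End weak_bound.

Section weak_limit.
Context {R : realType}.
Notation mu := (@lebesgue_measure R).

(** For a step function [h] this is the sum of the bounds on the steps, in which
    the errors [al n] vanish in the limit. A density is close in mean to a
    continuous function, hence to a step function. *)
Lemma weak_limit_bound (h : R -> R) (f_ : nat -> R -> R) (al : nat -> R) (S be : R) :
  mu.-integrable `[0, 1[ (EFin \o h) -> 0 <= be ->
  (forall n, measurable_fun setT (f_ n)) -> (forall n x, `|f_ n x| <= S) ->
  (forall n, 0 <= al n) -> al @ \oo --> 0 ->
  (forall n J, is_interval J -> (mu J < +oo)%E ->
    `|\int[mu]_(x in J) f_ n x| <= al n + be * fine (mu J)) ->
  forall e, 0 < e -> \forall n \near \oo,
    `|\int[mu]_(x in `[0, 1[) (h x * f_ n x)| <=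
    be * \int[mu]_(x in `[0, 1[) `|h x| + e.
Proof.
move=> ih be0 mf fS al0 all0 fb e e0.
have S0 : 0 <= S by apply: le_trans (fS 0%N 0).
have bf n : bounded_measurable (f_ n) by split => //; exists S.
have [Eoo El] := fine_lebesgue_itvco (@ler01 R).
have mE : measurable (`[0 : R, 1[%classic : set R) by exact: measurable_itv.
pose c := 2 * be + 2 * S + 1.
have c0 : 0 < c by rewrite /c; lra.
pose d := e / 2 / c; have d0 : 0 < d by rewrite !divr_gt0.
have [k [ck ik hk]] : exists k : R -> R, [/\ continuous k,
    mu.-integrable `[0, 1[ (EFin \o k) &
    \int[mu]_(x in `[0, 1[) `|h x - k x| <= d].
  have [g [cg ig hg]] := approximation_continuous_integrable mE Eoo ih.
  move/fine_cvgP : hg => [_ /cvgrPdist_lt/(_ _ d0)[N _ /(_ N (leqnn N))]].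
  rewrite sub0r normrN => hN.
  by exists (g N); split => //; apply/ltW/(le_lt_trans (ler_norm _)).
have cpt : compact `[0%R : R, 1%R]%classic by exact: segment_compact.
(* truncated outside the interval, [k] is bounded on the whole line *)
pose kt x := k x * \1_`[0%R, 1%R]%classic x.
have ktE x : 0 <= x <= 1 -> kt x = k x.
  by move=> x01; rewrite /kt indicE mem_set ?mulr1//= in_itv.
have bkt : bounded_measurable kt.
  split.
    apply: measurable_funM; first exact: continuous_measurable_fun.
    exact: measurable_indic.
  have /compact_bounded[B [_ kB]] := continuous_compact
    (continuous_subspaceT ck) cpt.
  exists (`|B| + 1) => x; rewrite /kt indicE.
  have B1 : B < `|B| + 1 by rewrite ltr_pwDr ?ler_norm.
  case: (boolP (x \in _)) => [|_]; last by rewrite mulr0 normr0 addr_ge0.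
  by rewrite inE mulr1 => x01; apply: (kB _ B1); exists x.
have [r r0 kr] := compact_uniform_modulus cpt ck d0.
have [m mr] : exists m, m.+1%:R^-1 < r.
  have := near_infty_natSinv_lt (PosNum r0) => -[N _ /(_ N (leqnn N))].
  by exists N.
have [|K K0 KP] := grid_bound (m := m) bkt be0 (ltW d0) bf fS al0 fb.
  move=> x y x0 xy y1 yx; rewrite !ktE; last 2 first.
  - by rewrite (le_trans x0 xy) ltW.
  - by rewrite x0 (le_trans xy) ?ltW.
  apply/ltW/kr; first by rewrite /= in_itv/= x0 (le_trans xy) ?ltW.
  by rewrite /ball/= distrC ger0_norm ?subr_ge0// (le_lt_trans yx).
have Kal : \forall n \near \oo, K * al n < e / 2.
  have /cvgrPdist_lt : K * al n @[n --> \oo] --> K * 0 by exact: cvgM (cvg_cst _) all0.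
  have e2 : 0 < e / 2 by rewrite divr_gt0.
  move=> /(_ _ e2).
  by apply: filterS => n; rewrite mulr0 sub0r normrN; apply: le_lt_trans; exact: ler_norm.
have ikt : mu.-integrable `[0, 1[ (EFin \o kt).
  exact: bounded_measurable_integrable.
have ktk g : \int[mu]_(x in `[0, 1[) (g (kt x) x) = \int[mu]_(x in `[0, 1[) g (k x) x.
  apply: eq_Rintegral => x; rewrite inE/= in_itv/= => /andP[x0 x1].
  by rewrite ktE// x0 ltW.
have iM g n : mu.-integrable `[0, 1[ (EFin \o g) ->
    mu.-integrable `[0, 1[ (EFin \o (fun x => g x * f_ n x)).
  move=> ig; apply: (@integrableMl _ _ _ mu _ mE (EFin \o g) (f_ n)) => //.
    exact: measurable_funS (mf n).
  exists S; split => [|x Sx y _]; first exact: num_real.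
  by apply: le_trans (fS n y) _; exact: ltW.
have inorm g : mu.-integrable `[0, 1[ (EFin \o g) ->
    mu.-integrable `[0, 1[ (EFin \o (fun x => `|g x|)).
  exact: integrable_norm.
have idiff : mu.-integrable `[0, 1[ (EFin \o (fun x => h x - k x)).
  by have := integrableB _ ih ik; apply; exact: mE.
have k1 : \int[mu]_(x in `[0, 1[) `|k x| <= \int[mu]_(x in `[0, 1[) `|h x| + d.
  rewrite -lerBlDl -RintegralB ?inorm//; apply: le_trans hk.
  apply: le_Rintegral => //; [|exact: inorm|].
    by have := integrableB _ (inorm _ ik) (inorm _ ih); apply; exact: mE.
  by move=> x _; rewrite distrC; exact: lerB_dist.
near=> n.
have hn : K * al n < e / 2 by near: n.
have -> : \int[mu]_(x in `[0, 1[) (h x * f_ n x) =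
    \int[mu]_(x in `[0, 1[) (k x * f_ n x) +
    \int[mu]_(x in `[0, 1[) ((h x - k x) * f_ n x).
  by rewrite -RintegralD ?iM//; apply: eq_Rintegral => x _; ring.
apply: (le_trans (ler_normD _ _)).
have := KP n; rewrite (ktk (fun y x => y * f_ n x)) (ktk (fun y _ => `|y|)) => h1.
have h2 : `|\int[mu]_(x in `[0, 1[) ((h x - k x) * f_ n x)| <= d * S.
  apply: (le_trans (le_normr_Rintegral _ _)); rewrite ?iM//.
  apply: (@le_trans _ _ (\int[mu]_(x in `[0, 1[) (`|h x - k x| * S))).
    apply: le_Rintegral => //; first by apply/inorm/iM.
      apply: (@integrableMl _ _ _ mu _ mE (EFin \o (fun x => `|h x - k x|)) (cst S)) => //.
        exact: inorm.
      exact: bounded_cst.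
    by move=> x _; rewrite normrM; apply: ler_wpM2l.
  rewrite RintegralZr//; last exact: inorm.
  exact: ler_wpM2r.
apply: (le_trans (lerD h1 h2)).
have := ler_wpM2l be0 k1.
have : d * c = e / 2 by rewrite /d divfK// gt_eqF.
rewrite /c !mulrDr; lra.
Unshelve. all: by end_near. Qed.

End weak_limit.

(** * Conditional measures on unstable segments *)
Section image_measure.
Context {d1 d2} {T1 : measurableType d1} {T2 : measurableType d2} {R : realType}.
Context (m : {measure set T1 -> \bar R}) (f : T1 -> T2).
Hypothesis mf : measurable_fun setT f.

Definition image_measure : {measure set T2 -> \bar R}.
Proof. by refine (pushforward m f : {measure set T2 -> \bar R}). Defined.

Lemma image_measureE A : image_measure A = m (f @^-1` A).
Proof. by []. Qed.

End image_measure.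

Section finite_copy.
Context {d} {T : measurableType d} {R : realType}.
Variables (nu : {measure set T -> \bar R}) (nuoo : (nu setT < +oo)%E).

(** The finiteness proof is an argument so that the instance of finite measure,
    which the Radon-Nikodym theorem requires, can refer to it. *)
Definition finite_copy of (nu setT < +oo)%E : set T -> \bar R := nu.

Let finite_copy_fin : fin_num_fun (finite_copy nuoo).
Proof.
move=> A mA; rewrite ge0_fin_numE//; apply: le_lt_trans nuoo.
by apply: le_measure; rewrite ?inE.
Qed.

HB.instance Definition _ := Measure.on (finite_copy nuoo).
HB.instance Definition _ :=
  Measure_isFinite.Build _ _ _ (finite_copy nuoo) finite_copy_fin.

End finite_copy.

Section fibre.
Context {R : realType} (b : R).
Notation mu := (@lebesgue_measure R).

(** The density is the Radon-Nikodym derivative. The change of variables for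
    nonnegative functions extends to bounded ones by adding a constant. *)
Lemma absolutely_continuous_density (nu : {measure set (measurableTypeR R) -> \bar R}) :
  (nu setT < +oo)%E -> nu (~` `[0, 1[%classic) = 0%E ->
  (forall A, measurable A -> mu A = 0%E -> nu A = 0%E) ->
  exists h : R -> R, [/\ forall x, 0 <= h x, mu.-integrable `[0, 1[ (EFin \o h),
    \int[mu]_(x in `[0, 1[) h x = fine (nu setT) &
    forall f : measurableTypeR R -> R, bounded_measurable f ->
      \int[nu]_x f x = \int[mu]_(x in `[0, 1[) (h x * f x)].
Proof.
move=> nuoo nuC numu.
pose nuF : {finite_measure set (measurableTypeR R) -> \bar R} := finite_copy nuoo.
have dom : nuF `<< mu by apply/null_content_dominatesP => A mA; exact: numu.
pose F := Radon_Nikodym_SigmaFinite.f nuF mu.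
have F0 x : (0 <= F x)%E by exact: Radon_Nikodym_SigmaFinite.f_ge0.
have Ffin x : F x \is a fin_num by exact: Radon_Nikodym_SigmaFinite.f_fin_num.
pose E : set (measurableTypeR R) := `[0 : R, 1[%classic.
have mE : measurable E.
  exact: measurable_itv.
have iF : mu.-integrable `[0, 1[ F.
  apply: (integrableS measurableT) => //.
  exact: Radon_Nikodym_SigmaFinite.f_integrable.
pose h x := fine (F x).
have hE : EFin \o h = F by apply/funext => x; rewrite /= fineK.
have nuE (g : measurableTypeR R -> \bar R) : measurable_fun setT g -> (forall x, 0 <= g x)%E ->
    (\int[nu]_x g x = \int[nu]_(x in E) g x)%E.
  move=> mg g0; rewrite -[in LHS](setUv E).
  rewrite ge0_integral_setU//; last 3 first.
  - by exact: measurableC.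
  - by rewrite setUv.
  - by apply/disj_setPS => x [].
  rewrite [X in (_ + X)%E](_ : _ = 0%E) ?adde0//.
  apply: null_set_integral => //; first by exact: measurableC.
  exact: measurable_funS mg.
have pos (g : measurableTypeR R -> R) : bounded_measurable g -> (forall x, 0 <= g x) ->
    \int[nu]_x g x = \int[mu]_(x in `[0, 1[) (h x * g x).
  move=> [mg _] g0; rewrite /Rintegral; congr fine.
  rewrite nuE//; last exact/measurable_EFinP.
  rewrite -(@Radon_Nikodym_SigmaFinite.change_of_variables _ _ _ nuF mu dom
    (EFin \o g) E)//.
    by apply: eq_integral => x _; rewrite /= EFinM muleC /h fineK.
  exact/measurable_EFinP/measurable_funTS.
have h0 x : 0 <= h x by exact: fine_ge0.
have ih : mu.-integrable `[0, 1[ (EFin \o h) by rewrite hE.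
have hT : \int[mu]_(x in `[0, 1[) h x = fine (nu setT).
  have := pos (cst 1) (bounded_measurable_cst _) (fun=> ler01).
  rewrite Rintegral_cst// mul1r => ->.
  by apply: eq_Rintegral => x _; rewrite mulr1.
exists h; split => // f bf; have [mf [S fS]] := bf.
have bfS : bounded_measurable (fun x => f x + S).
  exact: bounded_measurableD bf (bounded_measurable_cst S).
have inu (g : measurableTypeR R -> R) : bounded_measurable g -> nu.-integrable setT (EFin \o g).
  exact: bounded_measurable_integrable.
have ihg (g : measurableTypeR R -> R) : bounded_measurable g ->
    mu.-integrable `[0, 1[ (EFin \o (fun x => h x * g x)).
  move=> [mg [C gC]].
  apply: (@integrableMl _ _ _ mu _ mE (EFin \o h) g) => //.
    exact: measurable_funS mg.
  exists C; split => [|x Sx y _]; first exact: num_real.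
  by apply: le_trans (gC y) _; exact: ltW.
have -> : \int[nu]_x f x = \int[nu]_x (f x + S) - \int[nu]_x S.
  rewrite -RintegralB ?inu//; last exact: bounded_measurable_cst.
  by apply: eq_Rintegral => x _; rewrite addrK.
rewrite pos//; last first.
  by move=> x; have := fS x; rewrite ler_norml => /andP[+ _]; lra.
rewrite Rintegral_cst// -hT -RintegralZl// -RintegralB ?ihg//.
  by apply: eq_Rintegral => x _; ring.
by have := integrableZl _ S ih; apply; exact: mE.
Qed.

(** In the affine time [tau] of the segment, [kappa] becomes a probability
    measure on [0, 1[ with a density [h]. The integral of [h] is 1, so the weak
    limit bound is [be]. *)
Lemma fibre_bound (u v : R * R) (kappa : {measure set (R * R)%type -> \bar R})
    (phi_ : nat -> R * R -> R) (al : nat -> R) (S be : R) :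
  kappa setT = 1%E -> (v - u).1 != 0 -> `|(v - u).2| <= b * `|(v - u).1| ->
  kappa `<< segment_length u v ->
  (forall n, measurable_fun setT (phi_ n)) -> (forall n x, `|phi_ n x| <= S) ->
  (forall n, 0 <= al n) -> al @ \oo --> 0 -> 0 <= be ->
  (forall n, segment_bounded b (phi_ n) (al n) be) ->
  forall e, 0 < e -> \forall n \near \oo, `|\int[kappa]_q phi_ n q| <= be + e.
Proof.
set w := v - u => k1 w0 cone kac mphi phiS al0 all0 be0 seg e e0.
pose tau (q : R * R) : R := (q.1 - u.1) / w.1.
have mtau : measurable_fun setT tau.
  apply: measurable_funM => //; exact: measurable_funB.
have tauK t : tau (ray u w t) = t by rewrite /tau /ray/= addrAC subrr add0r mulfK.
have null A : measurable A ->
    (segment_path u v @^-1` A `&` `]0, 1[%classic = set0 \/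
     mu (segment_path u v @^-1` A `&` `]0, 1[%classic) = 0%E) -> kappa A = 0%E.
  move=> mA A0.
  have mg B : measurable B -> measurable (segment_path u v @^-1` B).
    move=> mB; rewrite segment_path_ray -[X in measurable X]setTI.
    exact: (measurable_ray u w).
  apply: (kac A) => // B mB BA; rewrite /segment_length.
  suff -> : mu (`]0, 1[ `&` segment_path u v @^-1` B) = 0%E by rewrite mule0.
  apply/eqP; rewrite -measure_le0; case: A0 => A0.
    rewrite (_ : _ `&` _ = set0) ?measure0//.
    apply/seteqP; split => // t [t01 Bt]; rewrite -A0; split => //.
    exact: BA.
  rewrite -[leRHS]A0; apply: le_measure; rewrite ?inE.
  - by apply: measurableI; [exact: measurable_itv|exact: mg].
  - by apply: measurableI; [exact: mg|exact: measurable_itv].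
  - by move=> t [t01 Bt]; split => //; exact: BA.
have mtau' : measurable_fun setT (tau : R * R -> measurableTypeR R) by exact: mtau.
pose nu := image_measure kappa mtau'.
have mpre (A : set (measurableTypeR R)) : measurable A -> measurable (tau @^-1` A).
  by move=> mA; rewrite -[X in measurable X]setTI; exact: mtau.
have gt t : segment_path u v t = ray u w t by rewrite segment_path_ray.
have nuT : nu setT = 1%E by rewrite image_measureE preimage_setT.
have [|||h [h0 ih hT hE]] := @absolutely_continuous_density nu.
- by rewrite nuT ltry.
- rewrite image_measureE; apply: null.
    by apply: mpre; apply: measurableC; exact: measurable_itv.
  left; apply/seteqP; split => // t [/= + t01]; rewrite gt tauK; apply.
  by move: t01; rewrite !in_itv/= => /andP[/ltW-> ->].
- move=> A mA A0; rewrite image_measureE; apply: null; first exact: mpre.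
  right; apply/eqP; rewrite -measure_le0 -A0; apply: le_measure; rewrite ?inE//.
    apply: measurableI; last exact: measurable_itv.
    rewrite segment_path_ray -[X in measurable X]setTI.
    by apply: (measurable_ray u w) => //; exact: mpre.
  by move=> t [/= + _]; rewrite gt tauK.
have transfer n : \int[kappa]_q phi_ n q =
    \int[mu]_(t in `[0, 1[) (h t * phi_ n (ray u w t)).
  have bray : bounded_measurable (phi_ n \o ray u w).
    by apply: bounded_measurable_ray; split => //; exists S.
  rewrite -(hE (phi_ n \o ray u w)); last exact: bray.
  have bcomp : bounded_measurable ((phi_ n \o ray u w) \o tau).
    case: bray => mr [C rC]; split; last by exists C => x; exact: rC.
    exact: measurableT_comp mr mtau.
  have koo : (kappa setT < +oo)%E by rewrite k1 ltry.
  have push : (\int[nu]_x (phi_ n (ray u w x))%:E =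
      \int[kappa]_q (phi_ n (ray u w (tau q)))%:E)%E.
    have := @integral_pushforward _ _ _ _ R (tau : R * R -> measurableTypeR R)
      mtau' kappa setT (EFin \o (phi_ n \o ray u w)).
    rewrite preimage_setT; apply => //.
      by apply/measurable_EFinP; case: bray.
    exact: (bounded_measurable_integrable (mu := kappa) measurableT koo bcomp).
  rewrite /Rintegral push; congr fine; apply: ae_eq_integral => //.
  - exact/measurable_EFinP.
  - by apply/measurable_EFinP; case: bcomp.
  (* [ray u w (tau q)] and [q] have the same abscissa, and they differ only for
     [q] off the line of the segment, a null set for [kappa] *)
  exists (~` ((fun q => (ray u w (tau q)).2 - q.2) @^-1` [set 0])).
  have mN : measurable (~` ((fun q => (ray u w (tau q)).2 - q.2) @^-1` [set 0])).
    apply: measurableC; rewrite -[X in measurable X]setTI.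
    suff : measurable_fun setT (fun q => (ray u w (tau q)).2 - q.2) by exact.
    apply: measurable_funB => //.
    by apply: measurable_funD => //; exact: measurable_funM.
  split => //.
    apply: null => //; left; apply/seteqP; split => // t [/= + _]; apply.
    by rewrite gt tauK subrr.
  move=> q /= /not_implyP[_ neq]; apply: contra_not neq => /= e2.
  have -> : ray u w (tau q) = q; last by [].
  rewrite [RHS]surjective_pairing; congr pair; last by apply/eqP; rewrite -subr_eq0 e2.
  by rewrite /tau/= divfK// addrC subrK.
have w1 : 0 < `|w.1| by rewrite normr_gt0.
have := @weak_limit_bound R h (fun n t => phi_ n (ray u w t))
  (fun n => al n / `|w.1|) S be ih be0.
have -> : \int[mu]_(x in `[0, 1[) `|h x| = 1.
  transitivity (fine (nu setT)); last by rewrite nuT.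
  by rewrite -hT; apply: eq_Rintegral => x _; rewrite ger0_norm.
rewrite mulr1 => wlb.
have : \forall n \near \oo,
    `|\int[mu]_(t in `[0, 1[) (h t * phi_ n (ray u w t))| <= be + e.
  apply: wlb => //.
  - by move=> n; exact: measurableT_comp (mphi n) (measurable_ray u w).
  - by move=> n; rewrite divr_ge0.
  - by rewrite -(mul0r `|w.1|^-1); apply: cvgM => //; exact: cvg_cst.
  - by move=> n J iJ Joo; apply: seg.
by apply: filterS => n; rewrite transfer.
Qed.

End fibre.

(** * Borel subsets of the plane *)
Section plane_borel.
Context {R : realType}.

(** The Borel sets of the plane are generated by measurable rectangles; an open
    set is a countable union of rational boxes. *)
Lemma open_plane_measurable (U : set (R * R)) : open U -> measurable U.
Proof.
move=> oU.
pose box (c : (rat * rat) * (rat * rat)) : set (R * R) :=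
  `]ratr c.1.1, ratr c.1.2[ `*` `]ratr c.2.1, ratr c.2.2[.
have -> : U = \bigcup_(c in [set c | box c `<=` U]) box c.
  apply/seteqP; split => [p Up|p [c /= cU]]; last exact: cU.
  have : nbhs p U by exact: open_nbhs_nbhs.
  rewrite -nbhs_ballE => -[r /= r0 rU].
  have lo (x : R) : x - r < x by rewrite ltrBlDr ltrDl.
  have hi (x : R) : x < x + r by rewrite ltrDl.
  have [q1 h1] := rat_in_itvoo (lo p.1); have [q2 h2] := rat_in_itvoo (hi p.1).
  have [q3 h3] := rat_in_itvoo (lo p.2); have [q4 h4] := rat_in_itvoo (hi p.2).
  move: h1 h2 h3 h4; rewrite !in_itv/= => /andP[? ?] /andP[? ?] /andP[? ?] /andP[? ?].
  exists ((q1, q2), (q3, q4)).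
    move=> q [/=]; rewrite !in_itv/= => /andP[? ?] /andP[? ?]; apply: rU.
    by split; rewrite /ball/= ltr_distl; apply/andP; split; lra.
  by split; rewrite /= in_itv/=; apply/andP.
rewrite bigcup_mkcond; apply: countable_bigcupT_measurable => [|c].
  exact: countableP.
by case: ifPn => // _; apply: measurableX; exact: measurable_itv.
Qed.

Lemma closed_plane_measurable (C : set (R * R)) : closed C -> measurable C.
Proof.
move=> cC; rewrite -[C]setCK; apply: measurableC; apply: open_plane_measurable.
exact: closed_openC.
Qed.

Lemma continuous_plane_measurable (f : R * R -> R) : continuous f ->
  measurable_fun setT f.
Proof.
move=> /continuousP cf; apply: (measurability _ (RGenOpens.measurableE R)).
move=> _ [_ [x [y ->] <-]]; rewrite setTI; apply: open_plane_measurable.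
exact/cf/interval_open.
Qed.

End plane_borel.

Section attractor_measurable.
Context {R : realType} (a b : R) (M : set (R * R)).
Hypothesis cM : compact M.

Lemma continuous_lozi : continuous (lozi a b).
Proof.
move=> p.
have fst_p : (fun q : R * R => q.1) @ p --> p.1 by exact: cvg_fst.
have c1 : (fun q : R * R => 1 + q.2 - a * `|q.1|) @ p --> 1 + p.2 - a * `|p.1|.
  apply: cvgB; first by apply: cvgD; [exact: cvg_cst|exact: cvg_snd].
  by apply: cvgM; [exact: cvg_cst|exact: cvg_norm].
have c2 : (fun q : R * R => b * q.1) @ p --> b * p.1.
  by apply: cvgM => //; exact: cvg_cst.
exact: cvg_pair c1 c2.
Qed.

Lemma attracting_set_measurable : measurable (attracting_set a b M).
Proof.
apply: bigcapT_measurable => n; apply: closed_plane_measurable.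
apply: compact_closed.
  exact: norm_hausdorff.
elim: n => [|n IH]; first by rewrite image_id.
have -> : iter n.+1 (lozi a b) @` M = lozi a b @` (iter n (lozi a b) @` M).
  by rewrite image_comp.
apply: continuous_compact IH; apply: continuous_subspaceT; exact: continuous_lozi.
Qed.

End attractor_measurable.

(** * The integral bound *)
Section disintegration.
Context {d d'} {T : measurableType d} {U : measurableType d'} {R : realType}.
Variables (rho : probability T R) (xi : T -> U) (kappa : R.-pker U ~> T).
Hypothesis mxi : measurable_fun setT xi.
Hypothesis rhoE : forall E, measurable E ->
  rho E = (\int[rho]_p kappa (xi p) E)%E.

(** The conditional measures and [rho], seen as kernels, have a composition; the
    disintegration formula for functions is the integration formula for this
    composition. *)
Definition base_kernel of unit : {measure set T -> \bar R} := rho.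

Let base_kernel_measurable V : measurable V ->
  measurable_fun setT (base_kernel ^~ V).
Proof. by move=> mV; exact: measurable_cst. Qed.

HB.instance Definition _ := isKernel.Build _ _ _ _ _ base_kernel
  base_kernel_measurable.

Let base_kernel_prob x : base_kernel x setT = 1%E.
Proof. exact: probability_setT. Qed.

HB.instance Definition _ := Kernel_isProbability.Build _ _ _ _ _ base_kernel
  base_kernel_prob.

(** The measurability proof is an argument so that the kernel instance can refer
    to it. *)
Definition fibre_kernel of measurable_fun setT xi :
  unit * T -> {measure set T -> \bar R} := fun p => kappa (xi p.2).

Let fibre_kernel_measurable V : measurable V ->
  measurable_fun setT (fibre_kernel mxi ^~ V).
Proof.
move=> mV; apply: (measurableT_comp (measurable_kernel kappa V mV)).
exact: measurableT_comp mxi measurable_snd.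
Qed.

HB.instance Definition _ := isKernel.Build _ _ _ _ _ (fibre_kernel mxi)
  fibre_kernel_measurable.

Let fibre_kernel_prob x : fibre_kernel mxi x setT = 1%E.
Proof. exact: prob_kernel. Qed.

HB.instance Definition _ := Kernel_isProbability.Build _ _ _ _ _ (fibre_kernel mxi)
  fibre_kernel_prob.

Lemma integral_disintegration (f : T -> \bar R) : measurable_fun setT f ->
  (forall x, 0 <= f x)%E ->
  (\int[rho]_p f p = \int[rho]_p \int[kappa (xi p)]_q f q)%E.
Proof.
move=> mf f0.
rewrite -[RHS](integral_kcomp base_kernel (fibre_kernel mxi) tt f0 mf).
by apply: eq_measure_integral => A mA _; exact: rhoE.
Qed.

End disintegration.

Section unit_mass.
Context {d} {T : measurableType d} {R : realType} (m : {measure set T -> \bar R}).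
Hypothesis m1 : m setT = 1%E.

Lemma unit_mass_integrable (f : T -> R) : bounded_measurable f ->
  m.-integrable setT (EFin \o f).
Proof. by apply: bounded_measurable_integrable => //; rewrite m1 ltry. Qed.

Lemma unit_mass_shift (f : T -> R) (c : R) : bounded_measurable f ->
  (\int[m]_x (f x + c)%:E = (\int[m]_x f x + c)%:E)%E.
Proof.
move=> bf; have bfc := bounded_measurableD bf (bounded_measurable_cst c).
rewrite -[LHS]fineK; last first.
  by apply: integrable_fin_num => //; exact: unit_mass_integrable bfc.
congr EFin; rewrite -[LHS]/(\int[m]_x (f x + c)) RintegralD//.
- by rewrite Rintegral_cst// m1 mulr1.
- exact: unit_mass_integrable.
- by apply: (unit_mass_integrable (f := cst c)); exact: bounded_measurable_cst.
Qed.

Lemma unit_mass_le (f : T -> R) (c : R) : bounded_measurable f ->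
  (forall x, f x <= c) -> \int[m]_x f x <= c.
Proof.
move=> bf fc.
have -> : c = \int[m]_x c by rewrite Rintegral_cst// m1 mulr1.
apply: le_Rintegral => //; first exact: unit_mass_integrable.
by apply: (unit_mass_integrable (f := cst c)); exact: bounded_measurable_cst.
Qed.

End unit_mass.

Section integral_bound.
Context {R : realType} (a b : R) (M : set (R * R)).
Variable rho : probability (R * R)%type R.
Hypothesis hyp : hyperbolic a b.
Hypothesis cM : compact M.
Hypothesis fM : lozi a b @` M `<=` M°.
Hypothesis srb : SRB_measure a b rho.
Hypothesis supp : rho (~` attracting_set a b M) = 0%E.

Lemma integrable_rho (f : R * R -> R) : bounded_measurable f ->
  rho.-integrable setT (EFin \o f).
Proof.
by apply: bounded_measurable_integrable => //; rewrite [X in (X < _)%E]probability_setT ltry.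
Qed.

Lemma ae_attracting_set : {ae rho, forall q, attracting_set a b M q}.
Proof.
exists (~` attracting_set a b M); split; [|exact: supp|by []].
by apply: measurableC; exact: attracting_set_measurable.
Qed.

(** The attractor has full measure and lies above the floor, so the cut-off is
    almost everywhere ineffective. *)
Lemma Rintegral_pullback_invariant (phi : R * R -> R) : bounded_measurable phi ->
  \int[rho]_q pullback a b phi q = \int[rho]_q phi q.
Proof.
move=> bf; have [mf [S fS]] := bf; have [inv _] := srb.
have ml := measurable_lozi a b.
have bcomp : bounded_measurable (phi \o lozi a b).
  by split; [exact: measurableT_comp mf ml|exists S => x; exact: fS].
transitivity (\int[rho]_q phi (lozi a b q)).
  rewrite /Rintegral; congr fine; apply: ae_eq_integral => //.
  - by apply/measurable_EFinP; case: (bounded_measurable_pullback a b bf).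
  - by apply/measurable_EFinP; case: bcomp.
  case: ae_attracting_set => N [mN N0 NA]; exists N; split => // q /= /not_implyP[_ neq].
  apply: NA => Aq; apply: neq.
  by rewrite /pullback (attracting_set_above hyp cM fM Aq).
rewrite /Rintegral; congr fine.
have := @integral_pushforward _ _ _ _ R (lozi a b) ml rho setT (EFin \o phi).
rewrite preimage_setT => <-//.
- by apply: eq_measure_integral => A mA _; exact: inv.
- exact/measurable_EFinP.
- exact: integrable_rho bcomp.
Qed.

Lemma Rintegral_pullback_iter (phi : R * R -> R) n : bounded_measurable phi ->
  \int[rho]_q iter n (pullback a b \o pullback a b) phi q = \int[rho]_q phi q.
Proof.
move=> bf; have bn m : bounded_measurable
    (iter m (pullback a b \o pullback a b) phi).
  elim: m => // m IH; exact/bounded_measurable_pullback/bounded_measurable_pullback.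
elim: n => // n IH.
rewrite iterS /= !Rintegral_pullback_invariant//.
exact: bounded_measurable_pullback.
Qed.

Lemma pullback_iter_le (phi : R * R -> R) S n : (forall q, `|phi q| <= S) ->
  forall q, `|iter n (pullback a b \o pullback a b) phi q| <= S.
Proof.
have step f : (forall q, `|f q| <= S) -> forall q, `|pullback a b f q| <= S.
  move=> fS q; rewrite /pullback; case: ifPn => // _.
  by rewrite normr0 (le_trans _ (fS q)).
by move=> fS; elim: n => // n IH; exact/step/step.
Qed.

(** The iterated pullbacks [phi n] of [g] all have the integral of [g], which is
    the average of their means for the conditional measures. Each of these
    means is asymptotically at most [line_density a b] by [fibre_bound]. They
    are bounded uniformly in [n], so the bound passes to the average. *)
Lemma segment_bounded_Rintegral (g : R * R -> R) : bounded_measurable g ->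
  segment_bounded b g 1 0 -> \int[rho]_q g q <= line_density a b.
Proof.
move=> bg seg; have [mg [S gS]] := bg.
have [_ [xi [kappa [mxi dis ae]]]] := srb.
have S0 : 0 <= S by exact: le_trans (gS (0, 0)).
set be := line_density a b; have be0 : 0 <= be := line_density_ge0 hyp.
pose phi n := iter n (pullback a b \o pullback a b) g.
have bphi n : bounded_measurable (phi n) by have [] := segment_bounded_iter hyp n bg seg.
have segphi n : segment_bounded b (phi n) (contraction a b ^+ n) be.
  by have [] := segment_bounded_iter hyp n bg seg.
have phiS n q : `|phi n q| <= S by exact: pullback_iter_le.
have rhoE E : measurable E -> rho E = (\int[rho]_p kappa (xi p) E)%E.
  by move=> mE; have := dis E setT mE measurableT; rewrite setIT preimage_setT.
(* adding [S] makes the integrands nonnegative, as the disintegration requires *)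
pose psi n p := (\int[kappa (xi p)]_q (phi n q + S)%:E)%E.
pose c := (S + be)%:E.
have mphiS n : measurable_fun setT (fun q => (phi n q + S)%:E).
  by apply/measurable_EFinP; apply: measurable_funD => //; case: (bphi n).
have phiS0 n q : (0 <= (phi n q + S)%:E)%E.
  by rewrite lee_fin; have := phiS n q; rewrite ler_norml => /andP[+ _]; lra.
have psi0 n p : (0 <= psi n p)%E by apply: integral_ge0 => q _; exact: phiS0.
have mpsi n : measurable_fun setT (psi n).
  have := measurable_fun_integral_kernel (l := kappa) (measurable_kernel kappa)
    (phiS0 n) (mphiS n).
  by move=> h; exact: measurableT_comp h mxi.
have k1 p : kappa (xi p) setT = 1%E by exact: prob_kernel.
have psiE n p : psi n p = (\int[kappa (xi p)]_q phi n q + S)%:E.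
  exact: unit_mass_shift (k1 p) _ _ (bphi n).
have psi_le n p : (psi n p <= (S + S)%:E)%E.
  rewrite psiE lee_fin lerD2r; apply: unit_mass_le => // q.
  exact: le_trans (ler_norm _) (phiS n q).
have intpsi n : (\int[rho]_p psi n p = (\int[rho]_q g q + S)%:E)%E.
  rewrite -(integral_disintegration mxi rhoE (mphiS n) (phiS0 n)).
  rewrite (unit_mass_shift (m := rho))//; last exact: probability_setT.
  by rewrite Rintegral_pullback_iter.
have psi_ev p : (exists u v, local_unstable a b u v /\
    kappa (xi p) `<< segment_length u v) ->
    forall e, 0 < e -> \forall n \near \oo, (psi n p <= c + e%:E)%E.
  move=> [u [v [lu ac]]] e e0.
  have [w0 cone] := local_unstable_cone hyp lu.
  have /andP[t0 t1] := contraction_itv hyp.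
  have := @fibre_bound R b u v (kappa (xi p)) phi (fun n => contraction a b ^+ n)
    S be (k1 p) w0 cone ac (fun n => (bphi n).1) phiS.
  case/(_ _ _ be0 segphi _ e0) => [n||N NN NP]; first by rewrite exprn_ge0// ltW.
    by apply: cvg_expr; rewrite ger0_norm// ltW.
  exists N => // n /NP /= h; rewrite psiE /c -EFinD lee_fin.
  by have := ler_norm (\int[kappa (xi p)]_q phi n q); lra.
pose r n p := \int[kappa (xi p)]_q phi n q + S.
have mr n : measurable_fun setT (r n).
  apply/measurable_EFinP; rewrite (_ : EFin \o _ = psi n)//.
  by apply/funext => p; rewrite psiE.
(* the means need not converge, but their maximum with the bound does *)
pose top n p := (Num.max (r n p) (S + be))%:E.
have mtop n : measurable_fun setT (top n).
  by apply/measurable_EFinP; apply: measurable_maxr.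
have topcvg : (\int[rho]_p top n p @[n --> \oo] --> \int[rho]_p c)%E.
  have := @dominated_convergence _ _ _ rho setT measurableT top (cst c)
    (cst (S + S + be)%:E).
  case => //.
  - case: ae => N [mN N0 NA]; exists N; split => // p /= hp; apply: NA => /= -[u [v [lu _ _ _ ac]]].
    apply: hp => _; apply: cvg_EFin; first by apply: nearW.
    apply/cvgrPdist_le => e e0.
    have := psi_ev p (ex_intro _ u (ex_intro _ v (conj lu ac))) e e0.
    apply: filterS => n; rewrite psiE /c -EFinD lee_fin => h.
    rewrite /top/= distrC ger0_norm ?subr_ge0 ?le_max ?lexx ?orbT//.
    by rewrite lerBlDl ge_max h lerDl ltW.
  - apply: (unit_mass_integrable (probability_setT rho) (f := cst _)).
    exact: bounded_measurable_cst.
  - apply: aeW => p n _ /=; rewrite lee_fin ger0_norm.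
      rewrite ge_max lerD2r lerDr S0 andbT.
      by have := psi_le n p; rewrite psiE lee_fin => h; rewrite (le_trans h)// lerDl.
    by rewrite le_max (addr_ge0 S0 be0) orbT.
have : ((\int[rho]_q g q + S)%:E <= \int[rho]_p c)%E.
  rewrite -(cvg_lim _ topcvg)//; apply: lime_ge; first by apply/cvg_ex; eexists; exact: topcvg.
  apply: nearW => n; rewrite -(intpsi n); apply: ge0_le_integral => //.
  - by move=> p _; rewrite psiE /top lee_fin le_max lexx.
rewrite integral_cst//; set rT := (X in (_ * X)%E).
have -> : rT = 1%E by exact: probability_setT.
by rewrite mule1 lee_fin addrC lerD2l.
Qed.

End integral_bound.

(** * Vertical strips and segments *)
Section finite_sums.
Context {d} {T : measurableType d} {R : realType}.

Lemma bounded_measurable_sum (f_ : nat -> T -> R) n :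
  (forall k, bounded_measurable (f_ k)) ->
  bounded_measurable (fun x => \sum_(0 <= k < n) f_ k x).
Proof.
move=> bf; elim: n => [|n IH].
  by under eq_fun do rewrite big_geq//; exact: bounded_measurable_cst.
under eq_fun do rewrite big_nat_recr//=.
exact: bounded_measurableD.
Qed.

Lemma Rintegral_sum (m : {measure set T -> \bar R}) D (f_ : nat -> T -> R) n :
  measurable D -> (m D < +oo)%E -> (forall k, bounded_measurable (f_ k)) ->
  \int[m]_(x in D) (\sum_(0 <= k < n) f_ k x) =
  \sum_(0 <= k < n) \int[m]_(x in D) f_ k x.
Proof.
move=> mD Doo bf; elim: n => [|n IH].
  rewrite big_geq//; under eq_Rintegral do rewrite big_geq//.
  by rewrite Rintegral_cst// mul0r.
under eq_Rintegral do rewrite big_nat_recr//=.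
rewrite RintegralD//; last 2 first.
- apply: (bounded_measurable_integrable (f := fun x => \sum_(0 <= k < n) f_ k x)) => //.
  exact: bounded_measurable_sum.
- exact: bounded_measurable_integrable.
by rewrite big_nat_recr//= IH.
Qed.

End finite_sums.

Section clamp.
Context {R : realType}.

Definition clamp (z : R) : R := Num.max (- 1) (Num.min 1 z).

Lemma clamp_itv z : - 1 <= clamp z <= 1.
Proof. by rewrite /clamp le_max lexx/= ge_max ge_min lexx/= andbT; lra. Qed.

Lemma clamp_nd : {homo clamp : x y / x <= y}.
Proof.
move=> x y xy; rewrite /clamp /Num.max /Num.min.
by repeat case: ifPn => //; lra.
Qed.

Lemma clamp_ge0 z : 0 <= z -> 0 <= clamp z.
Proof. by move=> z0; rewrite /clamp le_max le_min z0 ler01 orbT. Qed.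

Lemma clamp_le0 z : z <= 0 -> clamp z <= 0.
Proof. by move=> z0; rewrite /clamp ge_max ge_min z0 orbT andbT; lra. Qed.

(** According to the sign of [z], the function is nonincreasing with values in
    [0, 1] or nondecreasing with values in [-1, 0]. *)
Lemma clamp_variation z (a b : R) s : 0 < a -> itv_partition a b s ->
  variation a b (fun d => clamp (z / d)) s <= 1.
Proof.
move=> a0 abs.
have ab : a <= b by exact: itv_partition_le abs.
have b0 : 0 < b by exact: lt_le_trans ab.
have /andP[ca1 ca2] := clamp_itv (z / a); have /andP[cb1 cb2] := clamp_itv (z / b).
have inv x y : x \in `[a, b] -> x <= y -> y^-1 <= x^-1.
  rewrite in_itv/= => /andP[ax _] xy.
  by rewrite lef_pV2 ?posrE ?(lt_le_trans a0)// (le_trans ax).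
have [z0|/ltW z0] := leP 0 z.
- rewrite (nonincreasing_variation _ abs); last first.
    by move=> x y xab _ xy; apply/clamp_nd/ler_wpM2l => //; exact: inv.
  have : 0 <= clamp (z / b) by rewrite clamp_ge0// divr_ge0// ltW.
  by lra.
- rewrite (nondecreasing_variation _ abs); last first.
    by move=> x y xab _ xy; apply/clamp_nd/ler_wnM2l => //; exact: inv.
  have : clamp (z / b) <= 0 by rewrite clamp_le0// mulr_le0_ge0// invr_ge0 ltW.
  by lra.
Qed.

End clamp.

Section strips.
Context {R : realType}.
Notation mu := (@lebesgue_measure R).

Lemma lebesgue_sandwich (A : set R) (s t : R) : measurable A ->
  `]s, t[%classic `<=` A -> A `<=` `[s, t]%classic ->
  fine (mu A) = Num.max 0 (t - s).
Proof.
move=> mA sA As.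
have len b1 b2 : mu [set` Interval (BSide b1 s) (BSide b2 t)] =
    (Num.max 0 (t - s))%:E.
  rewrite /= lebesgue_measure_itv/= lte_fin; case: ltP => [st|ts].
    by rewrite -EFinD; congr EFin; rewrite max_r// subr_ge0 ltW.
  by rewrite max_l// subr_le0.
have -> : mu A = (Num.max 0 (t - s))%:E; last by [].
apply/eqP; rewrite eq_le; apply/andP; split.
  rewrite -(len true false); apply: le_measure; rewrite ?inE//.
rewrite -(len false true); apply: le_measure; rewrite ?inE//.
Qed.

(** Endpoints that may or may not belong to the interval. *)
Lemma finite_interval_hull (J : set R) : is_interval J -> (mu J < +oo)%E ->
  exists c0 d0 : R, [/\ c0 <= d0, `]c0, d0[%classic `<=` J &
    J !=set0 -> J `<=` `[c0, d0]%classic].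
Proof.
move=> iJ Joo.
have [[t0 Jt0]|J0] := pselect (J !=set0); last first.
  by exists 0, 0; split => // x/=; rewrite in_itv/= => /andP[x0 /(lt_trans x0)]; rewrite ltxx.
move/is_intervalP : iJ Joo Jt0 => ->; move: (Rhull J) => [i j].
rewrite /= lebesgue_measure_itv/=.
case: i => [b1 c0|[]]; case: j => [b2 d0|[]] //=; rewrite ?ltNyr ?ltry//=.
- move=> _; rewrite itv_boundlr => /andP[ct td].
  have ct' : c0 <= t0 by case: b1 ct; rewrite bnd_simp// => /ltW.
  have td' : t0 <= d0 by case: b2 td; rewrite bnd_simp// => /ltW.
  exists c0, d0; split=> [|x|_ x]; first exact: le_trans td'.
    rewrite /= !itv_boundlr !bnd_simp => /andP[cx xd].
    by case: (b1); case: (b2); rewrite !bnd_simp ?cx ?xd ?(ltW cx) ?(ltW xd).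
  rewrite /= !itv_boundlr !bnd_simp => /andP[cx xd].
  apply/andP; split; first by case: (b1) cx; rewrite bnd_simp// => /ltW.
  by case: (b2) xd; rewrite bnd_simp// => /ltW.
- by move=> _; rewrite itv_boundlr andbC.
Qed.

Definition strip_ratio (x c d : R) (q : R * R) : R :=
  (2 * d)^-1 * \1_(vertical_strip x d `&` [set q | q.2 <= c]) q.

Lemma measurable_lower c : measurable [set q : R * R | q.2 <= c].
Proof.
have -> : [set q : R * R | q.2 <= c] = setT `*` `]-oo, c]%classic.
  by apply/seteqP; split => q /=; rewrite in_itv//= => -[].
by apply: measurableX => //; exact: measurable_itv.
Qed.

Lemma measurable_strip (x d : R) : measurable (vertical_strip x d).
Proof. by apply: measurableX => //; exact: measurable_itv. Qed.

Lemma measurable_strip_lower (x c d : R) :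
  measurable (vertical_strip x d `&` [set q | q.2 <= c]).
Proof.
by apply: measurableI; [exact: measurable_strip|exact: measurable_lower].
Qed.

Lemma bounded_measurable_strip_ratio x c d : bounded_measurable (strip_ratio x c d).
Proof.
apply: bounded_measurableM; first exact: bounded_measurable_cst.
by apply: bounded_measurable_indic; exact: measurable_strip_lower.
Qed.

Lemma clamp_scale (r z : R) : 0 < r ->
  r * clamp (z / r) = Num.max (- r) (Num.min r z).
Proof.
move=> r0; rewrite /clamp maxr_pMr ?ltW// minr_pMr ?ltW//.
by rewrite mulrN mulr1 mulrCA divff ?gt_eqF// mulr1.
Qed.

(** The part of the segment below height [c] is an interval of times, and the
    strip is the interval of radius [d / |w.1|] around [(x - p.1) / w.1]. The
    length of the intersection is a difference of clamped endpoints, in which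
    [d] appears only through [be / d] and [al / d]. *)
Lemma segment_strip_ratio (p w : R * R) (J : set R) (x c : R) : w.1 != 0 ->
  is_interval J -> (mu J < +oo)%E ->
  exists al be : R, forall d, 0 < d ->
    \int[mu]_(t in J) strip_ratio x c d (ray p w t) =
    (clamp (be / d) - clamp (al / d)) / (2 * `|w.1|).
Proof.
move=> w0 iJ Joo; have mJ := is_interval_measurable iJ.
have w1 : 0 < `|w.1| by rewrite normr_gt0.
pose low := [set t : R | - c <= - p.2 + t * - w.2].
have ilow : is_interval low by exact: is_interval_affine_ge.
have lowE t : low t <-> p.2 + t * w.2 <= c.
  by rewrite /low/=; split; rewrite mulrN; lra.
pose J' := J `&` low.
have iJ' : is_interval J' by exact: is_intervalI.
have mJ' := is_interval_measurable iJ'.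
have [J'oo _] := fine_measure_le (mu:=mu) mJ Joo mJ' (@subIsetl _ _ _).
have intE d : 0 < d -> \int[mu]_(t in J) strip_ratio x c d (ray p w t) =
    (2 * d)^-1 * fine (mu (J' `&` [set t | `|p.1 + t * w.1 - x| < d])).
  move=> d0.
  set A := ray p w @^-1` (vertical_strip x d `&` [set q | q.2 <= c]).
  have mA : measurable A.
    rewrite -[X in measurable X]setTI; apply: measurable_ray => //.
    exact: measurable_strip_lower.
  have -> : J' `&` [set t | `|p.1 + t * w.1 - x| < d] = A `&` J.
    rewrite /J' [RHS]setIC -setIA; congr (_ `&` _).
    apply/seteqP; split => t.
      move=> [/lowE h /=]; rewrite ltr_distl => h'; split => //; split => //=.
    move=> [[/= + _] h]; rewrite in_itv/= => h'.
    by split; [exact/lowE|rewrite /= ltr_distl].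
  have bind : bounded_measurable (\1_A : R -> R) by exact: bounded_measurable_indic.
  transitivity (\int[mu]_(t in J) ((2 * d)^-1 * \1_A t)).
    by apply: eq_Rintegral => t _; rewrite /strip_ratio !indicE.
  rewrite RintegralZl//; last exact: bounded_measurable_integrable.
  by congr (_ * _); rewrite /Rintegral integral_indic.
have [c0 [d0 [cd sJ Js]]] := finite_interval_hull iJ' J'oo.
have [J'0|J'0] := pselect (J' !=set0); last first.
  exists 0, 0 => d d1; rewrite intE// subrr mul0r.
  have -> : J' = set0 by apply/eqP/negPn/negP => /set0P.
  by rewrite set0I measure0 mulr0.
pose t0 := (x - p.1) / w.1.
exists ((c0 - t0) * `|w.1|), ((d0 - t0) * `|w.1|) => d d1.
pose r := d / `|w.1|; have r0 : 0 < r by rewrite divr_gt0.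
have rE z : z * `|w.1| / d = z / r by rewrite /r invf_div mulrA.
have near t : (`|p.1 + t * w.1 - x| < d) = (`|t - t0| < r).
  rewrite /r ltr_pdivlMr// -normrM mulrBl /t0 divfK//; congr (`|_| < _); ring.
rewrite intE//.
have -> : fine (mu (J' `&` [set t | `|p.1 + t * w.1 - x| < d])) =
    Num.max 0 (Num.min d0 (t0 + r) - Num.max c0 (t0 - r)).
  apply: lebesgue_sandwich.
  - apply: measurableI => //.
    have -> : [set t | `|p.1 + t * w.1 - x| < d] = `]t0 - r, t0 + r[%classic.
      by apply/seteqP; split => t /=; rewrite near in_itv/= ltr_distl.
    exact: measurable_itv.
  - move=> t /=; rewrite in_itv/= gt_max lt_min => /andP[/andP[? ?] /andP[? ?]].
    split; first by apply: sJ; rewrite /= in_itv/=; apply/andP.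
    by rewrite /= near ltr_distl; apply/andP.
  - move=> t [/(Js J'0) /=]; rewrite in_itv/= => /andP[? ?].
    rewrite near ltr_distl => /andP[? ?]; rewrite in_itv/= ge_max le_min.
    by apply/andP; split; apply/andP; split => //; exact: ltW.
rewrite !rE.
have e1 : clamp ((d0 - t0) / r) = Num.max (- r) (Num.min r (d0 - t0)) / r.
  by rewrite -clamp_scale// mulrAC divff ?mul1r// gt_eqF.
have e2 : clamp ((c0 - t0) / r) = Num.max (- r) (Num.min r (c0 - t0)) / r.
  by rewrite -clamp_scale// mulrAC divff ?mul1r// gt_eqF.
rewrite e1 e2 -mulrBl.
have -> : Num.max 0 (Num.min d0 (t0 + r) - Num.max c0 (t0 - r)) =
  Num.max (- r) (Num.min r (d0 - t0)) - Num.max (- r) (Num.min r (c0 - t0)).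
  rewrite /Num.max /Num.min; move: cd r0; clear; move: (t0) (r) => u v cd v0.
  by repeat case: ifPn => //; rewrite -?leNgt; lra.
move: (_ - Num.max _ _) => z.
rewrite /r invf_div !invfM; field.
by rewrite ?gt_eqF//=; apply/andP.
Qed.

End strips.

(** * Limits of strip densities *)
Section right_limit.
Context {R : realType}.

(** A function of bounded variation on a closed interval is a difference of
    monotone functions. The extension [g] of [f] by 0 at the origin adds a
    single jump to the variation. *)
Lemma bounded_variation_right_limit (f : R -> R) (C : R) :
  (forall d, 0 < d -> `|f d| <= C) ->
  (forall d s, 0 < d -> itv_partition d 1 s -> variation d 1 f s <= C) ->
  cvg (f d @[d --> 0^'+]).
Proof.
move=> fC fV; pose g d := if d <= 0 then 0 else f d.
have gf d : 0 < d -> g d = f d by rewrite /g leNgt => ->.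
have gBV : bounded_variation 0 1 g.
  exists (C + C) => _ [s ps <-].
  case: s ps => [/itv_partition_nil/esym/eqP|h t]; first by rewrite oner_eq0.
  move=> ps; have pt := itv_partition_cons ps.
  have h0 : 0 < h by case: ps => /= /andP[].
  have gt0 n : (n < (size t).+1)%N -> 0 < nth 1 (h :: t) n.
    by move=> nt; apply: (lt_le_trans h0); exact: itv_partition_nth_ge pt.
  rewrite /variation/= big_nat_recl//=; apply: lerD.
    by rewrite gf// /g lexx subr0 fC.
  have := fV h t h0 pt; apply: le_trans.
  rewrite /variation le_eqVlt; apply/orP; left; apply/eqP.
  apply: eq_big_nat => n /andP[_ nt] /=; rewrite !gf//.
  - exact: (gt0 n (ltnW nt)).
  - exact: (gt0 n.+1 nt).
have mono (h : R -> R) : bounded_variation 0 1 h -> cvg (fine (neg_tv 0 h d) @[d --> 0^'+]).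
  move=> hBV; have nd := fine_neg_tv_nondecreasing hBV.
  apply/cvg_ex; eexists; apply: (@nondecreasing_at_right_cvgr _ _ _ (BLeft 1)).
  - by rewrite bnd_simp.
  - move=> x y; rewrite !in_itv/= => /andP[x0 x1] /andP[y0 y1] xy.
    by apply: nd => //; rewrite in_itv/= ltW//= ltW.
  - exists (fine (neg_tv 0 h 0)) => _ [x /= + <-]; rewrite in_itv/= => /andP[x0 x1].
    by apply: nd; rewrite ?in_itv/= ?lexx ?ler01 ?ltW.
have c1 := mono _ gBV; have c2 := mono _ (bounded_variationN gBV).
have /cvg_ex[l hl] : cvg (fine (neg_tv 0 (\- g) d) - fine (neg_tv 0 g d) @[d --> 0^'+]).
  exact: is_cvgB.
apply/cvg_ex; exists l; apply: cvg_trans hl; apply: near_eq_cvg; near=> d.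
have d0 : 0 < d by near: d; exact: nbhs_right_gt.
have d1 : d < 1 by near: d; exact: nbhs_right_lt.
rewrite -gf// (bounded_variation_pos_neg_tvE gBV)//.
by rewrite in_itv/= !ltW.
Unshelve. all: by end_near. Qed.

End right_limit.

Section strip_density.
Context {R : realType} (a b : R) (M : set (R * R)).
Variable rho : probability (R * R)%type R.
Hypothesis hyp : hyperbolic a b.
Hypothesis cM : compact M.
Hypothesis fM : lozi a b @` M `<=` M°.
Hypothesis srb : SRB_measure a b rho.
Hypothesis supp : rho (~` attracting_set a b M) = 0%E.
Notation mu := (@lebesgue_measure R).
Notation L := (line_density a b).

Definition strip_density x c d : R := \int[rho]_q strip_ratio x c d q.

Lemma strip_densityE x c d : strip_density x c d =
  (2 * d)^-1 * fine (rho (vertical_strip x d `&` [set q | q.2 <= c])).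
Proof.
rewrite /strip_density /strip_ratio RintegralZl//; last first.
  apply: (integrable_rho _ (f := \1_(vertical_strip x d `&` [set q | q.2 <= c]))).
  by apply: bounded_measurable_indic; exact: measurable_strip_lower.
congr (_ * _); rewrite /Rintegral integral_indic// ?setIT//.
exact: measurable_strip_lower.
Qed.

Lemma strip_density_ge0 x c d : 0 < d -> 0 <= strip_density x c d.
Proof.
move=> d0; rewrite strip_densityE; apply: mulr_ge0; last exact: fine_ge0.
by rewrite invr_ge0 mulr_ge0// ltW.
Qed.

(** The difference of two clamped values is at most 2, so the strip ratio
    integrates to at most [1 / |w.1|] along a segment. *)
Lemma strip_density_le x c d : 0 < d -> strip_density x c d <= L.
Proof.
move=> d0; apply: (segment_bounded_Rintegral hyp cM fM srb supp).
  exact: bounded_measurable_strip_ratio.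
move=> p w J w0 cone iJ Joo; have w1 : 0 < `|w.1| by rewrite normr_gt0.
have [al [be ->//]] := segment_strip_ratio p x c w0 iJ Joo.
rewrite mul0r addr0 normrM normfV (ger0_norm (_ : 0 <= 2 * `|w.1|)) ?mulr_ge0//.
rewrite invfM mulrA ler_pM2r ?invr_gt0// ler_pdivrMr// mul1r.
have /andP[? ?] := clamp_itv (be / d); have /andP[? ?] := clamp_itv (al / d).
by rewrite ler_norml; apply/andP; split; lra.
Qed.

(** The variation over a partition is the integral of a single function, the sum
    of the increments of the strip ratio with the signs of the increments of
    their integrals. Along a segment it integrates to at most the sum of the
    variations of two clamped functions divided by [2 * |w.1|], that is, to at
    most [1 / |w.1|]. *)
Lemma strip_density_variation x c d s : 0 < d -> itv_partition d 1 s ->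
  variation d 1 (strip_density x c) s <= L.
Proof.
move=> d0 ps; pose t n := nth 1 (d :: s) n.
have t0 n : (n < (size s).+1)%N -> 0 < t n.
  by move=> ns; apply: (lt_le_trans d0); exact: itv_partition_nth_ge ps.
pose sg n := if (n < size s)%N then
  Num.sg (strip_density x c (t n.+1) - strip_density x c (t n)) else 0.
pose term n q := sg n * (strip_ratio x c (t n.+1) q - strip_ratio x c (t n) q).
have bterm n : bounded_measurable (term n).
  apply: bounded_measurableM; first exact: bounded_measurable_cst.
  by apply: bounded_measurableB; exact: bounded_measurable_strip_ratio.
pose g q := \sum_(0 <= n < size s) term n q.
have bg : bounded_measurable g by exact: bounded_measurable_sum.
have sg1 n : `|sg n| <= 1.
  by rewrite /sg; case: ifP => _; rewrite ?normr0// normr_sg; case: (_ == _).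
have -> : variation d 1 (strip_density x c) s = \int[rho]_q g q.
  rewrite Rintegral_sum//; last first.
    by rewrite [X in (X < _)%E]probability_setT ltry.
  apply: eq_big_nat => n /andP[_ ns]; rewrite /term RintegralZl//; last first.
    apply: (@integrableB _ _ _ rho setT measurableT (EFin \o strip_ratio x c (t n.+1))
      (EFin \o strip_ratio x c (t n))); apply: integrable_rho;
      exact: bounded_measurable_strip_ratio.
  rewrite RintegralB//; try (apply: integrable_rho; exact: bounded_measurable_strip_ratio).
  by rewrite /sg ns -/(strip_density x c (t n.+1)) -/(strip_density x c (t n)) -normrEsg.
apply: (segment_bounded_Rintegral hyp cM fM srb supp bg).
move=> p w J w0 cone iJ Joo; have w1 : 0 < `|w.1| by rewrite normr_gt0.
have mJ := is_interval_measurable iJ.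
have [al [be E]] := segment_strip_ratio p x c w0 iJ Joo.
rewrite mul0r addr0.
have bray (f : R * R -> R) : bounded_measurable f -> bounded_measurable (f \o ray p w).
  exact: bounded_measurable_ray.
rewrite (Rintegral_sum (m := mu) (f_ := fun n => term n \o ray p w))//; last first.
  by move=> n; exact: bray.
have vb := clamp_variation be d0 ps; have va := clamp_variation al d0 ps.
have key : forall n, (n < size s)%N -> `|\int[mu]_(t in J) term n (ray p w t)| <=
   (`|clamp (be / t n.+1) - clamp (be / t n)| +
    `|clamp (al / t n.+1) - clamp (al / t n)|) / (2 * `|w.1|).
  move=> n ns.
  have intg m : mu.-integrable J (EFin \o (strip_ratio x c m \o ray p w)).
    by apply: bounded_measurable_integrable => //; apply/bray/bounded_measurable_strip_ratio.
  rewrite RintegralZl//; last first.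
    by have := integrableB _ (intg (t n.+1)) (intg (t n)); apply.
  have -> : \int[mu]_(r in J) (strip_ratio x c (t n.+1) (ray p w r) -
        strip_ratio x c (t n) (ray p w r)) =
      \int[mu]_(r in J) strip_ratio x c (t n.+1) (ray p w r) -
      \int[mu]_(r in J) strip_ratio x c (t n) (ray p w r).
    by have := RintegralB _ (intg (t n.+1)) (intg (t n)); apply.
  rewrite !E; [|exact/t0/ltnW|exact: t0].
  rewrite normrM -mulrBl normrM normfV (ger0_norm (_ : 0 <= 2 * `|w.1|)) ?mulr_ge0//.
  rewrite mulrA ler_pM2r ?invr_gt0 ?mulr_gt0//.
  apply: le_trans (ler_pM _ _ (sg1 n) (lexx _)) _ => //.
  rewrite mul1r opprD opprK addrACA [- _ + _]addrC -[clamp (al / _) - _]opprB.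
  exact: ler_normB.
apply: (le_trans (ler_norm_sum _ _ _)).
apply: (@le_trans _ _ (\sum_(0 <= n < size s)
   (`|clamp (be / t n.+1) - clamp (be / t n)| +
    `|clamp (al / t n.+1) - clamp (al / t n)|) / (2 * `|w.1|))).
  by rewrite !big_nat; apply: ler_sum => n /andP[_ ns]; exact: key.
rewrite -mulr_suml big_split/= invfM mulrA ler_pM2r ?invr_gt0//.
by rewrite ler_pdivrMr// mul1r; exact: lerD.
Qed.

Lemma strip_density_cvg x c : cvg (strip_density x c d @[d --> 0^'+]).
Proof.
apply: (@bounded_variation_right_limit _ _ L).
  move=> d d0; rewrite ger0_norm ?strip_density_ge0//; exact: strip_density_le.
by move=> d s d0 ps; exact: strip_density_variation.
Qed.

End strip_density.

(** * Distribution functions of the slices *)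
Section slices.
Context {R : realType} (rho : probability (R * R)%type R) (L B : R).
Definition box (B : R) : set (R * R) := `[- B, B]%classic `*` `[- B, B]%classic.

(** All that the construction of the slices uses about the dynamics; the bound
    [L] is that of the strip densities and [B] that of the attractor. *)
Definition regular_strips : Prop :=
  [/\ 0 <= B, rho (~` box B) = 0%E,
      (forall x c d, 0 < d -> strip_density rho x c d <= L) &
      (forall x c, cvg (strip_density rho x c d @[d --> 0^'+]))].

Hypothesis reg : regular_strips.
Let B0 : 0 <= B. Proof. by case: reg. Qed.
Let rho_box : rho (~` box B) = 0%E. Proof. by case: reg. Qed.
Let dens_le x c d : 0 < d -> strip_density rho x c d <= L.
Proof. by case: reg => _ _ h _; exact: h. Qed.
Let dens_cvg x c : cvg (strip_density rho x c d @[d --> 0^'+]).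
Proof. by case: reg. Qed.

Lemma measurable_box (C : R) : measurable (box C).
Proof. by apply: measurableX; exact: measurable_itv. Qed.

Lemma rho_fin A : measurable A -> rho A \is a fin_num.
Proof. by move=> mA; exact: fin_num_measure. Qed.

Lemma rho_off_box A : measurable A -> A `&` box B = set0 -> rho A = 0%E.
Proof.
move=> mA AB; apply/eqP; rewrite -measure_le0 -rho_box; apply: le_measure.
- by rewrite inE.
- by rewrite inE; apply: measurableC; exact: measurable_box.
- by move=> q Aq bq; have : (A `&` box B) q by []; rewrite AB.
Qed.

Lemma rho_eq_on_box A A' : measurable A -> measurable A' ->
  A `&` box B = A' `&` box B -> rho A = rho A'.
Proof.
move=> mA mA' AA'; have mb := measurable_box B.
have split C : measurable C -> rho C = rho (C `&` box B).
  move=> mC; rewrite -[in LHS](setIT C) -(setUv (box B)) setIUr measureU//.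
  - rewrite [X in (_ + X)%E]rho_off_box ?adde0//.
      by apply: measurableI => //; exact: measurableC.
    by rewrite -setIA setICl setI0.
  - exact: measurableI.
  - by apply: measurableI => //; exact: measurableC.
  - by rewrite setIACA setICr setI0.
by rewrite split// AA' -split.
Qed.

Lemma strip_density_nd x d : 0 < d ->
  {homo strip_density rho x ^~ d : c c' / c <= c'}.
Proof.
move=> d0 c c' cc'; rewrite !strip_densityE; apply: ler_wpM2l.
  by rewrite invr_ge0 mulr_ge0// ltW.
apply: fine_le; rewrite ?rho_fin//; try exact: measurable_strip_lower.
apply: le_measure; rewrite ?inE; try exact: measurable_strip_lower.
by move=> q [sq qc]; split => //=; exact: le_trans cc'.
Qed.

Lemma strip_density_low x c d : c < - B -> strip_density rho x c d = 0.
Proof.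
move=> cB; rewrite strip_densityE rho_off_box ?mulr0//.
  exact: measurable_strip_lower.
apply/seteqP; split => // q [[_ /= qc] [_]]; rewrite /= in_itv/= => /andP[Bq _].
by have := lt_le_trans cB Bq; rewrite ltNge qc.
Qed.

Lemma strip_density_high x c d : B <= c ->
  strip_density rho x c d = strip_density rho x B d.
Proof.
move=> Bc; rewrite !strip_densityE; congr (_ * fine _).
apply: rho_eq_on_box; try exact: measurable_strip_lower.
apply/seteqP; split => q [[sq /= qc] bq]; split => //; split => //=.
  by case: bq => _; rewrite /= in_itv/= => /andP[].
exact: le_trans Bc.
Qed.

Lemma strip_density_out x c d : d <= `|x| - B -> strip_density rho x c d = 0.
Proof.
move=> dx; rewrite strip_densityE rho_off_box ?mulr0//.
  exact: measurable_strip_lower.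
apply/seteqP; split => // q [[[/= + _] _] [+ _]]; rewrite /= !in_itv/= -ltr_distl -ler_norml.
move=> h1 h2; have := lerB_dist x q.1; rewrite distrC; lra.
Qed.

Let near0_cvg (f : R -> R) : (\forall d \near 0^'+, f d = 0) ->
  f d @[d --> 0^'+] --> 0.
Proof.
move=> f0; have c0 : (fun _ : R => 0 : R) @ 0^'+ --> 0 by exact: cvg_cst.
by apply: cvg_trans c0; apply: near_eq_cvg; apply: filterS f0 => d.
Qed.

Definition lower_density x c : R := lim (strip_density rho x c d @[d --> 0^'+]).

Lemma lower_density_cvg x c :
  strip_density rho x c d @[d --> 0^'+] --> lower_density x c.
Proof. exact: dens_cvg. Qed.

Lemma lower_density_itv x c : 0 <= lower_density x c <= L.
Proof.
apply/andP; split.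
  apply: limr_ge => //; near=> d; apply: strip_density_ge0.
  by near: d; exact: nbhs_right_gt.
apply: limr_le => //; near=> d; apply: dens_le.
by near: d; exact: nbhs_right_gt.
Unshelve. all: by end_near. Qed.

Lemma lower_density_nd x : {homo lower_density x : c c' / c <= c'}.
Proof.
move=> c c' cc'; apply: ler_lim => //; near=> d; apply: strip_density_nd => //.
Unshelve. all: by end_near. Qed.

Lemma lower_density_low x c : c < - B -> lower_density x c = 0.
Proof.
move=> cB; apply: cvg_lim => //; apply: near0_cvg.
by apply: nearW => d; exact: strip_density_low.
Qed.

Lemma lower_density_high x c : B <= c -> lower_density x c = lower_density x B.
Proof.
move=> Bc; rewrite /lower_density.
by have -> : strip_density rho x c = strip_density rho x B
  by apply/funext => d; exact: strip_density_high.
Qed.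

Lemma lower_density_out x c : B < `|x| -> lower_density x c = 0.
Proof.
move=> Bx; apply: cvg_lim => //; apply: near0_cvg; near=> d.
apply: strip_density_out.
by near: d; apply: nbhs_right_le; rewrite subr_gt0.
Unshelve. all: by end_near. Qed.

(** The function [lower_density x] may fail to be right-continuous, when mass
    above the height [c] in the strips tends to height [c] as they shrink. Its
    right limit is the distribution function of the limit measure. *)
Definition slice_cdf x c : R :=
  inf (range (fun n : nat => lower_density x (c + n.+1%:R^-1))).

Let lbound x c : has_lbound (range (fun n : nat => lower_density x (c + n.+1%:R^-1))).
Proof. by exists 0 => _ [n _ <-]; have /andP[] := lower_density_itv x (c + n.+1%:R^-1). Qed.

Lemma slice_cdf_cvg x c :
  lower_density x (c + n.+1%:R^-1) @[n --> \oo] --> slice_cdf x c.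
Proof.
apply: nonincreasing_cvgn => // m n mn; apply: lower_density_nd.
by rewrite lerD2l lef_pV2 ?posrE// ler_nat ltnS.
Qed.

Lemma slice_cdf_ge x c : lower_density x c <= slice_cdf x c.
Proof.
apply: lb_le_inf; first by exists (lower_density x (c + 1%:R^-1)); exists 0%N.
by move=> _ [n _ <-]; apply: lower_density_nd; rewrite lerDl.
Qed.

Lemma slice_cdf_le x c c' : c < c' -> slice_cdf x c <= lower_density x c'.
Proof.
rewrite -subr_gt0 => cc'.
have [N _ /(_ N (leqnn N)) /= h] := near_infty_natSinv_lt (PosNum cc').
apply: (@le_trans _ _ (lower_density x (c + N.+1%:R^-1))).
  by apply: ge_inf => //; exists N.
by apply: lower_density_nd; rewrite -lerBrDl ltW.
Qed.

Lemma slice_cdf_nd x : {homo slice_cdf x : c c' / c <= c'}.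
Proof.
move=> c c'; rewrite le_eqVlt => /predU1P[->//|cc'].
exact: le_trans (slice_cdf_le x cc') (slice_cdf_ge x c').
Qed.

Lemma slice_cdf_rc x : right_continuous (slice_cdf x).
Proof.
move=> c; apply/cvgrPdist_le => e e0.
have /cvgrPdist_le/(_ e e0)[N _ /(_ N (leqnn N)) /= h] := slice_cdf_cvg (x := x) (c := c).
near=> c'.
have cc' : c < c' by near: c'; exact: nbhs_right_gt.
have c'N : c' < c + N.+1%:R^-1 by near: c'; apply: nbhs_right_lt; rewrite ltrDl.
have h1 := slice_cdf_nd x (ltW cc'); have h2 := slice_cdf_le x c'N.
rewrite distrC ger0_norm ?subr_ge0//.
move: h; rewrite distrC => /(le_trans (ler_norm _)); lra.
Unshelve. all: by end_near. Qed.

Lemma slice_cdf_low x c : c < - B -> slice_cdf x c = 0.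
Proof.
move=> cB; apply/eqP; rewrite eq_le; apply/andP; split.
  have h : c < (c - B) / 2 by lra.
  rewrite -(@lower_density_low x ((c - B) / 2)); last lra.
  exact: slice_cdf_le.
have /andP[h _] := lower_density_itv x c; exact: le_trans h (slice_cdf_ge x c).
Qed.

Lemma slice_cdf_high x c : B <= c -> slice_cdf x c = lower_density x B.
Proof.
move=> Bc; apply/eqP; rewrite eq_le; apply/andP; split.
  rewrite -(@lower_density_high x (c + 1)); last lra.
  by apply: slice_cdf_le; rewrite ltrDl.
by rewrite -(lower_density_high x Bc) slice_cdf_ge.
Qed.

Definition slice_cumulative x : cumulative R R :=
  HB.pack (slice_cdf x) (isCumulative.Build R _ R (slice_cdf x)
    (slice_cdf_nd x) (@slice_cdf_rc x)).

End slices.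

(** * The slices *)
Section slice_measure.
Context {R : realType} (rho : probability (R * R)%type R) (L B : R).
Hypothesis reg : regular_strips rho L B.
Notation F := (slice_cdf rho).
Notation ray_to c := (`]-oo, c]%classic : set (measurableTypeR R)).

Definition slice_line x : {measure set (measurableTypeR R) -> \bar R} :=
  lebesgue_stieltjes_measure (slice_cumulative reg x).

Lemma slice_line_oc x s t : s <= t -> slice_line x `]s, t]%classic = (F x t - F x s)%:E.
Proof.
move=> st; rewrite /slice_line /= /lebesgue_stieltjes_measure.
rewrite /measure_extension measurable_mu_extE/=; last exact: is_ocitv.
by rewrite wlength_itv_bnd.
Qed.

Lemma slice_line_Nyc x c : slice_line x (ray_to c) = (F x c)%:E.
Proof.
pose I n : set (measurableTypeR R) := `]c - n%:R, c]%classic.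
have E : ray_to c = \bigcup_n I n.
  apply/seteqP; split => y.
    rewrite /= in_itv/= => yc; exists (Num.bound (c - y)) => //.
    rewrite /I/= in_itv/= yc andbT ltrBlDr -ltrBlDl.
    exact: unstable.ltr_bound.
  by move=> [n _ /=]; rewrite !in_itv/= => /andP[].
have mI n : measurable (I n) by exact: measurable_itv.
have h1 : (slice_line x \o I) n @[n --> \oo] --> slice_line x (ray_to c).
  rewrite E; apply: nondecreasing_cvg_mu => //.
    by rewrite -E; exact: measurable_itv.
  move=> m n mn; apply/subsetPset => y; rewrite /I/= !in_itv/= => /andP[+ ->].
  by rewrite andbT; apply: le_lt_trans; rewrite lerD2l lerN2 ler_nat.
have h2 : (slice_line x \o I) n @[n --> \oo] --> (F x c)%:E.
  have c0 : (fun _ : nat => (F x c)%:E) @ \oo --> (F x c)%:E by exact: cvg_cst.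
  apply: cvg_trans c0; apply: near_eq_cvg.
  exists (Num.bound (c + B)) => // n /= Bn.
  have cB : c + B < n%:R.
    by apply: (lt_le_trans (unstable.ltr_bound _)); rewrite ler_nat.
  have low : c - n%:R < - B by lra.
  by rewrite slice_line_oc ?gerBl// (slice_cdf_low reg x low) subr0.
exact: (cvg_unique _ h1 h2).
Qed.

Lemma slice_line_T x : slice_line x setT = (lower_density rho x B)%:E.
Proof.
pose I n : set (measurableTypeR R) := ray_to n%:R.
have E : setT = \bigcup_n I n.
  apply/seteqP; split => // y _; exists (Num.bound y) => //.
  by rewrite /I/= in_itv/=; apply/ltW; exact: unstable.ltr_bound.
have mI n : measurable (I n) by exact: measurable_itv.
have h1 : (slice_line x \o I) n @[n --> \oo] --> slice_line x setT.
  rewrite E; apply: nondecreasing_cvg_mu => //.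
    by rewrite -E; exact: measurableT.
  move=> m n mn; apply/subsetPset => y; rewrite /I/= !in_itv/= => ym.
  by rewrite (le_trans ym)// ler_nat.
have h2 : (slice_line x \o I) n @[n --> \oo] --> (lower_density rho x B)%:E.
  have c0 : (fun _ : nat => (lower_density rho x B)%:E) @ \oo -->
    (lower_density rho x B)%:E by exact: cvg_cst.
  apply: cvg_trans c0; apply: near_eq_cvg.
  exists (Num.bound B) => // n /= Bn.
  rewrite slice_line_Nyc (slice_cdf_high reg)//.
  by apply/ltW/(lt_le_trans (unstable.ltr_bound _)); rewrite ler_nat.
exact: (cvg_unique _ h1 h2).
Qed.

Let measurable_vertical (x : R) :
  measurable_fun setT (pair x : measurableTypeR R -> R * R).
Proof. by apply: measurable_fun_pair => //; exact: measurable_cst. Qed.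

Definition slice x : {measure set (R * R) -> \bar R} :=
  image_measure (slice_line x) (measurable_vertical x).

Lemma sliceE x A : slice x A = slice_line x (pair x @^-1` A).
Proof. by []. Qed.

Lemma slice_T x : slice x setT = (lower_density rho x B)%:E.
Proof. by rewrite sliceE preimage_setT slice_line_T. Qed.

Lemma slice_le x : (slice x setT <= L%:E)%E.
Proof. by rewrite slice_T lee_fin; have /andP[] := lower_density_itv reg x B. Qed.

Lemma slice_off_line x : slice x (~` vertical_line x) = 0%E.
Proof.
rewrite sliceE (_ : _ @^-1` _ = set0) ?measure0//.
by apply/seteqP; split => // y /= h; apply: h.
Qed.

Lemma slice_on_line x A : slice x (vertical_line x `&` A) = slice x A.
Proof.
rewrite !sliceE; congr (slice_line x _).
by apply/seteqP; split => y //= [].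
Qed.

Lemma Rintegral_slice x (f : R * R -> R) : bounded_measurable f ->
  \int[slice x]_q f q = \int[slice_line x]_y f (x, y).
Proof.
move=> [mf [S fS]]; rewrite /Rintegral; congr fine.
have bcomp : bounded_measurable (f \o pair x : measurableTypeR R -> R).
  split; last by exists S => y; exact: fS.
  exact: measurableT_comp mf (measurable_vertical x).
have oo : (slice_line x setT < +oo)%E by rewrite slice_line_T ltry.
have := @integral_pushforward _ _ _ _ R (pair x : measurableTypeR R -> R * R)
  (measurable_vertical x) (slice_line x) setT (EFin \o f).
rewrite preimage_setT; apply => //; first exact/measurable_EFinP.
exact: (bounded_measurable_integrable (mu := slice_line x) measurableT oo bcomp).
Qed.

End slice_measure.

(** * Slices are limits of strip averages *)
Section grid_approximation.
Context {d} {T : measurableType d} {R : realType} (m : {measure set T -> \bar R}).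
Variables (D : set T) (Y f : T -> R) (c al : nat -> R) (e : R) (N : nat).
Hypotheses (mD : measurable D) (Doo : (m D < +oo)%E) (mY : measurable_fun setT Y).
Hypotheses (bf : bounded_measurable f) (nd_c : {homo c : i j / (i <= j)%N >-> i <= j}).
Hypothesis e0 : 0 <= e.
Hypothesis grid : {ae m, forall t, D t -> c 0%N < Y t <= c N}.
Hypothesis osc : forall j t, (j < N)%N -> D t -> c j < Y t <= c j.+1 ->
  `|f t - al j| <= e.

Let below r t : R := \1_(Y @^-1` `]-oo, r]) t.

Let belowE r t : below r t = (Y t <= r)%R%:R.
Proof.
rewrite /below indicE; congr (_%:R); congr nat_of_bool.
by apply/idP/idP; rewrite inE /= in_itv.
Qed.

Let grid_pointwise n t : (forall j, (j < n)%N -> c j < Y t <= c j.+1 -> `|f t - al j| <= e) ->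
  c 0%N < Y t <= c n ->
  `|f t - \sum_(0 <= j < n) al j * (below (c j.+1) t - below (c j) t)| <= e.
Proof.
elim: n => [_|n IH h /andP[c0 cn]].
  by move=> /andP[/lt_le_trans h] /h; rewrite ltxx.
rewrite big_nat_recr//= !belowE cn.
have [tn|nt] := leP (Y t) (c n).
  by rewrite subrr mulr0 addr0; apply: IH; [move=> j jn; exact/h/ltnW|rewrite c0].
rewrite big1_seq ?add0r ?subr0 ?mulr1.
  by apply: h => //; rewrite nt.
move=> j; rewrite mem_index_iota => /andP[_ /andP[_ jn]].
rewrite !belowE !leNgt (le_lt_trans (nd_c jn) nt) (le_lt_trans (nd_c (ltnW jn)) nt).
by rewrite subrr mulr0.
Qed.

(** A Riemann-Stieltjes sum whose cells are given by the values of [Y]. The same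
    bound serves on the plane, with [Y] the height, and on a line, with [Y] the
    identity. *)
Lemma grid_approximation :
  `|\int[m]_(t in D) f t - \sum_(0 <= j < N) al j *
     (fine (m (D `&` Y @^-1` `]-oo, c j.+1])) - fine (m (D `&` Y @^-1` `]-oo, c j])))|
  <= e * fine (m D).
Proof.
have mpre r : measurable (Y @^-1` `]-oo, r]).
  by rewrite -[X in measurable X]setTI; apply: mY => //; exact: measurable_itv.
have bbelow r : bounded_measurable (below r) by exact: bounded_measurable_indic.
pose term j t := al j * (below (c j.+1) t - below (c j) t).
have bdiff j : bounded_measurable (fun t => below (c j.+1) t - below (c j) t).
  exact: bounded_measurableB.
have bterm j : bounded_measurable (term j).
  by apply: bounded_measurableM => //; exact: bounded_measurable_cst.
have bint g : bounded_measurable g -> m.-integrable D (EFin \o g).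
  exact: bounded_measurable_integrable.
have -> : \sum_(0 <= j < N) al j *
     (fine (m (D `&` Y @^-1` `]-oo, c j.+1])) - fine (m (D `&` Y @^-1` `]-oo, c j]))) =
    \int[m]_(t in D) (\sum_(0 <= j < N) term j t).
  rewrite Rintegral_sum//; apply: eq_bigr => j _.
  rewrite RintegralZl//; last exact: bint.
  rewrite RintegralB//; try exact: bint.
  by congr (_ * (_ - _)); rewrite /Rintegral /below integral_indic// setIC.
have bsum : bounded_measurable (fun t => \sum_(0 <= j < N) term j t).
  exact: bounded_measurable_sum.
rewrite -RintegralB//; try exact: bint.
pose g t := f t - \sum_(0 <= j < N) term j t.
have bg : bounded_measurable g by exact: bounded_measurableB.
apply: (le_trans (le_normr_Rintegral mD (bint _ bg))).
rewrite -Rintegral_cst// -lee_fin.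
have bn := bounded_measurable_normr bg.
have bc := @bounded_measurable_cst d T R e.
rewrite /Rintegral !fineK.
2: by apply: integrable_fin_num => //; exact: bint bc.
2: by apply: integrable_fin_num => //; exact: bint bn.
apply: ae_ge0_le_integral => //.
- by apply/measurable_EFinP; apply: measurable_funS bn.1.
- case: grid => Z [mZ Z0 ZP]; exists Z; split => // t /= /not_implyP[Dt ht]; apply: ZP => /= h.
  apply: ht; rewrite lee_fin; apply: grid_pointwise; last exact: h.
  by move=> j jN hj; exact: osc.
Qed.

End grid_approximation.

Section strip_limits.
Context {R : realType} (rho : probability (R * R)%type R) (L B : R).
Hypothesis reg : regular_strips rho L B.
Notation F := (slice_cdf rho).

Let B0 : 0 <= B. Proof. by case: reg. Qed.

Let L0 : 0 <= L.
Proof. by have /andP[h h'] := lower_density_itv reg 0 0; exact: le_trans h'. Qed.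

(** The grid reaches one unit beyond [[-B, B]], so that it still covers the
    support after a shift by less than 1. *)
Let grid (N : nat) (j : nat) : R := - (B + 1) + j%:R * ((2 * B + 2) / N%:R).

Let grid_nd N : {homo grid N : i j / (i <= j)%N >-> i <= j}.
Proof.
move=> i j ij; rewrite /grid lerD2l; apply: ler_wpM2r; last by rewrite ler_nat.
by apply: divr_ge0 => //; rewrite addr_ge0 ?mulr_ge0.
Qed.

Let grid0 N : grid N 0 = - (B + 1). Proof. by rewrite /grid mul0r addr0. Qed.

Let gridN N : (0 < N)%N -> grid N N = B + 1.
Proof.
move=> N0; rewrite /grid mulrCA divff ?mulr1; first ring.
by rewrite pnatr_eq0 -lt0n.
Qed.

Let gridS N j : grid N j.+1 = grid N j + (2 * B + 2) / N%:R.
Proof. by rewrite /grid -natr1 mulrDl mul1r addrA. Qed.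

Let grid_itv N j : (j <= N)%N -> (0 < N)%N -> - (B + 1) <= grid N j <= B + 1.
Proof.
move=> jN N0; have := grid_nd N (leq0n j); have := grid_nd N jN.
by rewrite grid0 gridN// => -> ->.
Qed.

Lemma grid_slice x (A : R -> R) (e : R) N : bounded_measurable (A : measurableTypeR R -> R) ->
  0 <= e -> (0 < N)%N ->
  (forall j y, (j < N)%N -> grid N j < y <= grid N j.+1 -> `|A y - A (grid N j)| <= e) ->
  `|\int[slice_line reg x]_y A y - \sum_(0 <= j < N) A (grid N j) *
    (F x (grid N j.+1) - F x (grid N j))| <= e * L.
Proof.
move=> bA e0 N0 osc.
have fE r : fine (slice_line reg x (setT `&` id @^-1` `]-oo, r]%classic)) = F x r.
  by rewrite setTI slice_line_Nyc.
rewrite (eq_bigr (fun j => (A \o grid N) j *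
  (fine (slice_line reg x (setT `&` id @^-1` `]-oo, grid N j.+1]%classic)) -
   fine (slice_line reg x (setT `&` id @^-1` `]-oo, grid N j]%classic))))); last first.
  by move=> j _; rewrite !fE.
have /andP[T0 TL] := lower_density_itv reg x B.
apply: (le_trans (grid_approximation (m := slice_line reg x) (N := N) (e := e) (D := setT)
  (Y := id : measurableTypeR R -> R) measurableT _ _ bA (@grid_nd N) e0 _ _)).
- by rewrite [X in (X < _)%E]slice_line_T ltry.
- exact: measurable_id.
- rewrite grid0 gridN//.
  exists (`]-oo, - (B + 1)] `|` `]B + 1, +oo[)%classic.
  have mi (i : interval R) : measurable ([set` i] : set (measurableTypeR R)).
    exact: measurable_itv.
  have m1 := mi `]-oo, - (B + 1)]; have m2 := mi `]B + 1, +oo[.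
  have m3 := mi `]-oo, B + 1].
  split; first exact: measurableU.
    apply: null_set_setU => //.
      by rewrite slice_line_Nyc (slice_cdf_low reg)//; lra.
    have : slice_line reg x setT =
        (slice_line reg x `]-oo, (B + 1)%R]%classic + slice_line reg x `](B + 1)%R, +oo[%classic)%E.
      rewrite -measureU//; last first.
        apply/seteqP; split => // y []; rewrite /= !in_itv/= andbT => yB By.
        by have := le_lt_trans yB By; rewrite ltxx.
      congr (slice_line reg x _); apply/seteqP; split => // y _ /=.
      by rewrite !in_itv/= andbT; case: (leP y (B + 1)); [left|right].
    have zfin : slice_line reg x `](B + 1)%R, +oo[%classic \is a fin_num.
      rewrite ge0_fin_numE//; apply: le_lt_trans (_ : (slice_line reg x setT < +oo)%E).
        by apply: le_measure; rewrite ?inE.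
      by rewrite slice_line_T ltry.
    rewrite slice_line_T slice_line_Nyc (slice_cdf_high reg); last lra.
    rewrite -(fineK zfin) -EFinD => -[] /eqP.
    by rewrite -subr_eq0 opprD addrA subrr sub0r oppr_eq0 => /eqP ->.
  move=> y /= /not_implyP[_ /negP]; rewrite negb_and -!leNgt -ltNge => /orP[yl|yh].
    by left; rewrite /= in_itv.
  by right; rewrite /= in_itv/= andbT.
- by move=> j y jN _; exact: osc.
by apply: ler_wpM2l => //; rewrite [X in fine X]slice_line_T.
Qed.

(** The cells are shifted upwards by [s], because strip densities at height
    [c + s] tend to [lower_density x (c + s)], which approximates
    [slice_cdf x c] for small [s], while [lower_density x c] does not. *)
Lemma grid_strip x (A : R * R -> R) (e s d : R) N : bounded_measurable A ->
  0 <= e -> (0 < N)%N -> 0 < d -> 0 < s < 1 ->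
  (forall j q, (j < N)%N -> `|q.1 - x| < d -> grid N j + s < q.2 <= grid N j.+1 + s ->
     `|A q - A (x, grid N j)| <= e) ->
  `|(2 * d)^-1 * \int[rho]_(q in vertical_strip x d) A q -
     \sum_(0 <= j < N) A (x, grid N j) *
    (strip_density rho x (grid N j.+1 + s) d - strip_density rho x (grid N j + s) d)|
  <= e * L.
Proof.
move=> bA e0 N0 d0 /andP[s0 s1] osc.
have d20 : 0 <= (2 * d)^-1 by rewrite invr_ge0 mulr_ge0// ltW.
have mD := measurable_strip x d.
pose m r := fine (rho (vertical_strip x d `&` snd @^-1` `]-oo, r]%classic)).
have mE r : (2 * d)^-1 * m r = strip_density rho x r d.
  rewrite strip_densityE /m.
  have -> // : snd @^-1` `]-oo, r]%classic = [set q : R * R | q.2 <= r].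
  by apply/seteqP; split => q /=; rewrite in_itv.
have -> : \sum_(0 <= j < N) A (x, grid N j) *
    (strip_density rho x (grid N j.+1 + s) d - strip_density rho x (grid N j + s) d) =
    (2 * d)^-1 * \sum_(0 <= j < N) A (x, grid N j) *
      (m (grid N j.+1 + s) - m (grid N j + s)).
  rewrite mulr_sumr; apply: eq_bigr => j _; rewrite -!mE; ring.
rewrite -mulrBr normrM (ger0_norm d20).
have Doo : (rho (vertical_strip x d) < +oo)%E.
  by rewrite -ge0_fin_numE// (rho_fin rho).
have nd : {homo (fun j => grid N j + s) : i j / (i <= j)%N >-> i <= j}.
  by move=> i j ij; rewrite lerD2r grid_nd.
have ae_grid : {ae rho, forall q, vertical_strip x d q -> grid N 0 + s < q.2 <= grid N N + s}.
  exists (~` box B); split; [|by case: reg|].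
    by apply: measurableC; exact: measurable_box.
  move=> q /= /not_implyP[_ hq] [_ /=]; rewrite in_itv/= => /andP[q1 q2].
  by apply: hq; rewrite grid0 gridN//; apply/andP; split; lra.
have osc' j q : (j < N)%N -> vertical_strip x d q ->
    grid N j + s < q.2 <= grid N j.+1 + s -> `|A q - A (x, grid N j)| <= e.
  move=> jN [/= + _]; rewrite in_itv/= -ltr_distl; exact: osc.
have h := grid_approximation (al := fun j => A (x, grid N j)) mD Doo
  (@measurable_snd _ _ _ _) bA nd e0 ae_grid osc'.
apply: (@le_trans _ _ ((2 * d)^-1 * (e * fine (rho (vertical_strip x d))))).
  exact: ler_wpM2l h.
rewrite mulrCA; apply: ler_wpM2l => //.
have -> : rho (vertical_strip x d) =
    rho (vertical_strip x d `&` [set q | q.2 <= B]).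
  apply: (rho_eq_on_box reg) => //; first exact: measurable_strip_lower.
  apply/seteqP; split => q; last by move=> [[? _] ?].
  move=> [sq bq]; split => //; split => //.
  by case: bq => _; rewrite /= in_itv/= => /andP[].
rewrite -strip_densityE; case: reg => _ _ h' _; exact: h'.
Qed.

(** Both integrals are compared with Riemann-Stieltjes sums over one grid. The
    modulus of continuity of [A] determines the grid, the grid determines the
    shift [s], and only then does [d] tend to 0. *)
Lemma strip_average_cvg x (A : R * R -> R) : continuous A -> bounded_measurable A ->
  (2 * d)^-1 * \int[rho]_(q in vertical_strip x d) A q @[d --> 0^'+] -->
  \int[slice reg x]_q A q.
Proof.
move=> cA bA; rewrite (Rintegral_slice reg x bA).
apply/cvgrPdist_le => e e0.
pose e' := e / (2 * L + 2).
have L2 : 0 < 2 * L + 2 by rewrite ltr_wpDl// mulr_ge0.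
have e'0 : 0 < e' by rewrite divr_gt0.
pose K : set (R * R) := [set x] `*` `[- (B + 1), B + 1]%classic.
have cK : compact K.
  by apply: compact_setX; [exact: compact_set1|exact: segment_compact].
have [del del0 unif] := compact_uniform_modulus cK cA e'0.
have hB : 0 < 2 * B + 2 by rewrite ltr_wpDl// mulr_ge0.
have m0 : 0 < Num.min (del / 2) 1 by rewrite lt_min divr_gt0/=.
have [N Nh] : exists N : nat, (2 * B + 2) / N.+1%:R < del / 2.
  have q0 : 0 < del / 2 / (2 * B + 2) by rewrite !divr_gt0.
  have [N _ /(_ N (leqnn N)) /= h] := near_infty_natSinv_lt (PosNum q0).
  by exists N; rewrite mulrC -ltr_pdivlMr.
have modulus j q : (j < N.+1)%N -> `|q.1 - x| < del ->
    `|q.2 - grid N.+1 j| < del -> `|A q - A (x, grid N.+1 j)| <= e'.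
  move=> jN q1 q2; rewrite distrC; apply/ltW/unif.
    by split => //=; rewrite in_itv/=; apply: grid_itv => //; exact: ltnW.
  by split; rewrite /ball/= distrC.
have bAx : bounded_measurable ((fun y => A (x, y)) : measurableTypeR R -> R).
  have [mA [S AS]] := bA; split; last by exists S => y; exact: AS.
  by apply: (measurableT_comp mA); apply: measurable_fun_pair => //; exact: measurable_cst.
pose F_sum := \sum_(0 <= j < N.+1) A (x, grid N.+1 j) *
    (F x (grid N.+1 j.+1) - F x (grid N.+1 j)).
have slice_sum : `|\int[slice_line reg x]_y A (x, y) - F_sum| <= e' * L.
  apply: (@grid_slice x (fun y => A (x, y)) e' N.+1 bAx) => //; first exact: ltW.
  move=> j y jN; rewrite gridS => /andP[y1 y2]; apply: (modulus j (x, y) jN) => /=.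
    by rewrite subrr normr0.
  move: (grid _ j) (_ / _) y1 y2 Nh => g h y1 y2 Nh.
  by rewrite ger0_norm; lra.
pose low_sum s := \sum_(0 <= j < N.+1) A (x, grid N.+1 j) *
    (lower_density rho x (grid N.+1 j.+1 + s) - lower_density rho x (grid N.+1 j + s)).
have [n [s0 s1 sdel low_F]] : exists n : nat, let s := n.+1%:R^-1 in
    [/\ 0 < s, s < 1, s < del / 2 & `|F_sum - low_sum s| <= e'].
  have : low_sum n.+1%:R^-1 @[n --> \oo] --> F_sum.
    apply: cvg_big => [|j _]; first exact: add_continuous.
    apply: cvgM; first exact: cvg_cst.
    by apply: cvgB; exact: (slice_cdf_cvg reg).
  move=> /cvgrPdist_le/(_ _ e'0)[n1 _ P1].
  have [n2 _ P2] := near_infty_natSinv_lt (PosNum m0).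
  exists (maxn n1 n2); split.
  - by rewrite invr_gt0.
  - by have := P2 _ (leq_maxr n1 n2); rewrite /= lt_min => /andP[].
  - by have := P2 _ (leq_maxr n1 n2); rewrite /= lt_min => /andP[].
  - exact: P1 _ (leq_maxl n1 n2).
move: (n.+1%:R^-1) s0 s1 sdel low_F => s s0 s1 sdel low_F.
pose dens_sum d := \sum_(0 <= j < N.+1) A (x, grid N.+1 j) *
    (strip_density rho x (grid N.+1 j.+1 + s) d -
     strip_density rho x (grid N.+1 j + s) d).
have dens_low : dens_sum d @[d --> 0^'+] --> low_sum s.
  apply: cvg_big => [|j _]; first exact: add_continuous.
  apply: cvgM; first exact: cvg_cst.
  by apply: cvgB; exact: (lower_density_cvg reg).
near=> d.
have d0 : 0 < d by near: d; exact: nbhs_right_gt.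
have ddel : d < del by near: d; exact: nbhs_right_lt.
have dens_d : `|low_sum s - dens_sum d| <= e'.
  by near: d; move/cvgrPdist_le : dens_low; exact.
have strip_sum : `|(2 * d)^-1 * \int[rho]_(q in vertical_strip x d) A q - dens_sum d| <=
    e' * L.
  apply: (grid_strip bA) => //; [exact: ltW|by rewrite s0|].
  move=> j q jN q1; rewrite gridS => /andP[q2 q2']; apply: modulus => //.
    exact: lt_trans ddel.
  move: (grid _ j) (_ / N.+1%:R) q2 q2' Nh => g h q2 q2' Nh.
  by rewrite ger0_norm; lra.
have eE : e' * L + e' + e' + e' * L = e.
  have -> : e' * L + e' + e' + e' * L = e' * (2 * L + 2) by ring.
  by rewrite /e' divfK// gt_eqF.
rewrite -eE; move: slice_sum low_F dens_d strip_sum.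
move: (\int[slice_line reg x]_y A (x, y)) (_ * Rintegral _ _ _) => u v.
rewrite !ler_norml => /andP[? ?] /andP[? ?] /andP[? ?] /andP[? ?].
by apply/andP; split; lra.
Unshelve. all: by end_near. Qed.

Lemma slice_strip_limit x : strip_limit rho x (slice reg x).
Proof.
move=> A cA [K AK].
have bA : bounded_measurable A.
  by split; [exact: continuous_plane_measurable|exists K].
have soo : (slice reg x setT < +oo)%E by rewrite slice_T ltry.
have fin : (\int[slice reg x]_p (A p)%:E)%E \is a fin_num.
  apply: integrable_fin_num => //.
  exact: (bounded_measurable_integrable (mu := slice reg x) measurableT soo bA).
have mD d := measurable_strip x d.
have finD d : (\int[rho]_(p in vertical_strip x d) (A p)%:E)%E \is a fin_num.
  apply: integrable_fin_num => //; apply: bounded_measurable_integrable => //.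
  by rewrite -ge0_fin_numE// (rho_fin rho).
rewrite -(fineK fin); apply: cvg_EFin.
  by apply: nearW => d; rewrite fin_numM.
have avg := @strip_average_cvg x A cA bA.
rewrite [X in X @ _ --> _](_ : _ = fun d => (2 * d)^-1 *
  \int[rho]_(q in vertical_strip x d) A q)//.
by apply/funext => d /=; rewrite fineM.
Qed.

End strip_limits.

(** * Continuous functions determine finite measures *)
Section quadrants.
Context {R : realType}.

Definition quadrant (s c : R) : set (R * R) := [set q | q.1 <= s /\ q.2 <= c].

Definition quadrants : set (set (R * R)) :=
  [set A | exists s c, A = quadrant s c].

Lemma quadrantI s c s' c' :
  quadrant s c `&` quadrant s' c' = quadrant (Num.min s s') (Num.min c c').
Proof.
apply/seteqP; split => q; rewrite /quadrant/= !le_min.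
  by move=> [[-> ->] [-> ->]].
by move=> [/andP[-> ->] /andP[-> ->]].
Qed.

Lemma quadrants_setI_closed : setI_closed quadrants.
Proof.
move=> _ _ [s [c ->]] [s' [c' ->]]; rewrite quadrantI.
by exists (Num.min s s'), (Num.min c c').
Qed.

Lemma measurable_quadrant s c : measurable (quadrant s c).
Proof.
have -> : quadrant s c = `]-oo, s]%classic `*` `]-oo, c]%classic.
  by apply/seteqP; split => q /=; rewrite !in_itv.
by apply: measurableX; exact: measurable_itv.
Qed.

Lemma quadrants_cover : \bigcup_n quadrant n%:R n%:R = setT :> set (R * R).
Proof.
apply/seteqP; split => // q _.
exists (maxn (Num.bound q.1) (Num.bound q.2)) => //.
by split; apply/ltW/(lt_le_trans (unstable.ltr_bound _)); rewrite ler_nat ?leq_maxl ?leq_maxr.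
Qed.

Lemma measurable_quadrants :
  @measurable _ (R * R)%type = <<s quadrants >>.
Proof.
apply/seteqP; split; last first.
  apply: smallest_sub; first exact: sigma_algebra_measurable.
  by move=> _ [s [c ->]]; exact: measurable_quadrant.
pose G := g_sigma_algebraType quadrants.
have mq s c : @measurable _ G (quadrant s c).
  by apply: sub_sigma_algebra; exists s, c.
have m1 : measurable_fun setT (fst : G -> R).
  apply: (measurability _ (RGenOInfty.measurableE R)).
  move=> _ [_ [s ->] <-]; rewrite setTI.
  have -> : fst @^-1` `]s, +oo[%classic = ~` (\bigcup_n quadrant s n%:R).
    apply/seteqP; split => q; rewrite /= in_itv/= andbT.
      by move=> sq [n _ [qs _]]; move: sq; rewrite ltNge qs.
    move=> h; rewrite ltNge; apply/negP => qs; apply: h.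
    by exists (Num.bound q.2) => //; split => //; apply/ltW/unstable.ltr_bound.
  by apply: measurableC; apply: bigcupT_measurable.
have m2 : measurable_fun setT (snd : G -> R).
  apply: (measurability _ (RGenOInfty.measurableE R)).
  move=> _ [_ [c ->] <-]; rewrite setTI.
  have -> : snd @^-1` `]c, +oo[%classic = ~` (\bigcup_n quadrant n%:R c).
    apply/seteqP; split => q; rewrite /= in_itv/= andbT.
      by move=> sq [n _ [_ qs]]; move: sq; rewrite ltNge qs.
    move=> h; rewrite ltNge; apply/negP => qs; apply: h.
    by exists (Num.bound q.1) => //; split => //; apply/ltW/unstable.ltr_bound.
  by apply: measurableC; apply: bigcupT_measurable.
apply: smallest_sub; first exact: smallest_sigma_algebra.
move=> _ [[A mA <-]|[A mA <-]].
  exact: m1.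
exact: m2.
Qed.

Lemma measure_unique_quadrants (m1 m2 : {measure set (R * R) -> \bar R}) :
  (m1 setT < +oo)%E -> (forall s c, m1 (quadrant s c) = m2 (quadrant s c)) ->
  forall A, measurable A -> m1 A = m2 A.
Proof.
move=> m1oo m12 A mA.
apply: (measure_unique quadrants (fun n => quadrant n%:R n%:R)) => //.
- exact: measurable_quadrants.
- exact: quadrants_setI_closed.
- by move=> n; exists n%:R, n%:R.
- exact: quadrants_cover.
- by move=> _ [s [c ->]]; exact: m12.
- move=> n; apply: le_lt_trans m1oo; apply: le_measure; rewrite ?inE//.
  exact: measurable_quadrant.
Qed.

(** Twice the positive part. *)
Definition excess (x : R) : R := `|x| + x.

(** The positive part of [1 - 2 * k * r], where [r] is the l1 distance from [q] to
    the quadrant. *)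
Definition quadrant_approx (s c : R) (k : nat) (q : R * R) : R :=
  excess (1 - k%:R * (excess (q.1 - s) + excess (q.2 - c))) / 2.

Lemma excess_ge0 x : 0 <= excess x.
Proof. by rewrite /excess -(opprK x) normrN subr_ge0 ler_norm. Qed.

Lemma continuous_quadrant_approx s c k : continuous (quadrant_approx s c k).
Proof.
move=> p; rewrite /quadrant_approx.
have ce (f : R * R -> R) : f @ p --> f p -> (fun q => excess (f q)) @ p --> excess (f p).
  by move=> cf; apply: cvgD => //; exact: cvg_norm.
apply: cvgM; last exact: cvg_cst.
apply: (ce (fun q => 1 - k%:R * (excess (q.1 - s) + excess (q.2 - c)))).
apply: cvgB; first exact: cvg_cst.
apply: cvgM; first exact: cvg_cst.
apply: cvgD.
  by apply: (ce (fun q => q.1 - s)); apply: cvgB; [exact: cvg_fst|exact: cvg_cst].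
by apply: (ce (fun q => q.2 - c)); apply: cvgB; [exact: cvg_snd|exact: cvg_cst].
Qed.

Lemma quadrant_approx_itv s c k q : 0 <= quadrant_approx s c k q <= 1.
Proof.
rewrite /quadrant_approx divr_ge0 ?excess_ge0//= ler_pdivrMr// mul1r /excess.
have : 0 <= k%:R * (excess (q.1 - s) + excess (q.2 - c)).
  by rewrite mulr_ge0// addr_ge0// excess_ge0.
move: (k%:R * _) => z z0.
by have [h|h] := leP 0 (1 - z); rewrite ?(ger0_norm h) ?(ltr0_norm h); lra.
Qed.

Lemma quadrant_approx_cvg s c q :
  quadrant_approx s c k q @[k --> \oo] --> (\1_(quadrant s c) q : R).
Proof.
rewrite indicE; have [|] := boolP (q \in quadrant s c).
  rewrite inE => -[q1 q2].
  have -> : (fun k => quadrant_approx s c k q) = cst 1; last exact: cvg_cst.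
  apply/funext => k; rewrite /quadrant_approx /excess.
  rewrite (ler0_norm (_ : q.1 - s <= 0)) ?subr_le0// (ler0_norm (_ : q.2 - c <= 0)) ?subr_le0//.
  by rewrite !addNr addr0 mulr0 subr0 normr1/=; lra.
move=> /negP; rewrite inE => nq.
have z0 : 0 < excess (q.1 - s) + excess (q.2 - c).
  rewrite lt0r addr_ge0 ?excess_ge0// andbT paddr_eq0 ?excess_ge0//.
  apply/negP => /andP[/eqP h1 /eqP h2]; apply: nq; split.
    by move: h1; rewrite /excess; have := normr_ge0 (q.1 - s); lra.
  by move: h2; rewrite /excess; have := normr_ge0 (q.2 - c); lra.
have c0 : (fun _ : nat => 0 : R) @ \oo --> 0 by exact: cvg_cst.
apply: cvg_trans c0; apply: near_eq_cvg.
exists (Num.bound (excess (q.1 - s) + excess (q.2 - c))^-1) => // k /= hk.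
rewrite /quadrant_approx /excess -/(excess (q.1 - s)) -/(excess (q.2 - c)).
move: (excess _ + _) z0 hk => z z0 hk.
have : z^-1 < k%:R by apply: (lt_le_trans (unstable.ltr_bound _)); rewrite ler_nat.
rewrite -[z^-1]mul1r ltr_pdivrMr// => kz.
by rewrite ltr0_norm ?addNr ?mul0r//; lra.
Qed.

(** Indicators of quadrants are bounded limits of continuous functions, and
    quadrants are a generating pi-system. The constant function 1 shows that
    [m2] has the mass of [m1]. *)
Lemma measure_unique_continuous (m1 m2 : {measure set (R * R) -> \bar R}) :
  (m1 setT < +oo)%E ->
  (forall A : R * R -> R, continuous A -> (exists K, forall p, `|A p| <= K) ->
     (\int[m1]_p (A p)%:E = \int[m2]_p (A p)%:E)%E) ->
  forall E, measurable E -> m1 E = m2 E.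
Proof.
move=> m1oo m12.
have mass (m : {measure set (R * R) -> \bar R}) : (\int[m]_p (cst 1 p)%:E = m setT)%E.
  by rewrite -[RHS]mul1e -integral_cst.
have mT : m1 setT = m2 setT.
  rewrite -!mass; apply: m12; first exact: cst_continuous.
  by exists 1 => p; rewrite normr1.
have lim_q (m : {measure set (R * R) -> \bar R}) s c : (m setT < +oo)%E ->
    (\int[m]_q (quadrant_approx s c k q)%:E @[k --> \oo] --> m (quadrant s c))%E.
  move=> moo; have := @dominated_convergence _ _ _ m setT measurableT
    (fun k q => (quadrant_approx s c k q)%:E) (EFin \o \1_(quadrant s c)) (cst 1%E).
  case.
  - move=> k; apply/measurable_EFinP; apply: continuous_plane_measurable.
    exact: continuous_quadrant_approx.
  - apply/measurable_EFinP; apply: measurable_indic; exact: measurable_quadrant.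
  - apply: aeW => q _; apply: cvg_EFin; first by apply: nearW.
    exact: quadrant_approx_cvg.
  - apply: (bounded_measurable_integrable (f := cst 1)) => //.
    exact: bounded_measurable_cst.
  - apply: aeW => q k _ /=; have /andP[h1 h2] := quadrant_approx_itv s c k q.
    by rewrite lee_fin ger0_norm.
  move=> _ _; rewrite integral_indic//; last exact: measurable_quadrant.
  by rewrite setIT.
apply: measure_unique_quadrants => // s c.
have m2oo : (m2 setT < +oo)%E by rewrite -mT.
have h1 := lim_q m1 s c m1oo; have h2 := lim_q m2 s c m2oo.
have e : (fun k => \int[m1]_q (quadrant_approx s c k q)%:E)%E =
    (fun k => \int[m2]_q (quadrant_approx s c k q)%:E)%E.
  apply/funext => k; apply: m12; first exact: continuous_quadrant_approx.
  exists 1 => q; have /andP[h h'] := quadrant_approx_itv s c k q.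
  by rewrite ger0_norm.
by rewrite e in h1; exact: (cvg_unique _ h1 h2).
Qed.

End quadrants.

(** * Disintegration over the slices *)
Section window_averages.
Context {R : realType} (rho : probability (R * R)%type R) (L B : R).
Hypothesis reg : regular_strips rho L B.
Notation mu := (@lebesgue_measure R).
Notation F := (slice_cdf rho).
Notation line := (measurableTypeR R).

Let B0 : 0 <= B. Proof. by case: reg. Qed.

Let L0 : 0 <= L.
Proof. by have /andP[h h'] := lower_density_itv reg 0 0; exact: le_trans h'. Qed.

(** The window begins at [- (B + 1)] so that it contains all the centres of
    strips of half-width at most 1 through the points of the support that are
    at distance at least this half-width to the left of [s]. *)
Definition window (s : R) : set line := `[- (B + 1), s]%classic.

Lemma measurable_window s : measurable (window s).
Proof. exact: measurable_itv. Qed.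

Lemma window_finite s : (mu (window s) < +oo)%E.
Proof. by rewrite /window lebesgue_measure_itv/=; case: ifP; rewrite ltry. Qed.

Let incidence (D : set line) (c d : R) : set (line * (R * R)) :=
  [set z | D z.1 /\ (`|z.2.1 - z.1| < d /\ z.2.2 <= c)].

Let measurable_incidence D c d : measurable D -> measurable (incidence D c d).
Proof.
move=> mD.
have m1 : measurable_fun setT (fun z : line * (R * R) => z.2.1 - z.1 : R).
  apply: measurable_funB; first exact: measurableT_comp measurable_fst measurable_snd.
  exact: measurable_fst.
have -> : incidence D c d = (fst @^-1` D) `&`
   ((fun z : line * (R * R) => `|z.2.1 - z.1|) @^-1` `]-oo, d[%classic `&`
    (fun z : line * (R * R) => z.2.2) @^-1` `]-oo, c]%classic).
  by apply/seteqP; split => z /=; rewrite !in_itv/=.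
apply: measurableI; last apply: measurableI.
- rewrite -[X in measurable X]setTI.
  exact: measurable_fst.
- rewrite -[X in measurable X]setTI.
  suff h : measurable_fun setT (fun z : line * (R * R) => `|z.2.1 - z.1|).
    by apply: h => //; exact: measurable_itv.
  exact: measurableT_comp.
- rewrite -[X in measurable X]setTI.
  suff h : measurable_fun setT (fun z : line * (R * R) => z.2.2).
    by apply: h => //; exact: measurable_itv.
  exact: measurableT_comp measurable_snd measurable_snd.
Qed.

Let xsection_incidence D c d x : xsection (incidence D c d) x =
  if x \in D then vertical_strip x d `&` [set q | q.2 <= c] else set0.
Proof.
apply/seteqP; split => q; rewrite /xsection/= inE/=.
  move=> [Dx [h1 h2]]; rewrite mem_set//; split => //; split => //=.
  by rewrite in_itv/= -ltr_distl.
case: ifPn => // /set_mem Dx [[/= + _] h2]; rewrite in_itv/= -ltr_distl => h1.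
by [].
Qed.

Lemma bounded_measurable_strip_density c d : 0 < d ->
  bounded_measurable ((fun x => strip_density rho x c d) : line -> R).
Proof.
move=> d0; split; last first.
  exists L => x; rewrite ger0_norm ?strip_density_ge0//.
  by case: reg => _ _ h _; exact: h.
rewrite (_ : (fun _ => _) = fun x : line =>
  (2 * d)^-1 * fine (rho (xsection (incidence setT c d) x))); last first.
  by apply/funext => x; rewrite strip_densityE xsection_incidence mem_set.
apply: measurable_funM => //; apply/measurable_EFinP.
rewrite (_ : EFin \o _ = rho \o xsection (incidence setT c d)); last first.
  apply/funext => x /=; rewrite fineK// (rho_fin rho)//.
  by apply: measurable_xsection; exact: measurable_incidence.
by apply: measurable_fun_xsection; exact: measurable_incidence.
Qed.

(** Divided by [2 * d], this is the weight of the point [q] once the integrals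
    over the centres and over the plane are exchanged. *)
Let overlap s c d (q : R * R) : R := fine (mu (ysection (incidence (window s) c d) q)).

Let ysection_incidence D c d q : ysection (incidence D c d) q =
  [set x | D x /\ (`|q.1 - x| < d /\ q.2 <= c)].
Proof. by apply/seteqP; split => x; rewrite /ysection/= inE. Qed.

Let measurable_ysection_incidence s c d q :
  measurable (ysection (incidence (window s) c d) q).
Proof. by apply: measurable_ysection; apply: measurable_incidence; exact: measurable_window. Qed.

Let overlap_le s c d q : 0 < d ->
  (mu (ysection (incidence (window s) c d) q) < +oo)%E /\ 0 <= overlap s c d q <= 2 * d.
Proof.
move=> d0.
have h : (mu (ysection (incidence (window s) c d) q) <= (2 * d)%:E)%E.
  apply: (@le_trans _ _ (mu `]q.1 - d, q.1 + d[%classic)); last first.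
    rewrite lebesgue_measure_itv/= lte_fin ifT; last lra.
    by rewrite -EFinD lee_fin; lra.
  apply: le_measure; rewrite ?inE.
  - exact: measurable_ysection_incidence.
  - exact: measurable_itv.
  - rewrite ysection_incidence => x [_ [+ _]]; rewrite distrC ltr_distl /= in_itv/=.
    by move=> /andP[-> ->].
have oo : (mu (ysection (incidence (window s) c d) q) < +oo)%E.
  by apply: le_lt_trans h _; rewrite ltry.
split => //; rewrite /overlap fine_ge0//=.
by rewrite -lee_fin fineK// ge0_fin_numE.
Qed.

Let bounded_measurable_overlap s c d : 0 < d -> bounded_measurable (overlap s c d).
Proof.
move=> d0; split; last first.
  exists (2 * d) => q; have [_ /andP[h1 h2]] := overlap_le s c q d0.
  by rewrite ger0_norm.
apply/measurable_EFinP.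
rewrite (_ : EFin \o _ = mu \o ysection (incidence (window s) c d)); last first.
  apply/funext => q /=; rewrite /overlap fineK// ge0_fin_numE//.
  by have [] := overlap_le s c q d0.
by apply: measurable_fun_ysection; apply: measurable_incidence; exact: measurable_window.
Qed.

Let tonelli s c d : 0 < d ->
  2 * d * \int[mu]_(x in window s) strip_density rho x c d = \int[rho]_q overlap s c d q.
Proof.
move=> d0.
have mI := measurable_incidence c d (measurable_window s).
have bD := bounded_measurable_strip_density c d0.
have oo := window_finite s; have mw := measurable_window s.
have iD : mu.-integrable (window s) (EFin \o (fun x => strip_density rho x c d)).
  exact: bounded_measurable_integrable.
rewrite -RintegralZl// /Rintegral; congr fine.
transitivity (\int[mu]_x \int[rho]_q (\1_(incidence (window s) c d) (x, q))%:E)%E.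
  rewrite integral_mkcond; apply: eq_integral => x _.
  rewrite (_ : (fun q => _) =
    fun q => (\1_(xsection (incidence (window s) c d) x) q)%:E); last first.
    by apply/funext => q; rewrite !indicE mem_xsection.
  rewrite integral_indic//; last exact: measurable_xsection.
  rewrite setIT xsection_incidence patchE; case: ifPn => _; last by rewrite measure0.
  rewrite strip_densityE mulrA divff ?mul1r; last by rewrite mulf_neq0// gt_eqF.
  by rewrite fineK// (rho_fin rho)//; exact: measurable_strip_lower.
rewrite (@fubini_tonelli _ _ _ _ _ mu rho
  (fun z => (\1_(incidence (window s) c d) z)%:E))//; last first.
  by apply/measurable_EFinP; exact: measurable_indic.
apply: eq_integral => q _.
rewrite (_ : (fun x => _) = fun x => (\1_(ysection (incidence (window s) c d) q) x)%:E); last first.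
  by apply/funext => x; rewrite !indicE mem_ysection.
rewrite integral_indic//.
rewrite setIT /overlap fineK// ge0_fin_numE//.
by have [] := overlap_le s c q d0.
Qed.

(** On the support, the weight [overlap / (2 * d)] lies in [0, 1] and agrees with
    the indicator of the quadrant outside the strip of half-width [d] around
    the right edge, whose mass is at most [2 * d * L]. *)
Lemma window_strip_density s c d : 0 < d -> d <= 1 ->
  `|\int[mu]_(x in window s) strip_density rho x c d - fine (rho (quadrant s c))|
  <= 2 * d * L.
Proof.
move=> d0 d1; have dd : 0 < 2 * d by rewrite mulr_gt0.
have bo := bounded_measurable_overlap s c d0.
have bq : bounded_measurable (\1_(quadrant s c) : R * R -> R).
  by apply: bounded_measurable_indic; exact: measurable_quadrant.
have bs : bounded_measurable (\1_(vertical_strip s d) : R * R -> R).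
  by apply: bounded_measurable_indic; exact: measurable_strip.
have -> : \int[mu]_(x in window s) strip_density rho x c d =
    \int[rho]_q ((2 * d)^-1 * overlap s c d q).
  rewrite RintegralZl//; last exact: integrable_rho.
  by rewrite -tonelli// mulKf// gt_eqF.
have -> : fine (rho (quadrant s c)) = \int[rho]_q \1_(quadrant s c) q.
  rewrite /Rintegral integral_indic// ?setIT//; exact: measurable_quadrant.
have bo' : bounded_measurable (fun q => (2 * d)^-1 * overlap s c d q).
  by apply: bounded_measurableM => //; exact: bounded_measurable_cst.
rewrite -RintegralB//; [|exact: integrable_rho..].
pose g q := (2 * d)^-1 * overlap s c d q - \1_(quadrant s c) q.
have bg : bounded_measurable g by exact: bounded_measurableB.
apply: (le_trans (le_normr_Rintegral measurableT (integrable_rho _ bg))).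
apply: (@le_trans _ _ (\int[rho]_q \1_(vertical_strip s d) q)).
  rewrite -lee_fin /Rintegral !fineK; last 2 first.
  - by apply: integrable_fin_num => //; exact: (integrable_rho _ bs).
  - by apply: integrable_fin_num => //; exact: (integrable_rho _ (bounded_measurable_normr bg)).
  apply: ae_ge0_le_integral => //.
  - by apply/measurable_EFinP; case: (bounded_measurable_normr bg).
  - by apply/measurable_EFinP; case: bs.
  exists (~` box B); split; [|by case: reg|].
    by apply: measurableC; exact: measurable_box.
  move=> q /= /not_implyP[_ hq] [/=]; rewrite !in_itv/= => /andP[q1 q2] _; apply: hq.
  rewrite lee_fin [X in _ <= X]indicE.
  have [_ /andP[u1 u2]] := overlap_le s c q d0.
  have o3 : 0 <= (2 * d)^-1 * overlap s c d q <= 1.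
    apply/andP; split; first by apply: mulr_ge0 => //; rewrite invr_ge0 ltW.
    by rewrite ler_pdivrMl// mulr1.
  rewrite /g indicE; have [|] := boolP (q \in vertical_strip s d).
    by case/andP: o3 => ? ?; case: (q \in quadrant s c); rewrite ler_norml/=; lra.
  move=> /negP; rewrite inE => /= ns.
  have {}ns : (q.1 <= s - d) || (s + d <= q.1).
    case: (leP q.1 (s - d)) => //= h1; case: (leP (s + d) q.1) => // h2.
    by exfalso; apply: ns; split => //=; rewrite in_itv/= h1 h2.
  have [qc|qc] := leP q.2 c; last first.
    have -> : (q \in quadrant s c) = false.
      by apply/negP; rewrite inE => -[_]; rewrite leNgt qc.
    rewrite /overlap ysection_incidence (_ : [set x | _] = set0).
      by rewrite measure0 mulr0 subr0 normr0.
    by apply/seteqP; split => // x [_ [_]]; rewrite leNgt qc.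
  case/orP: ns => hq.
    have -> : (q \in quadrant s c) = true by rewrite mem_set//; split => //; lra.
    rewrite /overlap ysection_incidence.
    have -> : [set x | window s x /\ `|q.1 - x| < d /\ q.2 <= c] = `]q.1 - d, q.1 + d[%classic.
      apply/seteqP; split => x /=; rewrite distrC ltr_distl in_itv/=; first by move=> [_ []].
      move=> /andP[x1 x2]; rewrite /window/= in_itv/= x1 x2 qc; split => //.
      by apply/andP; split; lra.
    rewrite lebesgue_measure_itv/= lte_fin ifT; last lra.
    rewrite -EFinD/= (_ : q.1 + d - (q.1 - d) = 2 * d); last lra.
    by rewrite mulVf ?gt_eqF// subrr normr0.
  have -> : (q \in quadrant s c) = false.
    by apply/negP; rewrite inE => -[? _]; lra.
  rewrite /overlap ysection_incidence (_ : [set x | _] = set0).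
    by rewrite measure0 mulr0 subr0 normr0.
  apply/seteqP; split => // x [/= + [+ _]]; rewrite /window/= in_itv/= distrC ltr_distl.
  by move=> /andP[? ?] /andP[? ?]; lra.
have -> : \int[rho]_q \1_(vertical_strip s d) q = 2 * d * strip_density rho s B d.
  rewrite strip_densityE mulrA divff ?mul1r; last by rewrite gt_eqF.
  rewrite /Rintegral integral_indic// ?setIT; last exact: measurable_strip.
  congr fine; apply: (rho_eq_on_box reg).
  - exact: measurable_strip.
  - exact: measurable_strip_lower.
  - apply/seteqP; split => q; last by move=> [[? _] ?].
    move=> [sq bq']; split => //; split => //.
    by case: bq' => _; rewrite /= in_itv/= => /andP[].
by rewrite ler_pM2l//; case: reg => _ _ h _; exact: h.
Qed.

End window_averages.

Section bounded_convergence.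
Context {d} {T : measurableType d} {R : realType} (m : {measure set T -> \bar R}).

Lemma bounded_convergence (D : set T) (f_ : nat -> T -> R) (f : T -> R) (S : R) :
  measurable D -> (m D < +oo)%E -> (forall n, measurable_fun setT (f_ n)) ->
  (forall n x, `|f_ n x| <= S) -> (forall x, f_ n x @[n --> \oo] --> f x) ->
  bounded_measurable f /\
  \int[m]_(x in D) f_ n x @[n --> \oo] --> \int[m]_(x in D) f x.
Proof.
move=> mD Doo mf fS ff.
have fle x : `|f x| <= S.
  by apply: (cvgr_to_le (cvg_norm (ff x))); apply: nearW => n; exact: fS.
have bf : bounded_measurable f.
  by split; [apply: (measurable_fun_cvg mf) => x _; exact: ff|exists S].
split => //.
have iS : m.-integrable D (EFin \o cst S).
  apply: bounded_measurable_integrable => //.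
  by split; [exact: measurable_cst|exists `|S|].
have [] := @dominated_convergence _ _ _ m D mD (fun n => EFin \o f_ n) (EFin \o f)
  (EFin \o cst S) _ _ _ iS.
- by move=> n; apply/measurable_EFinP; exact: measurable_funS (mf n).
- by apply/measurable_EFinP; apply: measurable_funS bf.1.
- by apply: aeW => x _; apply: cvg_EFin; [exact: nearW|exact: ff].
- by apply: aeW => x n _; rewrite /= lee_fin.
move=> i_f _; rewrite -(fineK (integrable_fin_num mD i_f)) => /fine_cvg; exact.
Qed.
End bounded_convergence.

Section disintegration_formula.
Context {R : realType} (rho : probability (R * R)%type R) (L B : R).
Hypothesis reg : regular_strips rho L B.
Notation mu := (@lebesgue_measure R).
Notation F := (slice_cdf rho).
Notation line := (measurableTypeR R).

Let B0 : 0 <= B. Proof. by case: reg. Qed.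

Let L0 : 0 <= L.
Proof. by have /andP[h h'] := lower_density_itv reg 0 0; exact: le_trans h'. Qed.

(** The bound [2 * d * L] vanishes as the half-width tends to 0. *)
Lemma window_lower_density s c :
  bounded_measurable ((fun x => lower_density rho x c) : line -> R) /\
  \int[mu]_(x in window B s) lower_density rho x c = fine (rho (quadrant s c)).
Proof.
pose u n : R := n.+1%:R^-1.
have u0 n : 0 < u n by rewrite invr_gt0.
have u1 n : u n <= 1 by rewrite invf_le1// ler1n.
have uc : u @ \oo --> 0 by exact: cvg_harmonic.
have [] := @bounded_convergence _ line R mu (window B s)
  (fun n x => strip_density rho x c (u n)) (fun x => lower_density rho x c) L.
- exact: measurable_window.
- exact: window_finite.
- by move=> n; have [] := bounded_measurable_strip_density reg c (u0 n).
- move=> n x; rewrite ger0_norm ?strip_density_ge0//.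
  by case: reg => _ _ h _; exact: h.
- move=> x; have := lower_density_cvg reg (x:=x) (c:=c); move/cvg_at_rightP; apply; split => //.
move=> bl cl; split => //.
apply: (cvg_unique _ cl) => //.
apply/cvgrPdist_le => e e0.
have : 2 * L * u n @[n --> \oo] --> 2 * L * 0 by apply: cvgM => //; exact: cvg_cst.
move=> /cvgrPdist_le/(_ _ e0); apply: filterS => n; rewrite mulr0 sub0r normrN.
move=> h; rewrite distrC; apply: (le_trans (window_strip_density reg s c (u0 n) (u1 n))).
by apply: le_trans h; rewrite mulrAC ler_norm.
Qed.

(** Quadrants are decreasing intersections of the quadrants just above them. *)
Lemma window_slice_cdf s c :
  bounded_measurable ((fun x => F x c) : line -> R) /\
  \int[mu]_(x in window B s) F x c = fine (rho (quadrant s c)).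
Proof.
pose u n : R := n.+1%:R^-1.
have u0 n : 0 < u n by rewrite invr_gt0.
have [] := @bounded_convergence _ line R mu (window B s)
  (fun n x => lower_density rho x (c + u n)) (fun x => F x c) L.
- exact: measurable_window.
- exact: window_finite.
- by move=> n; have [[]] := window_lower_density s (c + u n).
- by move=> n x; have /andP[h h'] := lower_density_itv reg x (c + u n); rewrite ger0_norm.
- by move=> x; exact: (slice_cdf_cvg reg).
move=> bF cF; split => //.
apply: (cvg_unique _ cF) => //.
have wl n : \int[mu]_(x in window B s) lower_density rho x (c + u n) =
    fine (rho (quadrant s (c + u n))) := (window_lower_density s (c + u n)).2.
suff : fine (rho (quadrant s (c + u n))) @[n --> \oo] --> fine (rho (quadrant s c)).
  by apply: cvg_trans; apply: near_eq_cvg; apply: nearW => n; rewrite -wl.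
have cap : \bigcap_n quadrant s (c + u n) = quadrant s c.
  apply/seteqP; split => q.
    move=> h; split; first by have [] := h 0%N I.
    rewrite leNgt; apply/negP; rewrite -subr_gt0 => cq.
    have [N _ /(_ N (leqnn N)) /= hN] := near_infty_natSinv_lt (PosNum cq).
    by have [_] := h N I; rewrite leNgt -ltrBrDl hN.
  by move=> [q1 q2] n _; split => //; rewrite (le_trans q2)// lerDl ltW.
have : (rho \o (fun n => quadrant s (c + u n))) n @[n --> \oo] --> rho (quadrant s c).
  rewrite -cap; apply: nonincreasing_cvg_mu.
  - by rewrite -ge0_fin_numE// (rho_fin rho)//; exact: measurable_quadrant.
  - by move=> n; exact: measurable_quadrant.
  - by rewrite cap; exact: measurable_quadrant.
  - move=> i j ij; apply/subsetPset => q [q1 q2]; split => //.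
    apply: (le_trans q2); rewrite lerD2l /u lef_pV2 ?posrE// ler_nat.
    by rewrite ltnS.
move=> h; have := fine_cvg; apply.
rewrite fineK//; last by rewrite (rho_fin rho)//; exact: measurable_quadrant.
Qed.

Lemma slice_quadrant x s c : slice reg x (quadrant s c) = (if x <= s then F x c else 0)%:E.
Proof.
rewrite sliceE; case: ifPn => xs.
  rewrite -(slice_line_Nyc reg); congr (slice_line reg x _).
  apply/seteqP; split => y; rewrite /= in_itv/=; first by case.
  by move=> yc; split.
rewrite (_ : _ @^-1` _ = set0) ?measure0//.
by apply/seteqP; split => // y [/= h]; move: xs; rewrite h.
Qed.

Lemma slice_disintegrates_quadrant s c :
  measurable_fun setT ((fun x => slice reg x (quadrant s c)) : line -> \bar R) /\
  rho (quadrant s c) = (\int[mu]_x slice reg x (quadrant s c))%E.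
Proof.
have [[mF [S FS]] intF] := window_slice_cdf s c.
split.
  under eq_fun do rewrite slice_quadrant.
  apply/measurable_EFinP; apply: measurable_fun_ifT => //.
  by apply: measurable_fun_ler.
rewrite -[LHS](fineK (rho_fin rho (measurable_quadrant s c))) -intF.
rewrite /Rintegral fineK; last first.
  apply: integrable_fin_num; first exact: measurable_window.
  apply: bounded_measurable_integrable => //; first exact: measurable_window.
    exact: window_finite.
  by split => //; exists S.
rewrite integral_mkcond; apply: eq_integral => x _.
rewrite slice_quadrant patchE; case: ifPn => [|].
  by rewrite inE /window/= in_itv/= => /andP[_ ->].
move=> /negP; rewrite inE /window/= in_itv/= => h.
case: ifPn => // xs; congr EFin.
have {h} xB : x < - (B + 1) by rewrite ltNge; apply/negP => h'; apply: h; rewrite h' xs.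
apply/eqP; rewrite eq_le; apply/andP; split.
  have /andP[+ _] := lower_density_itv reg x c => h; exact: le_trans h (slice_cdf_ge reg x c).
rewrite -(lower_density_out reg (x := x) (c + 1)); last first.
  rewrite -normrN; apply: lt_le_trans (ler_norm _); rewrite ltrNr; apply: lt_trans xB _.
  by rewrite ltrN2 ltrDl.
by apply: (slice_cdf_le reg); rewrite ltrDl.
Qed.

(** Dynkin's theorem extends the formula from quadrants to Borel sets. *)
Lemma slice_disintegrates E : measurable E ->
  measurable_fun setT ((fun x => slice reg x E) : line -> \bar R) /\
  rho E = (\int[mu]_x slice reg x E)%E.
Proof.
have fin x A : measurable A -> slice reg x A \is a fin_num.
  move=> mA; rewrite ge0_fin_numE//; apply: le_lt_trans (_ : (slice reg x setT < +oo)%E).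
    by apply: le_measure; rewrite ?inE.
  by rewrite slice_T ltry.
pose P (A : set (R * R)) :=
  measurable_fun setT ((fun x => slice reg x A) : line -> \bar R) /\
  rho A = (\int[mu]_x slice reg x A)%E.
have PT : P setT.
  have [m1 i1] := slice_disintegrates_quadrant B B.
  have e x : slice reg x setT = slice reg x (quadrant B B).
    rewrite slice_T slice_quadrant (slice_cdf_high reg)//; case: ifPn => //.
    rewrite -ltNge => Bx; rewrite (lower_density_out reg)//.
    by apply: lt_le_trans Bx (ler_norm _).
  split; first by under eq_fun do rewrite e.
  under eq_integral do rewrite e.
  rewrite -i1; apply: (rho_eq_on_box reg) => //; first exact: measurable_quadrant.
  apply/seteqP; split => q [? bq]; split => //.
  by case: bq => /= ; rewrite !in_itv/= => /andP[_ ?] /andP[_ ?]; split.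
have Pint A : measurable A -> P A -> mu.-integrable setT (fun x => slice reg x A).
  move=> mA [mP iP]; apply/integrableP; split => //.
  under eq_integral do rewrite gee0_abs//.
  by rewrite -iP -ge0_fin_numE// (rho_fin rho).
move=> mE; apply: (@dynkin_induction _ _ quadrants P _ _ PT) => //.
- exact: measurable_quadrants.
- exact: quadrants_setI_closed.
- by move=> _ [s [c ->]]; exact: slice_disintegrates_quadrant.
- move=> A mA PA.
  have eC x : slice reg x (~` A) = (slice reg x setT - slice reg x A)%E.
    by rewrite -setTD measureD ?setTI//; rewrite -ge0_fin_numE// fin.
  split; first by under eq_fun do rewrite eC; apply: emeasurable_funB; [case: PT|case: PA].
  under eq_integral do rewrite eC.
  rewrite integralB//; [|exact: Pint..].
  by rewrite -PT.2 -PA.2 -setTD measureD ?setTI//; rewrite -ge0_fin_numE// (rho_fin rho).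
- move=> A_ mA tA PA.
  have eU x : slice reg x (\bigcup_k A_ k) = (\sum_(k <oo) slice reg x (A_ k))%E.
    by rewrite measure_semi_bigcup//; exact: bigcup_measurable.
  split.
    under eq_fun do rewrite eU.
    by apply: ge0_emeasurable_sum => // k _; case: (PA k).
  under eq_integral do rewrite eU.
  rewrite integral_nneseries//; last by move=> k; case: (PA k).
  rewrite measure_semi_bigcup//; last exact: bigcup_measurable.
  by apply: eq_eseriesr => k _; case: (PA k).
by rewrite -measurable_quadrants.
Qed.

End disintegration_formula.

(** * Proof of the theorem *)
Lemma regular_strips_lozi (R : realType) (a b : R) (M : set (R * R))
    (rho : probability (R * R)%type R) :
  hyperbolic a b -> compact M -> lozi a b @` M `<=` M° -> SRB_measure a b rho ->
  rho (~` attracting_set a b M) = 0%E ->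
  exists B, regular_strips rho (line_density a b) B.
Proof.
move=> hyp cM fM srb supp.
have [B [B0 bB]] := attracting_set_bounded a b cM.
exists B; split; first exact: ltW.
- apply/eqP; rewrite eq_le measure_ge0 andbT -supp; apply: le_measure.
  + by rewrite inE; apply: measurableC; exact: measurable_box.
  + by rewrite inE; apply: measurableC; exact: attracting_set_measurable.
  + apply: subsetC => q /bB[q1 q2].
    by split; rewrite /= in_itv/= -ler_norml.
- by move=> x c d; apply: (@strip_density_le _ a b M rho).
- by move=> x c; apply: (@strip_density_cvg _ a b M rho).
Qed.

Theorem theorem2p1 (R : realType) (a b : R) (M : set (R * R))
    (rho : probability (R * R)%type R)
    (hb0 : 0 < b) (hb : b < Num.min (a - Num.sqrt 2) (4 - 2 * a))
    (hM : compact M) (hfM : lozi a b @` M `<=` M°)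
    (hrho : SRB_measure a b rho)
    (hsupp : rho (~` attracting_set a b M) = 0%E) :
  exists rho_ : R -> {measure set (R * R)%type -> \bar R},
    [/\ (forall x : R, rho_ x (~` vertical_line x) = 0%E),
        (ereal_sup [set rho_ x (vertical_line x) | x in setT] < +oo)%E,
        (forall x : R, strip_limit rho x (rho_ x)),
        (forall E : set (R * R), measurable E ->
           measurable_fun setT (fun x : R => rho_ x (vertical_line x `&` E)) /\
           rho E = (\int[lebesgue_measure]_x rho_ x (vertical_line x `&` E))%E) &
        (forall (x : R) (nu : {measure set (R * R)%type -> \bar R}),
           strip_limit rho x nu ->
           forall E : set (R * R), measurable E -> nu E = rho_ x E)].
Proof.
have hyp := lozi_hyperbolic hb0 hb.
have [B reg] := regular_strips_lozi hyp hM hfM hrho hsupp.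
exists (fun x => slice reg x); split.
- by move=> x; exact: slice_off_line.
- apply: (@le_lt_trans _ _ (line_density a b)%:E); last exact: ltry.
  apply: ge_ereal_sup => _ [x _ <-].
  by rewrite -[vertical_line x]setIT slice_on_line; exact: slice_le.
- by move=> x; exact: slice_strip_limit.
- move=> E mE.
  have e : (fun x => slice reg x (vertical_line x `&` E)) = (fun x => slice reg x E).
    by apply/funext => x; exact: slice_on_line.
  by rewrite e; have [mS iS] := slice_disintegrates reg mE; split; [exact: mS|exact: iS].
- move=> x nu lim_nu E mE; apply/esym; apply: measure_unique_continuous mE.
    by apply: le_lt_trans (slice_le reg x) _; exact: ltry.
  move=> A cA bA.
  have lim_slice : strip_limit rho x (slice reg x) by exact: slice_strip_limit.
  exact (cvg_unique (@ereal_hausdorff R) (lim_slice A cA bA) (lim_nu A cA bA)).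
Qed.
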